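(* Let $2\le p<+\infty$ and let $f\in H^p\setminus\{0\}$. Let $M(y)=\int_{-\infty}^{+\infty}|f(x+iy)|^p\,dx$ for $y>0$. Assume the functions $\varphi:(0,+\infty)\to(-\infty,+\infty)$ and $h:(0,+\infty)\to(-\infty,+\infty)$ meet the conditions (i) $\varphi\in\mathcal{D}^3(0,+\infty)$ and $\varphi(y)=\int_1^y\varphi'(t)\,dt$ for all $y\in(0,+\infty)$; (ii) $\varphi'>0$ and $\varphi'^2\varphi''+\varphi\varphi'\varphi'''-2\varphi\varphi''^2\le 0$ on $(0,+\infty)$; (iii) $h(y)=\int_1^y\varphi'(t)M(t)\,dt$ for all $y\in(0,+\infty)$. Then $\frac{h}{\varphi}$ (extended to $y=1$ by continuity, i.e. by the value $\lim_{y\to1}\frac{h(y)}{\varphi(y)}=M(1)$) and $\log\frac{h}{\varphi}$ both belong to $\mathcal{D}^2(0,+\infty)$, and moreover $$\Bigl(\frac{h}{\varphi}\Bigr)'<0,\qquad \Bigl(\log\frac{h}{\varphi}\Bigr)''>0\qquad\text{on }(0,+\infty).$$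
   Context: For a non-empty open interval $I\subset\mathbb{R}$ and $n\ge 1$, $\mathcal{D}^n(I)$ denotes the class of all real-valued functions having a finite $n$-th derivative everywhere in $I$ (no continuity of the $n$-th derivative is required). $H^p$ is the Hardy space of the upper half-plane: the holomorphic functions $f$ on $\{z\in\mathbb{C}:\operatorname{Im}z>0\}$ with $\sup_{y>0}\int_{-\infty}^{+\infty}|f(x+iy)|^p\,dx<+\infty$. A prime denotes differentiation. *)

(* Defs.v *)
From HB Require Import structures.
From mathcomp Require Import all_boot all_order all_algebra.
From mathcomp Require Import all_classical all_reals all_analysis.
From mathcomp Require Export complex.

Set Implicit Arguments.
Unset Strict Implicit.
Unset Printing Implicit Defensive.

Import Order.TTheory GRing.Theory Num.Theory.
Import numFieldNormedType.Exports.

Local Open Scope ring_scope.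
Local Open Scope complex_scope.
Local Open Scope classical_set_scope.

(* Functions on a subset of [R] or [R[i]] are total functions whose values
   outside the subset are irrelevant. *)

(* As [I] is open, the derivatives at a point of [I] only depend on the values
   of [g] on [I]. *)
Definition Dclass (R : realType) (n : nat) (I : set R) (g : R -> R) : Prop :=
  forall k, (k < n)%N -> forall x, I x -> derivable (derive1n k g) x 1.

Definition upper_half_plane (R : realType) : set R[i] :=
  [set z | 0 < complex.Im z].

(* Complex differentiability: the scalar field is [R[i]], so the increments
   in the quotient defining [derivable] range over [R[i]]. *)
Definition holomorphic_on (R : realType) (U : set R[i]) (f : R[i] -> R[i]) :
    Prop :=
  forall z, U z -> derivable (f : R[i]^o -> R[i]^o) z 1.

Definition line_integral_pow (R : realType) (p : R) (f : R[i] -> R[i]) (y : R) :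
    \bar R :=
  (\int[@lebesgue_measure R]_x
     (ComplexField.Normc.normc (f (x +i* y)%C) `^ p)%:E)%E.

Definition hardy (R : realType) (p : R) : set (R[i] -> R[i]) :=
  [set f | holomorphic_on (@upper_half_plane R) f /\
    (ereal_sup [set line_integral_pow p f y | y in [set y : R | (0 < y)%R]]
       < +oo)%E].

Definition oriented_integral (R : realType) (a b : R) (g : R -> R) : R :=
  if a <= b then \int[@lebesgue_measure R]_(t in `[a, b]) g t
  else - \int[@lebesgue_measure R]_(t in `[b, a]) g t.

Definition extend_at (R : realType) (a v : R) (g : R -> R) : R -> R :=
  fun y => if y == a then v else g y.

(* Main.v *)
(* Write M for the mean and q = h / phi. By Cauchy's estimates and Young's
   inequality, f, f' and f'' near a horizontal line are dominated by a function
   whose p-th power is integrable, so M may be differentiated twice under the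
   integral sign. The line integrals being invariant under horizontal
   translations, M'' is the integral of the Laplacian p^2 |f|^(p-2) |f'|^2 of
   |f|^p, and l^2 M + 2 l M' + M'' >= 0 for all real l, because the integrand is
   nonnegative; hence M'^2 <= M M''. As M is moreover bounded, M > 0 and M' < 0.
   The rest is one-variable calculus: q' = phi' (M phi - h) / phi^2 < 0, and
   q q'' - q'^2 = phi'^2 h D / phi^4 where D tends to 0 at 1 and is nondecreasing
   on both sides of 1, by condition (ii) and the log-convexity of M. At the point
   1 itself the derivatives of q are read off second order expansions. *)

Require Import Defs.
From HB Require Import structures.
From mathcomp Require Import all_boot all_order all_algebra.
From mathcomp Require Import all_classical all_reals all_analysis.
From mathcomp Require Import measurable_realfun.
From mathcomp Require Import ring lra.

Set Implicit Arguments.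
Unset Strict Implicit.
Unset Printing Implicit Defensive.

Import Order.TTheory GRing.Theory Num.Theory.
Import numFieldNormedType.Exports.

Local Open Scope ring_scope.
Local Open Scope classical_set_scope.

Local Notation normc := ComplexField.Normc.normc.

(** * Derivatives of real functions *)

Section RealDerivative.
Variable R : realType.
Implicit Types (f g : R -> R) (x a b : R).

(** The assumption [2 <= p] enters through [r = p / 2 >= 1]: [|f|^p] is the power [r] of the smooth
    function [|f|^2], and such a power is twice differentiable along every line of the half-plane,
    even at the zeros of [f]. Domination has to be uniform under horizontal translation. Cauchy's
    estimates are therefore stated with the integral of [|f|] over the border of a rectangle that
    moves with [x]; the [p]-th power of this integral is controlled by the integral of [|f|^p] over
    the same border, which Tonelli's theorem integrates in [x]. Positivity of [M] starts at the
    height of one point where [f] does not vanish, and log-convexity carries it to all heights. No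
    continuity of [phi'''] or [M''] is available, so monotonicity comes from the mean value theorem
    and not from integrating derivatives. Finally, [D' >= 0] alone would give weak inequalities
    only; strictness comes from a neighbourhood of 1, where [D'] is bounded below by a function
    equivalent to a positive multiple of [(y - 1)^2]. *)

Lemma dvD f g x a b : is_derive x 1 f a -> is_derive x 1 g b ->
  is_derive x 1 (fun t => f t + g t) (a + b).
Proof. by move=> ? ?; exact: is_deriveD. Qed.

Lemma dvB f g x a b : is_derive x 1 f a -> is_derive x 1 g b ->
  is_derive x 1 (fun t => f t - g t) (a - b).
Proof. by move=> ? ?; exact: is_deriveB. Qed.

Lemma dvM f g x a b : is_derive x 1 f a -> is_derive x 1 g b ->
  is_derive x 1 (fun t => f t * g t) (a * g x + f x * b).
Proof.
move=> fa gb; have := is_deriveM fa gb.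
by rewrite addrC [g x *: a]mulrC.
Qed.

Lemma dv_cst (k : R) x : is_derive x 1 (fun=> k) 0.
Proof. exact: is_derive_cst. Qed.

Lemma dvZ k f x a : is_derive x 1 f a -> is_derive x 1 (fun t => k * f t) (k * a).
Proof. by move=> fa; have := dvM (dv_cst k x) fa; rewrite mul0r add0r. Qed.

Lemma dv_sqr f x a : is_derive x 1 f a -> is_derive x 1 (fun t => f t ^+ 2) (2 * f x * a).
Proof.
move=> fa; have := dvM fa fa; rewrite (_ : a * f x + f x * a = 2 * f x * a); last by ring.
by under eq_fun do rewrite -expr2.
Qed.

Lemma dvX n f x a : is_derive x 1 f a ->
  is_derive x 1 (fun t => f t ^+ n.+1) (n.+1%:R * f x ^+ n * a).
Proof.
move=> fa; elim: n => [|n IH]; first by rewrite mul1r expr0 mul1r.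
have := dvM fa IH; rewrite (_ : _ + _ = n.+2%:R * f x ^+ n.+1 * a); last first.
  by rewrite -[n.+2%:R]natr1 exprS; ring.
by under eq_fun do rewrite -exprS.
Qed.

Lemma dv_id x : is_derive x 1 (fun t : R => t) 1.
Proof. exact: is_derive_id. Qed.

Lemma dvV g x b : g x != 0 -> is_derive x 1 g b ->
  is_derive x 1 (fun t => (g t)^-1) (- (b / g x ^+ 2)).
Proof.
move=> gx [dg <-]; apply: DeriveDef; first exact: derivableV.
by rewrite (deriveV gx dg) /GRing.scale/= -[in LHS]exprVn mulNr mulrC exprVn.
Qed.

Lemma dvdiv f g x a b : g x != 0 -> is_derive x 1 f a -> is_derive x 1 g b ->
  is_derive x 1 (fun t => f t / g t) ((a * g x - f x * b) / g x ^+ 2).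
Proof.
move=> gx fa gb; have := dvM fa (dvV gx gb).
by congr is_derive; field.
Qed.

Lemma dv_comp f g x a b : is_derive (g x) 1 f a -> is_derive x 1 g b ->
  is_derive x 1 (fun t => f (g t)) (a * b).
Proof. by move=> fa gb; exact: is_derive1_comp. Qed.

Lemma dv_eq f x a b : is_derive x 1 f a -> a = b -> is_derive x 1 f b.
Proof. by move=> ? <-. Qed.

Lemma dv_cont f x a : is_derive x 1 f a -> {for x, continuous f}.
Proof. by case=> df _; exact/differentiable_continuous/derivable1_diffP. Qed.

Lemma dv_derive1 f x a : is_derive x 1 f a -> f^`() x = a.
Proof. by move=> [_ <-]; rewrite derive1E. Qed.

Lemma dv_near f g x a : is_derive x 1 f a -> (\forall t \near x, f t = g t) ->
  is_derive x 1 g a.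
Proof. by move=> fa fg; exact: near_eq_is_derive fg fa. Qed.

End RealDerivative.

(** * Complex derivatives *)

Section ComplexDerivative.
Variable R : realType.
Implicit Types (z w h l : R[i]) (f g : R[i] -> R[i]).

Lemma normc_norm z : `|z| = (normc z)%:C%C.
Proof. by []. Qed.

Lemma normc_ge0 z : 0 <= normc z.
Proof. by rewrite -lecR -normc_norm normr_ge0. Qed.

Lemma normcD z w : normc (z + w) <= normc z + normc w.
Proof. exact: le_normcD. Qed.

Lemma normcM z w : normc (z * w) = normc z * normc w.
Proof. exact: ComplexField.Normc.normcM. Qed.

Lemma normcV z : normc z^-1 = (normc z)^-1.
Proof. exact: ComplexField.Normc.normcV. Qed.

Lemma normcB z w : normc (z - w) <= normc z + normc w.
Proof. by rewrite -(normcN w) normcD. Qed.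

Lemma normc_gt0 z : (0 < normc z) = (z != 0).
Proof. by rewrite -ltcR -normc_norm normr_gt0. Qed.

Lemma normc_real (x : R) : normc x%:C%C = `|x|.
Proof. by rewrite /= expr0n /= addr0 sqrtr_sqr. Qed.

Lemma normc_imag (x : R) : normc (0 +i* x)%C = `|x|.
Proof. by rewrite /= expr0n /= add0r sqrtr_sqr. Qed.

Lemma normc_sqr z : normc z ^+ 2 = complex.Re z ^+ 2 + complex.Im z ^+ 2.
Proof. by case: z => a b /=; rewrite sqr_sqrtr// addr_ge0 ?sqr_ge0. Qed.

Lemma Re_le_normc z : `|complex.Re z| <= normc z.
Proof. by rewrite -lecR -normc_norm normc_ge_Re. Qed.

Lemma Im_le_normc z : `|complex.Im z| <= normc z.
Proof.
rewrite -sqrtr_sqr; case: z => a b /=.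
by apply: ler_wsqrtr; rewrite lerDr sqr_ge0.
Qed.

Lemma normc_le_ReIm z : normc z <= `|complex.Re z| + `|complex.Im z|.
Proof.
case: z => a b; have -> : (a +i* b = a%:C + (0 +i* b))%C.
  by rewrite /GRing.add /= addr0 add0r.
by apply: le_trans (normcD _ _) _; rewrite normc_real normc_imag /= addr0 add0r.
Qed.

(** The form without quotient includes [h = 0], and the real-valued [normc] turns every estimate
    into an inequality in [R]. *)
Definition has_cderiv f z l := forall e : R, 0 < e -> exists2 d : R, 0 < d &
  forall h, normc h < d -> normc (f (z + h) - f z - l * h) <= e * normc h.

Lemma derivable_has_cderiv f z :
  derivable (f : R[i]^o -> R[i]^o) z 1 -> exists l, has_cderiv f z l.
Proof.
move=> /cvg_ex[l fl]; exists l => e e0.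
have e0' : 0 < e%:C%C :> R[i] by rewrite ltcR.
move/cvgrPdist_le : fl => /(_ _ e0') /nbhs_ballP[d /= d0 hd].
(* The radius is an element of [R[i]]; being positive for the partial order, it is real. *)
have dE : d = (complex.Re d)%:C%C.
  by case: d d0 {hd} => a b; rewrite ltcE /= => /andP[/eqP -> _].
exists (complex.Re d); first by rewrite -ltcR -dE.
move=> h hltd; have [->|h0] := eqVneq h 0.
  by rewrite addr0 mulr0 subrr subr0 !ComplexField.Normc.normc0 mulr0.
have : ball (0 : R[i]^o) d h.
  by rewrite -ball_normE /ball_ /= sub0r normrN normc_norm dE ltcR.
move=> /hd /(_ h0); rewrite normc_norm lecR => H.
have -> : f (z + h) - f z - l * h = - (l - h^-1 * (f (h * 1 + z) - f z)) * h.
  by rewrite mulr1 (addrC h); field.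
by rewrite normcM normcN ler_wpM2r ?normc_ge0.
Qed.

Lemma has_cderiv_uniq f z l l' : has_cderiv f z l -> has_cderiv f z l' -> l = l'.
Proof.
move=> fl fl'; apply/eqP; rewrite -subr_eq0; apply/negPn/negP => ll'.
have ll0 : 0 < normc (l - l') by rewrite normc_gt0.
have e0 : 0 < normc (l - l') / 4 by rewrite divr_gt0.
have [d d0 hd] := fl _ e0; have [d' d'0 hd'] := fl' _ e0.
pose m := Num.min d d' / 2.
have m0 : 0 < m by rewrite divr_gt0 // lt_min d0.
have mm : m < Num.min d d' by rewrite /m ltr_pdivrMr // mulrDr mulr1 ltrDl lt_min d0.
have nm : normc m%:C%C = m by rewrite normc_real gtr0_norm.
have := hd m%:C%C; have := hd' m%:C%C; rewrite nm.
move: mm; rewrite lt_min => /andP[-> ->] /(_ isT) H1 /(_ isT) H2.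
have := normcB (f (z + m%:C%C) - f z - l' * m%:C%C) (f (z + m%:C%C) - f z - l * m%:C%C).
have -> : f (z + m%:C%C) - f z - l' * m%:C%C - (f (z + m%:C%C) - f z - l * m%:C%C)
  = (l - l') * m%:C%C by ring.
by rewrite normcM nm => H3; nra.
Qed.

Lemma has_cderiv_near f g z l : has_cderiv f z l ->
  (exists2 d : R, 0 < d & forall h, normc h < d -> g (z + h) = f (z + h)) ->
  has_cderiv g z l.
Proof.
move=> fl [d d0 gf] e e0; have [d' d'0 hd'] := fl e e0.
exists (Num.min d d'); first by rewrite lt_min d0.
move=> h; rewrite lt_min => /andP[hd hd'0].
have := gf 0; rewrite addr0 ComplexField.Normc.normc0 => ->//.
by rewrite gf//; exact: hd'.
Qed.

Definition ccont f z := forall e : R, 0 < e -> exists2 d : R, 0 < d &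
  forall h, normc h < d -> normc (f (z + h) - f z) <= e.

Lemma has_cderiv_ccont f z l : has_cderiv f z l -> ccont f z.
Proof.
move=> /(_ 1 ltr01)[d d0 hd] e e0.
have k0 : 0 < 1 + normc l by rewrite ltr_pwDl // normc_ge0.
exists (Num.min d (e / (1 + normc l))); first by rewrite lt_min d0 divr_gt0.
move=> h; rewrite lt_min ltr_pdivlMr// => /andP[/hd h1 h2].
have := normcD (f (z + h) - f z - l * h) (l * h).
rewrite subrK normcM; have := normc_ge0 h; nra.
Qed.

Lemma ccontD f g z : ccont f z -> ccont g z -> ccont (fun w => f w + g w) z.
Proof.
move=> hF hG e e0; have e2 : 0 < e / 2 by rewrite divr_gt0.
have [d d0 hd] := hF _ e2; have [d' d'0 hd'] := hG _ e2.
exists (Num.min d d'); rewrite ?lt_min ?d0// => s; rewrite lt_min => /andP[/hd h1 /hd' h2].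
by have := normcD (f (z + s) - f z) (g (z + s) - g z); rewrite opprD addrACA; lra.
Qed.

Lemma ccontZ (k : R[i]) f z : ccont f z -> ccont (fun w => k * f w) z.
Proof.
move=> hG e e0; have k0 := normc_ge0 k.
have e2 : 0 < e / (1 + normc k) by rewrite divr_gt0// ltr_pwDl.
have [d d0 hd] := hG _ e2; exists d => // s /hd.
rewrite -mulrBr normcM ler_pdivlMr ?ltr_pwDl//.
by have := normc_ge0 (f (z + s) - f z); nra.
Qed.

Lemma has_cderiv_cst (c : R[i]) z : has_cderiv (fun _ => c) z 0.
Proof.
move=> e e0; exists 1 => // h _.
by rewrite subrr mul0r subr0 ComplexField.Normc.normc0 mulr_ge0 ?normc_ge0// ltW.
Qed.

Lemma has_cderivM f g z l m : has_cderiv f z l -> has_cderiv g z m ->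
  has_cderiv (fun w => f w * g w) z (l * g z + f z * m).
Proof.
move=> fl gm e e0.
(* [K] bounds [|l|], [|f z|] and [1 + |g z|], so each of the three error terms below is at most
   [K a |h|], a third of the target. *)
pose K := 3 + normc (f z) + normc (g z) + normc l + normc m.
have [Kf Kg Kl Km] := And4 (normc_ge0 (f z)) (normc_ge0 (g z)) (normc_ge0 l) (normc_ge0 m).
have K0 : 0 < K by rewrite /K; lra.
pose a := Num.min 1 (e / (3 * K)).
have a0 : 0 < a by rewrite /a lt_min ltr01 divr_gt0// mulr_gt0.
have [d d0 hd] := fl a a0; have [d' d'0 hd'] := gm a a0.
have [d2 d20 hd2] := has_cderiv_ccont gm a0.
exists (Num.min (Num.min d d') d2); first by rewrite !lt_min d0 d'0 d20.
move=> h; rewrite !lt_min => /andP[/andP[/hd h1 /hd' h2] /hd2 h3].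
have -> : f (z + h) * g (z + h) - f z * g z - (l * g z + f z * m) * h =
  (f (z + h) - f z - l * h) * g (z + h) + l * h * (g (z + h) - g z)
  + f z * (g (z + h) - g z - m * h) by ring.
apply: le_trans (normcD _ _) _.
apply: le_trans (lerD (normcD _ _) (lexx _)) _; rewrite !normcM.
have gzh : normc (g (z + h)) <= 1 + normc (g z).
  rewrite -[g (z + h)](subrK (g z)); apply: le_trans (normcD _ _) _.
  rewrite lerD2r; apply: le_trans h3 _; by rewrite ge_min lexx.
have aK : a * (3 * K) <= e.
  by rewrite -ler_pdivlMr ?mulr_gt0// /a ge_min lexx orbT.
have [nh n1 n2 n3] := And4 (normc_ge0 h) (normc_ge0 (f (z + h) - f z - l * h))
  (normc_ge0 (g (z + h) - g z)) (normc_ge0 (g (z + h) - g z - m * h)).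
apply: (@le_trans _ _ (a * (3 * K) * normc h)); last by rewrite ler_wpM2r.
have e1 : normc (f (z + h) - f z - l * h) * normc (g (z + h)) <= a * normc h * K.
  by apply: ler_pM => //; [exact: normc_ge0|apply: le_trans gzh _; rewrite /K; lra].
have e2 : normc l * normc h * normc (g (z + h) - g z) <= K * normc h * a.
  by apply: ler_pM => //; [exact: mulr_ge0|apply: ler_wpM2r => //; rewrite /K; lra].
have e3 : normc (f z) * normc (g (z + h) - g z - m * h) <= K * (a * normc h).
  by apply: ler_pM => //; rewrite /K; lra.
by lra.
Qed.

Lemma has_cderiv_invB (z0 z : R[i]) : z != z0 ->
  has_cderiv (fun w => (w - z0)^-1) z (- (z - z0) ^- 2).
Proof.
move=> zz0 e e0.
have n0 : 0 < normc (z - z0) by rewrite normc_gt0 subr_eq0.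
set N := normc (z - z0) in n0 *.
(* The remainder is exactly [h^2 / ((z + h - z0) (z - z0)^2)]. The first radius keeps
   [|z + h - z0| >= N / 2]; the second makes [|h| / (N / 2 * N^2) <= e]. *)
exists (Num.min (N / 2) (e * N ^+ 3 / 2)).
  by rewrite lt_min !(divr_gt0, mulr_gt0, exprn_gt0).
move=> h; rewrite lt_min => /andP[h1 h2].
have Nh : N / 2 <= normc (z + h - z0).
  have := normcB (z + h - z0) h; have -> : z + h - z0 - h = z - z0 by ring.
  by rewrite -/N; lra.
have zh0 : z + h - z0 != 0 by rewrite -normc_gt0; lra.
have zn0 : z - z0 != 0 by rewrite subr_eq0.
have -> : (z + h - z0)^-1 - (z - z0)^-1 - - (z - z0) ^- 2 * h =
   h * h * ((z + h - z0)^-1 * ((z - z0)^-1 * (z - z0)^-1)) by field; apply/andP.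
rewrite !(normcM, normcV) -/N [leLHS](_ : _ = (normc h / (normc (z + h - z0) * N ^+ 2)) * normc h); last first.
  by field; rewrite !gt_eqF//; lra.
apply: ler_wpM2r; first exact: normc_ge0.
rewrite ler_pdivrMr; last by rewrite mulr_gt0 ?exprn_gt0//; lra.
apply: le_trans (ltW h2) _.
have -> : e * N ^+ 3 / 2 = e * (N / 2 * N ^+ 2) by field.
by rewrite ler_pM2l// ler_pM2r ?exprn_gt0.
Qed.

End ComplexDerivative.

(** * Contour integrals over rectangles *)

Section RealIntegrable.
Context d (T : measurableType d) (R : realType) (mu : {measure set T -> \bar R}).
Variables (D : set T) (mD : measurable D).
Implicit Types f g : T -> R.

Lemma integrable_realZ k f : mu.-integrable D (EFin \o f) ->
  mu.-integrable D (EFin \o (fun x => k * f x)).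
Proof. by move=> /(integrableZl mD k); apply: eq_integrable. Qed.

Lemma integrable_realD f g : mu.-integrable D (EFin \o f) ->
  mu.-integrable D (EFin \o g) -> mu.-integrable D (EFin \o (fun x => f x + g x)).
Proof. by move=> hf /(integrableD mD hf); apply: eq_integrable. Qed.

End RealIntegrable.

Section SegmentIntegral.
Variable R : realType.
Notation mu := (@lebesgue_measure R).
Implicit Types (a b t : R) (F G H : R -> R[i]).

Definition pcont G t := forall e : R, 0 < e -> exists2 d : R, 0 < d &
  forall s, `|s| < d -> normc (G (t + s) - G t) <= e.

(** Continuity is two-sided at the end points as well: the integrands are all restrictions of
    functions continuous beyond the segment. *)
Definition icont a b G := forall t, a <= t <= b -> pcont G t.

Lemma pcont_real G (p : R[i] -> R) t :
  (forall z w, `|p z - p w| <= normc (z - w)) -> pcont G t ->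
  {for t, continuous (p \o G)}.
Proof.
move=> pL Gt; apply/cvgrPdist_le => e /Gt[d d0 hd]; near=> s.
rewrite distrC; apply: le_trans (pL _ _) _ => /=.
rewrite -(subrKC t s); apply: hd.
rewrite distrC; near: s; exact: cvgr_dist_lt.
Unshelve. all: by end_near. Qed.

Lemma pcont_Re G t : pcont G t -> {for t, continuous (fun s => complex.Re (G s))}.
Proof.
apply: (pcont_real (p := @complex.Re R)) => z w.
by case: z w => ? ? [? ?]; exact: (Re_le_normc (_ +i* _)%C).
Qed.

Lemma pcont_Im G t : pcont G t -> {for t, continuous (fun s => complex.Im (G s))}.
Proof.
apply: (pcont_real (p := @complex.Im R)) => z w.
by case: z w => ? ? [? ?]; exact: (Im_le_normc (_ +i* _)%C).
Qed.

Lemma pcont_normc G t : pcont G t -> {for t, continuous (fun s => normc (G s))}.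
Proof.
move=> Gt; apply: (@pcont_real G (fun z => normc z) t _ Gt) => z w; rewrite ler_norml; apply/andP; split.
  by have := normcB z (z - w); rewrite opprB addrC subrK; lra.
by have := normcD (z - w) w; rewrite subrK; lra.
Qed.

Lemma pcontD F G t : pcont F t -> pcont G t -> pcont (fun s => F s + G s) t.
Proof.
move=> hF hG e e0; have e2 : 0 < e / 2 by rewrite divr_gt0.
have [d d0 hd] := hF _ e2; have [d' d'0 hd'] := hG _ e2.
exists (Num.min d d'); rewrite ?lt_min ?d0// => s; rewrite lt_min => /andP[/hd h1 /hd' h2].
by have := normcD (F (t + s) - F t) (G (t + s) - G t); rewrite opprD addrACA; lra.
Qed.

Lemma pcontZ (k : R[i]) G t : pcont G t -> pcont (fun s => k * G s) t.
Proof.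
move=> hG e e0; have k0 := normc_ge0 k.
have e2 : 0 < e / (1 + normc k) by rewrite divr_gt0// ltr_pwDl.
have [d d0 hd] := hG _ e2; exists d => // s /hd.
rewrite -mulrBr normcM ler_pdivlMr ?ltr_pwDl//.
by have := normc_ge0 (G (t + s) - G t); nra.
Qed.

Lemma pcontB F G t : pcont F t -> pcont G t -> pcont (fun s => F s - G s) t.
Proof.
move=> hF /(pcontZ (-1)) hG; have := pcontD hF hG.
by congr pcont; apply/funext => s; rewrite mulN1r.
Qed.

Lemma continuous_segment_integrable (g : R -> R) a b :
  (forall t, a <= t <= b -> {for t, continuous g}) ->
  mu.-integrable `[a, b] (EFin \o g).
Proof.
move=> gc; apply: continuous_compact_integrable; first exact: segment_compact.
apply: continuous_in_subspaceT => t; rewrite inE/= in_itv/=; exact: gc.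
Qed.

Lemma integrable_Re G a b : icont a b G ->
  mu.-integrable `[a, b] (EFin \o (fun s => complex.Re (G s))).
Proof. by move=> h; apply: continuous_segment_integrable => t /h/pcont_Re. Qed.

Lemma integrable_Im G a b : icont a b G ->
  mu.-integrable `[a, b] (EFin \o (fun s => complex.Im (G s))).
Proof. by move=> h; apply: continuous_segment_integrable => t /h/pcont_Im. Qed.

Lemma integrable_normc G a b : icont a b G ->
  mu.-integrable `[a, b] (EFin \o (fun s => normc (G s))).
Proof. by move=> h; apply: continuous_segment_integrable => t /h/pcont_normc. Qed.

Definition cint a b G : R[i] :=
  ((\int[mu]_(t in `[a, b]) complex.Re (G t)) +i*
   (\int[mu]_(t in `[a, b]) complex.Im (G t)))%C.

Lemma eq_cint a b F G : (forall t, a <= t <= b -> F t = G t) ->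
  cint a b F = cint a b G.
Proof.
move=> FG; rewrite /cint; congr (_ +i* _)%C; apply: eq_Rintegral => t;
  by rewrite inE/= in_itv/= => /FG ->.
Qed.

Lemma cintD a b F G : icont a b F -> icont a b G ->
  cint a b (fun t => F t + G t) = cint a b F + cint a b G.
Proof.
move=> hF hG; rewrite /cint [RHS]/GRing.add/=; congr (_ +i* _)%C.
  rewrite -RintegralD//; [|exact: integrable_Re..].
  by apply: eq_Rintegral => t _; case: (F t) (G t) => ? ? [].
rewrite -RintegralD//; [|exact: integrable_Im..].
by apply: eq_Rintegral => t _; case: (F t) (G t) => ? ? [].
Qed.

Lemma cintZ a b k G : icont a b G -> cint a b (fun t => k * G t) = k * cint a b G.
Proof.
move=> hG; have iR := integrable_Re hG; have iI := integrable_Im hG.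
case: k => k l; rewrite /cint [RHS]/GRing.mul/=; congr (_ +i* _)%C.
  rewrite -!RintegralZl// -RintegralB//; [|exact: integrable_realZ..].
  by apply: eq_Rintegral => t _; case: (G t).
rewrite -!RintegralZl// -RintegralD//; [|exact: integrable_realZ..].
by apply: eq_Rintegral => t _; case: (G t).
Qed.

Lemma cintB a b F G : icont a b F -> icont a b G ->
  cint a b (fun t => F t - G t) = cint a b F - cint a b G.
Proof.
move=> hF hG; rewrite -(mulN1r (cint a b G)) -cintZ// -cintD//.
  by apply: eq_cint => t _; rewrite mulN1r.
by move=> t /hG; exact: pcontZ.
Qed.

Lemma Rintegral_chasles (g : R -> R) a m b : a <= m <= b ->
  mu.-integrable `[a, b] (EFin \o g) ->
  \int[mu]_(t in `[a, b]) g t =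
  \int[mu]_(t in `[a, m]) g t + \int[mu]_(t in `[m, b]) g t.
Proof.
move=> /andP[am mb] ig.
rewrite -[X in _ + X]Rintegral_itv_obnd_cbnd.
  by rewrite -(Rintegral_itvB ig) ?bnd_simp// addrC subrK.
by apply: integrableS ig => //; apply: subset_itvr; rewrite bnd_simp.
Qed.

Lemma cint_chasles a m b G : a <= m <= b -> icont a b G ->
  cint a b G = cint a m G + cint m b G.
Proof.
move=> amb hG; rewrite /cint [RHS]/GRing.add/=; congr (_ +i* _)%C.
  by apply: Rintegral_chasles => //; exact: integrable_Re.
by apply: Rintegral_chasles => //; exact: integrable_Im.
Qed.

Lemma length_segment a b : a <= b -> fine (mu `[a, b]%classic) = b - a.
Proof.
rewrite lebesgue_measure_itv/= lte_fin le_eqVlt => /predU1P[->|->//].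
by rewrite ltxx subrr.
Qed.

Lemma Rintegral_segment_cst a b k : a <= b -> \int[mu]_(t in `[a, b]) k = k * (b - a).
Proof. by move=> ab; rewrite Rintegral_cst//= length_segment. Qed.

Lemma integrable_segment_cst a b k : mu.-integrable `[a, b] (EFin \o fun=> k).
Proof. by apply: continuous_segment_integrable => t _; exact: cvg_cst. Qed.

(** The factor 2 comes from estimating the real and imaginary parts separately. *)
Lemma normc_cint_le a b G (g : R -> R) : icont a b G ->
  mu.-integrable `[a, b] (EFin \o g) ->
  (forall t, a <= t <= b -> normc (G t) <= g t) ->
  normc (cint a b G) <= 2 * \int[mu]_(t in `[a, b]) g t.
Proof.
move=> hG ig Gg; apply: le_trans (normc_le_ReIm _) _ => /=.
rewrite mulr_natl mulr2n; apply: lerD.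
  apply: le_trans (le_normr_Rintegral _ _) _ => //; first exact: integrable_Re.
  apply: le_Rintegral => //; first exact/integrable_norm/integrable_Re.
  by move=> t; rewrite /= in_itv/= => /Gg; apply: le_trans; exact: Re_le_normc.
apply: le_trans (le_normr_Rintegral _ _) _ => //; first exact: integrable_Im.
apply: le_Rintegral => //; first exact/integrable_norm/integrable_Im.
by move=> t; rewrite /= in_itv/= => /Gg; apply: le_trans; exact: Im_le_normc.
Qed.

Lemma pcont_cst (k : R[i]) t : pcont (fun=> k) t.
Proof.
by move=> e e0; exists 1 => // s _; rewrite subrr ComplexField.Normc.normc0 ltW.
Qed.

Lemma cint_cst a b k : a <= b -> cint a b (fun=> k) = k * (b - a)%:C%C.
Proof.
move=> ab; rewrite /cint !Rintegral_segment_cst//.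
by case: k => k l; rewrite [RHS]/GRing.mul/=; congr (_ +i* _)%C; ring.
Qed.

Lemma cint_near a b G k e : a <= b -> icont a b G ->
  (forall t, a <= t <= b -> normc (G t - k) <= e) ->
  normc (cint a b G - k * (b - a)%:C%C) <= 2 * (e * (b - a)).
Proof.
move=> ab hG Ge; rewrite -cint_cst// -cintB//; last by move=> t _; exact: pcont_cst.
rewrite -Rintegral_segment_cst//; apply: normc_cint_le => //.
  by move=> t /hG ?; apply: pcontB => //; exact: pcont_cst.
exact: integrable_segment_cst.
Qed.

End SegmentIntegral.

Section RectangleIntegral.
Variable R : realType.
Notation mu := (@lebesgue_measure R).
Implicit Types (a b c d : R) (f g : R[i] -> R[i]) (z w : R[i]).

Definition onrect a b c d z :=
  a <= complex.Re z <= b /\ c <= complex.Im z <= d.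

Definition onborder a b c d z := onrect a b c d z /\
  [\/ complex.Re z = a, complex.Re z = b, complex.Im z = c | complex.Im z = d].

Definition bcont g a b c d := forall z, onborder a b c d z -> ccont g z.

Lemma pcont_line g (e : R[i]) (z : R -> R[i]) t : normc e = 1 ->
  (forall s, z (t + s) = z t + s%:C%C * e) ->
  ccont g (z t) -> pcont (fun s => g (z s)) t.
Proof.
move=> e1 zE gz k k0; have [d d0 hd] := gz k k0; exists d => // s sd.
by rewrite zE; apply: hd; rewrite normcM normc_real e1 mulr1.
Qed.

Lemma pcont_h g y t : ccont g (t +i* y)%C -> pcont (fun s => g (s +i* y)%C) t.
Proof.
apply: (@pcont_line g 1 (fun s => (s +i* y)%C)).
  exact: ComplexField.Normc.normc1.
by move=> s; rewrite mulr1 [RHS]/GRing.add/= addr0.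
Qed.

Lemma pcont_v g x t : ccont g (x +i* t)%C -> pcont (fun s => g (x +i* s)%C) t.
Proof.
apply: (@pcont_line g 'i%C (fun s => (x +i* s)%C)).
  by rewrite /= expr0n expr1n/= add0r sqrtr1.
by move=> s; rewrite [RHS]/GRing.add/=; congr (_ +i* _)%C; ring.
Qed.

Lemma icont_bottom g a b c d : c <= d -> bcont g a b c d ->
  icont a b (fun x => g (x +i* c)%C).
Proof.
move=> cd bg t tab; apply/pcont_h/bg; split; first by split => //=; rewrite lexx.
exact: Or43.
Qed.

Lemma icont_top g a b c d : c <= d -> bcont g a b c d ->
  icont a b (fun x => g (x +i* d)%C).
Proof.
move=> cd bg t tab; apply/pcont_h/bg; split; first by split => //=; rewrite lexx andbT.
exact: Or44.
Qed.

Lemma icont_left g a b c d : a <= b -> bcont g a b c d ->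
  icont c d (fun y => g (a +i* y)%C).
Proof.
move=> cd bg t tab; apply/pcont_v/bg; split; first by split => //=; rewrite lexx.
exact: Or41.
Qed.

Lemma icont_right g a b c d : a <= b -> bcont g a b c d ->
  icont c d (fun y => g (b +i* y)%C).
Proof.
move=> cd bg t tab; apply/pcont_v/bg; split; first by split => //=; rewrite lexx andbT.
exact: Or42.
Qed.

(* The contour integral over the boundary of [a, b] x [c, d], opposite sides
   being put together: then both integrands are constant when g is affine. *)
Definition rectint g a b c d : R[i] :=
  cint a b (fun x => g (x +i* c)%C - g (x +i* d)%C) +
  'i%C * cint c d (fun y => g (b +i* y)%C - g (a +i* y)%C).

Lemma bcont_icont g a b c d : a <= b -> c <= d -> bcont g a b c d ->
  icont a b (fun x => g (x +i* c)%C - g (x +i* d)%C) /\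
  icont c d (fun y => g (b +i* y)%C - g (a +i* y)%C).
Proof.
move=> ab cd bg; split => t ht; apply: pcontB.
- exact: icont_bottom bg _ ht.
- exact: icont_top bg _ ht.
- exact: icont_right bg _ ht.
- exact: icont_left bg _ ht.
Qed.

Lemma eq_rectint f g a b c d : a <= b -> c <= d ->
  (forall z, onborder a b c d z -> f z = g z) ->
  rectint f a b c d = rectint g a b c d.
Proof.
move=> ab cd fg; rewrite /rectint; congr (_ + _ * _); apply: eq_cint => t ht.
  by congr (_ - _); apply: fg; split; rewrite /onrect/= ?lexx ?cd ?ht//; [exact: Or43|exact: Or44].
by congr (_ - _); apply: fg; split; rewrite /onrect/= ?lexx ?ab ?ht//; [exact: Or42|exact: Or41].
Qed.

Lemma rectint_lin f g k a b c d : a <= b -> c <= d ->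
  bcont f a b c d -> bcont g a b c d ->
  rectint (fun z => f z + k * g z) a b c d = rectint f a b c d + k * rectint g a b c d.
Proof.
move=> ab cd bf bg; have [f1 f2] := bcont_icont ab cd bf.
have [g1 g2] := bcont_icont ab cd bg.
rewrite /rectint.
have E p q r s : p + k * q - (r + k * s) = (p - r) + k * (q - s) by ring.
rewrite (eq_cint (a := a) (G := fun x => (f (x +i* c)%C - f (x +i* d)%C)
  + k * (g (x +i* c)%C - g (x +i* d)%C))); last by move=> t _; rewrite E.
rewrite (eq_cint (a := c) (G := fun y => (f (b +i* y)%C - f (a +i* y)%C)
  + k * (g (b +i* y)%C - g (a +i* y)%C))); last by move=> t _; rewrite E.
have kg1 := fun t ht => pcontZ k (g1 t ht); have kg2 := fun t ht => pcontZ k (g2 t ht).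
by rewrite (cintD f1 kg1) (cintD f2 kg2) (cintZ _ g1) (cintZ _ g2); ring.
Qed.

Lemma rectint_split_x g a m b c d : a <= m <= b -> c <= d ->
  bcont g a m c d -> bcont g m b c d ->
  rectint g a b c d = rectint g a m c d + rectint g m b c d.
Proof.
move=> /andP[am mb] cd b1 b2.
have [h1 v1] := bcont_icont am cd b1; have [h2 v2] := bcont_icont mb cd b2.
rewrite /rectint (@cint_chasles _ a m b) ?am//; last first.
  move=> t /andP[aT tb]; have [tm|mt] := leP t m; first by apply: h1; rewrite aT.
  by apply: h2; rewrite (ltW mt).
rewrite (eq_cint (a := c) (G := fun y => (g (m +i* y)%C - g (a +i* y)%C)
  + (g (b +i* y)%C - g (m +i* y)%C))); last by move=> t _; ring.
by rewrite (cintD v1 v2); ring.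
Qed.

Lemma rectint_split_y g a b c m d : a <= b -> c <= m <= d ->
  bcont g a b c m -> bcont g a b m d ->
  rectint g a b c d = rectint g a b c m + rectint g a b m d.
Proof.
move=> ab /andP[cm md] b1 b2.
have [h1 v1] := bcont_icont ab cm b1; have [h2 v2] := bcont_icont ab md b2.
rewrite /rectint (@cint_chasles _ c m d) ?cm//; last first.
  move=> t /andP[ct td]; have [tm|mt] := leP t m; first by apply: v1; rewrite ct.
  by apply: v2; rewrite (ltW mt).
rewrite (eq_cint (a := a) (G := fun x => (g (x +i* c)%C - g (x +i* m)%C)
  + (g (x +i* m)%C - g (x +i* d)%C))); last by move=> t _; ring.
by rewrite (cintD h1 h2); ring.
Qed.

Lemma normc_i : normc ('i%C : R[i]) = 1.
Proof. by rewrite normc_imag normr1. Qed.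

Lemma rectint_le g a b c d e : a <= b -> c <= d -> bcont g a b c d ->
  (forall z, onborder a b c d z -> normc (g z) <= e) ->
  normc (rectint g a b c d) <= 4 * e * ((b - a) + (d - c)).
Proof.
move=> ab cd bg ge; have [h v] := bcont_icont ab cd bg.
have h1 : normc (cint a b (fun x => g (x +i* c)%C - g (x +i* d)%C) - 0 * (b - a)%:C%C)
    <= 2 * ((e + e) * (b - a)).
  apply: cint_near => // t tab; rewrite subr0.
  apply: le_trans (normcB _ _) _; apply: lerD; apply: ge; split;
   rewrite /onrect/= ?lexx ?cd ?tab//; [exact: Or43|exact: Or44].
have h2 : normc (cint c d (fun y => g (b +i* y)%C - g (a +i* y)%C) - 0 * (d - c)%:C%C)
    <= 2 * ((e + e) * (d - c)).
  apply: cint_near => // t tab; rewrite subr0.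
  apply: le_trans (normcB _ _) _; apply: lerD; apply: ge; split;
   rewrite /onrect/= ?lexx ?ab ?tab//; [exact: Or42|exact: Or41].
move: h1 h2; rewrite !mul0r !subr0 => h1 h2.
apply: le_trans (normcD _ _) _; rewrite normcM normc_i mul1r; lra.
Qed.

Lemma ReB z w : complex.Re (z - w) = complex.Re z - complex.Re w.
Proof. by case: z w => ? ? []. Qed.

Lemma ImB z w : complex.Im (z - w) = complex.Im z - complex.Im w.
Proof. by case: z w => ? ? []. Qed.

Lemma normc_diag a b c d z w : onrect a b c d z -> onrect a b c d w ->
  normc (w - z) <= (b - a) + (d - c).
Proof.
move=> [/andP[? ?] /andP[? ?]] [/andP[? ?] /andP[? ?]].
apply: le_trans (normc_le_ReIm _) _.
rewrite ReB ImB.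
by apply: lerD; rewrite ler_norml; apply/andP; split; lra.
Qed.

(** The affine part [g z + l (w - z)] drops out: on opposite sides its values differ by the
    constants [l * (0 +i* (c - d))] and [l * (b - a)], whose integrals cancel after multiplication
    of the second by ['i]. Only the remainder is left, at most [e] times the half-perimeter. *)
Lemma rectint_local g a b c d z l e : a <= b -> c <= d -> bcont g a b c d ->
  onrect a b c d z ->
  (forall w, onborder a b c d w -> normc (g w - g z - l * (w - z)) <= e * normc (w - z)) ->
  0 <= e ->
  normc (rectint g a b c d) <= 8 * e * ((b - a) + (d - c)) ^+ 2.
Proof.
move=> ab cd bg zQ hl e0.
have [h v] := bcont_icont ab cd bg.
have bnd w : onborder a b c d w ->
    normc (g w - g z - l * (w - z)) <= e * ((b - a) + (d - c)).
  move=> wQ; apply: le_trans (hl w wQ) _; apply: ler_wpM2l => //.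
  by apply: normc_diag => //; case: wQ.
have h1 : normc (cint a b (fun x => g (x +i* c)%C - g (x +i* d)%C)
    - l * (0 +i* (c - d))%C * (b - a)%:C%C)
    <= 2 * ((e * ((b - a) + (d - c)) + e * ((b - a) + (d - c))) * (b - a)).
  apply: cint_near => // t tab.
  have -> : g (t +i* c)%C - g (t +i* d)%C - l * (0 +i* (c - d))%C =
    (g (t +i* c)%C - g z - l * ((t +i* c)%C - z)) -
    (g (t +i* d)%C - g z - l * ((t +i* d)%C - z)).
    have -> : (0 +i* (c - d))%C = (t +i* c)%C - (t +i* d)%C :> R[i].
      by rewrite [RHS]/GRing.add/= subrr.
    by ring.
  apply: le_trans (normcB _ _) _; apply: lerD; apply: bnd; split;
   rewrite /onrect/= ?lexx ?cd ?tab//; [exact: Or43|exact: Or44].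
have h2 : normc (cint c d (fun y => g (b +i* y)%C - g (a +i* y)%C)
    - l * (b - a)%:C%C * (d - c)%:C%C)
    <= 2 * ((e * ((b - a) + (d - c)) + e * ((b - a) + (d - c))) * (d - c)).
  apply: cint_near => // t tab.
  have -> : g (b +i* t)%C - g (a +i* t)%C - l * (b - a)%:C%C =
    (g (b +i* t)%C - g z - l * ((b +i* t)%C - z)) -
    (g (a +i* t)%C - g z - l * ((a +i* t)%C - z)).
    have -> : (b - a)%:C%C = (b +i* t)%C - (a +i* t)%C :> R[i].
      by rewrite [RHS]/GRing.add/= subrr.
    by ring.
  apply: le_trans (normcB _ _) _; apply: lerD; apply: bnd; split;
   rewrite /onrect/= ?lexx ?ab ?tab//; [exact: Or42|exact: Or41].
have -> : rectint g a b c d =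
  (cint a b (fun x => g (x +i* c)%C - g (x +i* d)%C)
    - l * (0 +i* (c - d))%C * (b - a)%:C%C) + 'i%C *
  (cint c d (fun y => g (b +i* y)%C - g (a +i* y)%C)
    - l * (b - a)%:C%C * (d - c)%:C%C).
  have -> : (0 +i* (c - d))%C = - ('i%C * (d - c)%:C%C) :> R[i].
    by apply/eqP; rewrite eq_complex/=; apply/andP; split; apply/eqP; ring.
  by rewrite /rectint; ring.
apply: le_trans (normcD _ _) _; rewrite normcM normc_i mul1r.
apply: le_trans (lerD h1 h2) _.
rewrite [leLHS](_ : _ = 4 * e * ((b - a) + (d - c)) ^+ 2); last by ring.
by have := sqr_ge0 (b - a + (d - c)); nra.
Qed.

End RectangleIntegral.

(** * The theorems of Goursat and Cauchy *)

Section Goursat.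
Variable R : realType.
Implicit Types (a b c d : R) (f g : R[i] -> R[i]) (z w : R[i]).

(** Nested rectangles: the lower left corners have nondecreasing bounded coordinates, whose suprema
    [X] and [Y] lie in every rectangle. The invariant [P] carries along whatever makes the chosen
    piece bad. *)
Lemma bisection (P : nat -> R -> R -> Prop) (w h x0 y0 : R) : 0 <= w -> 0 <= h ->
  P 0 x0 y0 ->
  (forall n x y, P n x y -> exists x' y', [/\ P n.+1 x' y',
    x <= x' <= x + w / 2 ^+ n.+1 & y <= y' <= y + h / 2 ^+ n.+1]) ->
  exists X Y, forall n, exists x y, [/\ P n x y,
    x <= X <= x + w / 2 ^+ n & y <= Y <= y + h / 2 ^+ n].
Proof.
move=> w0 h0 P0 Pstep.
(* Where [P] fails the corner is kept, a default that [sP] shows never to occur. *)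
have next n (p : R * R) : {q : R * R | P n p.1 p.2 -> [/\ P n.+1 q.1 q.2,
    p.1 <= q.1 <= p.1 + w / 2 ^+ n.+1 & p.2 <= q.2 <= p.2 + h / 2 ^+ n.+1]}.
  apply: cid; have [/Pstep [x' [y' H]]|nP] := pselect (P n p.1 p.2).
    by exists (x', y').
  by exists p.
pose s := fix s n := if n is m.+1 then sval (next m (s m)) else (x0, y0).
have sP n : P n (s n).1 (s n).2.
  by elim: n => [|n IH] //=; case: (svalP (next n (s n)) IH).
have half (v : R) n : v / 2 ^+ n = v / 2 ^+ n.+1 + v / 2 ^+ n.+1.
  by rewrite exprS invfM; field; rewrite expf_neq0.
have nest (u : nat -> R) (v : R) : 0 <= v ->
    (forall n, u n <= u n.+1 <= u n + v / 2 ^+ n.+1) ->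
    exists U, forall n, u n <= U <= u n + v / 2 ^+ n.
  move=> v0 hu.
  have mon n k : u n <= u (n + k)%N.
    elim: k => [|k IH]; rewrite ?addn0// addnS (le_trans IH)//.
    by case/andP: (hu (n + k)%N).
  have mon' n k : u (n + k)%N + v / 2 ^+ (n + k) <= u n + v / 2 ^+ n.
    elim: k => [|k IH]; rewrite ?addn0// addnS (le_trans _ IH)//.
    by rewrite [in leRHS]half addrA lerD2r; case/andP: (hu (n + k)%N).
  have ub n m : u m <= u n + v / 2 ^+ n.
    have [mn|nm] := leqP m n.
      apply: (@le_trans _ _ (u n)); first by rewrite -(subnKC mn).
      by rewrite lerDl divr_ge0// exprn_ge0.
    apply: le_trans (mon' n (m - n)%N); rewrite subnKC 1?ltnW//.
    by rewrite lerDl divr_ge0// exprn_ge0.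
  exists (sup (range u)) => n; apply/andP; split.
    apply: ub_le_sup; last by exists n.
    by exists (u 0 + v / 2 ^+ 0) => _ [m _ <-].
  by apply: ge_sup; [exists (u 0), 0|move=> _ [m _ <-]].
have [n|X hX] := nest (fun n => (s n).1) w w0.
  by case: (svalP (next n (s n)) (sP n)).
have [n|Y hY] := nest (fun n => (s n).2) h h0.
  by case: (svalP (next n (s n)) (sP n)).
by exists X, Y => n; exists (s n).1, (s n).2; split.
Qed.

Lemma onborderW a b c d z : onborder a b c d z -> onrect a b c d z.
Proof. by case. Qed.

Lemma exists_div_expn (x e : R) : 0 < e -> exists n, x / 2 ^+ n < e.
Proof.
move=> e0; exists (Num.bound (`|x| / e)).
rewrite ltr_pdivrMr ?exprn_gt0//; apply: le_lt_trans (ler_norm x) _.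
rewrite mulrC -ltr_pdivrMr//.
apply: lt_trans (archi_boundP _) _; first by rewrite divr_ge0// ltW.
by rewrite -natrX ltr_nat ltn_expl.
Qed.

Lemma rectint_quarters g (x y w' h' : R) : 0 <= w' -> 0 <= h' ->
  (forall z, onrect x (x + (w' + w')) y (y + (h' + h')) z -> ccont g z) ->
  rectint g x (x + (w' + w')) y (y + (h' + h')) =
  rectint g x (x + w') y (y + h') + rectint g x (x + w') (y + h') (y + h' + h') +
  (rectint g (x + w') (x + w' + w') y (y + h') +
   rectint g (x + w') (x + w' + w') (y + h') (y + h' + h')).
Proof.
move=> w0 h0 gc; rewrite !(addrA _ w') !(addrA _ h').
have xw : x <= x + w' <= x + w' + w' by lra.
have yh : y <= y + h' <= y + h' + h' by lra.
have bc x1 x2 y1 y2 : x <= x1 -> x2 <= x + w' + w' -> y <= y1 ->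
   y2 <= y + h' + h' -> bcont g x1 x2 y1 y2.
  move=> h1 h2 h3 h4 z /onborderW[/andP[h5 h6] /andP[h7 h8]]; apply: gc.
  rewrite !(addrA _ w') !(addrA _ h').
  by split; apply/andP; split; [exact: le_trans h5|exact: le_trans h2|
    exact: le_trans h7|exact: le_trans h4].
have [xw1 xw2] := andP xw; have [yh1 yh2] := andP yh.
have yh3 := le_trans yh1 yh2; have xw3 := le_trans xw1 xw2.
rewrite (rectint_split_x xw yh3 (bc _ _ _ _ _ _ _ _) (bc _ _ _ _ _ _ _ _))//.
rewrite (rectint_split_y xw1 yh (bc _ _ _ _ _ _ _ _) (bc _ _ _ _ _ _ _ _))//.
by rewrite (rectint_split_y xw2 yh (bc _ _ _ _ _ _ _ _) (bc _ _ _ _ _ _ _ _)).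
Qed.

Lemma normc_sum4 (B : R) z1 z2 z3 z4 : 4 * B < normc (z1 + z2 + (z3 + z4)) ->
  [\/ B < normc z1, B < normc z2, B < normc z3 | B < normc z4].
Proof.
move=> h; have [q1|q1] := ltP B (normc z1); first exact: Or41.
have [q2|q2] := ltP B (normc z2); first exact: Or42.
have [q3|q3] := ltP B (normc z3); first exact: Or43.
have [q4|q4] := ltP B (normc z4); first exact: Or44.
have := normcD (z1 + z2) (z3 + z4); have := normcD z1 z2; have := normcD z3 z4; lra.
Qed.

(** If the integral exceeds [e L^2], one of the four quarters exceeds [e (L / 2)^2], and so on;
    differentiability at the common point of the nested rectangles contradicts this at a small
    scale. *)
Lemma goursat g a b c d : a <= b -> c <= d ->
  (forall z, onrect a b c d z -> exists l, has_cderiv g z l) ->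
  rectint g a b c d = 0.
Proof.
move=> ab cd dg; set L := (b - a) + (d - c).
have gc z : onrect a b c d z -> ccont g z by move=> /dg[l]; exact: has_cderiv_ccont.
have L0 : 0 <= L by rewrite /L addr_ge0// subr_ge0.
suff main e : 0 < e -> normc (rectint g a b c d) <= e * L ^+ 2.
  apply/eqP/negPn/negP; rewrite -normc_gt0 => n0.
  have e0 : 0 < normc (rectint g a b c d) / (2 * (1 + L ^+ 2)).
    by rewrite divr_gt0// mulr_gt0// ltr_pwDl// sqr_ge0.
  have := main _ e0; apply/negP; rewrite -ltNge mulrAC ltr_pdivrMr.
    by have := sqr_ge0 L; nra.
  by rewrite mulr_gt0// ltr_pwDl// sqr_ge0.
move=> e0; rewrite leNgt; apply/negP => bad.
have w0 : 0 <= b - a by rewrite subr_ge0.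
have h0 : 0 <= d - c by rewrite subr_ge0.
pose P n x y := [/\ a <= x, x + (b - a) / 2 ^+ n <= b, c <= y,
  y + (d - c) / 2 ^+ n <= d &
  e * (L / 2 ^+ n) ^+ 2 <
  normc (rectint g x (x + (b - a) / 2 ^+ n) y (y + (d - c) / 2 ^+ n))].
have [||X [Y hXY]] := @bisection P (b - a) (d - c) a c w0 h0.
- by rewrite /P !expr0 !divr1 !lexx !subrKC; split.
- move=> n x y [ax xb cy yd badn].
  have [w wE] : exists w : R, w = (b - a) / 2 ^+ n.+1 by exists ((b - a) / 2 ^+ n.+1).
  have [h hE] : exists h : R, h = (d - c) / 2 ^+ n.+1 by exists ((d - c) / 2 ^+ n.+1).
  have half (v : R) : v / 2 ^+ n = v / 2 ^+ n.+1 + v / 2 ^+ n.+1.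
    by rewrite exprS invfM; field; rewrite expf_neq0.
  rewrite (half (b - a)) (half (d - c)) -wE -hE in xb yd badn.
  have w1 : 0 <= w by rewrite wE divr_ge0// exprn_ge0.
  have h1 : 0 <= h by rewrite hE divr_ge0// exprn_ge0.
  have gcn z : onrect x (x + (w + w)) y (y + (h + h)) z -> ccont g z.
    move=> [/andP[h2 h3] /andP[h4 h5]]; apply: gc; split; apply/andP; split;
    [exact: le_trans h2|exact: le_trans xb|exact: le_trans h4|exact: le_trans yd].
  have LE : e * (L / 2 ^+ n) ^+ 2 = 4 * (e * (L / 2 ^+ n.+1) ^+ 2).
    by rewrite (half L); ring.
  rewrite LE (rectint_quarters w1 h1 gcn) in badn.
  have [B BE] : exists B : R, B = e * (L / 2 ^+ n.+1) ^+ 2 by exists (e * (L / 2 ^+ n.+1) ^+ 2).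
  rewrite -BE in badn; have {}badn := normc_sum4 badn.
  have axw : a <= x + w by rewrite (le_trans ax)// lerDl.
  have cyh : c <= y + h by rewrite (le_trans cy)// lerDl.
  have [xw yh] : x + w <= b /\ y + h <= d.
    by rewrite (le_trans _ xb) ?(le_trans _ yd)// lerD2l lerDl.
  rewrite addrA in xb; rewrite addrA in yd.
  have bnd (u v : R) : 0 <= v -> (u <= u <= u + v) /\ (u <= u + v <= u + v).
    by move=> v0; rewrite !lexx lerDl v0.
  have [hx hx'] := bnd x w w1; have [hy hy'] := bnd y h h1.
  rewrite /P -wE -hE -BE; case: badn => q.
  - by exists x, y.
  - by exists x, (y + h).
  - by exists (x + w), y.
  - by exists (x + w), (y + h).
have zQ : onrect a b c d (X +i* Y)%C.
  have [x [y [[h1 h2 h3 h4 _] /andP[h5 h6] /andP[h7 h8]]]] := hXY 0.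
  by split; apply/andP; split => /=; [exact: le_trans h5|exact: le_trans h2|
    exact: le_trans h7|exact: le_trans h4].
have [l dl] := dg _ zQ.
(* Any divisor at least the constant 8 of [rectint_local] contradicts [badn]. *)
have e9 : 0 < e / 9 by rewrite divr_gt0.
have [r r0 hr] := dl _ e9.
have [n Ln] := exists_div_expn L r0.
have [x [y [[ax xb cy yd badn] hX hY]]] := hXY n.
have p0 : 0 <= (2 ^+ n)^-1 :> R by rewrite invr_ge0 exprn_ge0.
have zQn : onrect x (x + (b - a) / 2 ^+ n) y (y + (d - c) / 2 ^+ n) (X +i* Y)%C by [].
have Ln' : x + (b - a) / 2 ^+ n - x + (y + (d - c) / 2 ^+ n - y) = L / 2 ^+ n.
  by rewrite /L; ring.
move: badn; apply/negP; rewrite -leNgt.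
apply: le_trans (rectint_local (z := (X +i* Y)%C) (l := l) (e := e / 9) _ _ _ _ _ _) _ => //.
- by rewrite lerDl mulr_ge0.
- by rewrite lerDl mulr_ge0.
- move=> z /onborderW[/andP[h1 h2] /andP[h3 h4]]; apply: gc.
  by split; apply/andP; split; [exact: le_trans h1|exact: le_trans xb|
    exact: le_trans h3|exact: le_trans yd].
- move=> z /onborderW zn; rewrite -{1}(subrKC (X +i* Y)%C z); apply: hr.
  by apply: le_lt_trans Ln; rewrite -Ln'; exact: normc_diag.
- exact: ltW.
- by rewrite Ln'; have := sqr_ge0 (L / 2 ^+ n); nra.
Qed.

End Goursat.

Section Cauchy.
Variable R : realType.
Notation mu := (@lebesgue_measure R).
Implicit Types (a b c d e x y : R) (f g : R[i] -> R[i]) (z w : R[i]).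

Definition inrect a b c d z :=
  a < complex.Re z < b /\ c < complex.Im z < d.

Lemma inrectW a b c d z : inrect a b c d z -> onrect a b c d z.
Proof. by case=> /andP[? ?] /andP[? ?]; split; rewrite !ltW. Qed.

Lemma onborder_neq a b c d z w : inrect a b c d z -> onborder a b c d w -> w != z.
Proof.
move=> [/andP[? ?] /andP[? ?]] [_ h]; apply/eqP => wz.
by rewrite wz in h; case: h; lra.
Qed.

Lemma ReZ k z : complex.Re (k%:C%C * z) = k * complex.Re z.
Proof. by case: z => ? ? /=; ring. Qed.

(** Two vertical and then two horizontal cuts isolate the small square; the four pieces removed
    avoid [z], so Goursat's theorem makes their integrals vanish. *)
Lemma excision g z a b c d e : 0 < e ->
  a <= complex.Re z - e -> complex.Re z + e <= b ->
  c <= complex.Im z - e -> complex.Im z + e <= d ->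
  (forall w, onrect a b c d w -> w != z -> exists l, has_cderiv g w l) ->
  rectint g a b c d = rectint g (complex.Re z - e) (complex.Re z + e)
                              (complex.Im z - e) (complex.Im z + e).
Proof.
set x := complex.Re z; set y := complex.Im z => e0 ax xb cy yd dg.
have dg' w : onrect a b c d w -> complex.Re w != x \/ complex.Im w != y ->
    exists l, has_cderiv g w l.
  by move=> wQ wz; apply: dg => //; apply/eqP => wE; case: wz; rewrite wE eqxx.
have bc a1 b1 c1 d1 : a <= a1 -> b1 <= b -> c <= c1 -> d1 <= d ->
    a1 != x -> b1 != x -> c1 != y -> d1 != y -> bcont g a1 b1 c1 d1.
  move=> ? ? ? ? ? ? ? ? w [[/andP[? ?] /andP[? ?]] hw].
  have [||l] := dg' w; last exact: has_cderiv_ccont.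
    by split; apply/andP; split; lra.
  by case: hw => ->; [left|left|right|right].
have z0 a1 b1 c1 d1 : a <= a1 -> b1 <= b -> c <= c1 -> d1 <= d -> a1 <= b1 -> c1 <= d1 ->
    [\/ b1 < x, x < a1, d1 < y | y < c1] -> rectint g a1 b1 c1 d1 = 0.
  move=> ? ? ? ? ? ? hw; apply: goursat => // w [/andP[? ?] /andP[? ?]].
  apply: dg'; first by split; apply/andP; split; lra.
  by case: hw => ?; [left|left|right|right]; apply/eqP; lra.
rewrite (@rectint_split_x _ _ a (x - e) b); [|lra|lra|apply: bc; lra|apply: bc; lra].
rewrite [X in X + _]z0 ?add0r; [|lra..|by apply: Or41; lra].
rewrite (@rectint_split_x _ _ (x - e) (x + e) b); [|lra|lra|apply: bc; lra|apply: bc; lra].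
rewrite [X in _ + X]z0 ?addr0; [|lra..|by apply: Or42; lra].
rewrite (@rectint_split_y _ _ _ _ c (y - e) d); [|lra|lra|apply: bc; lra|apply: bc; lra].
rewrite [X in X + _]z0 ?add0r; [|lra..|by apply: Or43; lra].
rewrite (@rectint_split_y _ _ _ _ (y - e) (y + e) d); [|lra|lra|apply: bc; lra|apply: bc; lra].
rewrite [X in _ + X]z0 ?addr0; [|lra..|by apply: Or44; lra].
by [].
Qed.

(** On opposite sides of a square of half-side [e] centered at [z], the values of [1 / (w - z)]
    differ by this kernel, up to a factor ['i] for the horizontal sides. *)
Lemma Rintegral_atan x e : 0 < e ->
  \int[mu]_(t in `[x - e, x + e]) (2 * e / ((t - x) ^+ 2 + e ^+ 2)) = 4 * atan 1.
Proof.
move=> e0; pose F t := 2 * atan ((t - x) / e).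
have dF (t : R) : is_derive t (1 : R) F (2 * e / ((t - x) ^+ 2 + e ^+ 2)).
  have h := dvM (dvB (dv_id t) (dv_cst x t)) (dv_cst e^-1 t).
  apply: dv_eq (dvZ 2 (dv_comp (is_derive1_atan _) h)) _.
  have : 0 < (t - x) ^+ 2 + e ^+ 2 by rewrite ltr_wpDl ?sqr_ge0// exprn_gt0.
  have : 0 < 1 + ((t - x) / e) ^+ 2 by rewrite ltr_pwDl// sqr_ge0.
  by move=> h1 h2; field; rewrite !gt_eqF//; rewrite addrC.
have cF t : {for t, continuous F} by exact: dv_cont (dF t).
rewrite /Rintegral (@continuous_FTC2 _ _ F).
- rewrite -EFinB /F/= (_ : x + e - x = e); last by ring.
  rewrite (_ : x - e - x = - e); last by ring.
  by rewrite mulNr divff ?gt_eqF// atanN; ring.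
- by rewrite ltrD2l; lra.
- apply: continuous_in_subspaceT => t _.
  have h := dvD (dv_sqr (dvB (dv_id t) (dv_cst x t))) (dv_cst (e ^+ 2) t).
  apply: dv_cont (dvdiv _ (dv_cst (2 * e) t) h).
  by rewrite gt_eqF// ltr_wpDl ?sqr_ge0// exprn_gt0.
- split; first by move=> t _; case: (dF t).
  + exact: cvg_at_right_filter (cF _).
  + exact: cvg_at_left_filter (cF _).
- by move=> t _; exact: dv_derive1.
Qed.

(* This is [2 i pi], in the form in which the integral of [1 / w] over the
   boundary of a square centered at the origin produces it. *)
Definition winding : R[i] := 'i%C * (8 * atan 1)%:C%C.

Lemma winding_neq0 : winding != 0.
Proof.
rewrite -normc_gt0 normcM normc_i mul1r normc_real normr_gt0 mulf_neq0 //.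
by rewrite atan1 mulf_neq0 ?gt_eqF ?pi_gt0// invr_gt0.
Qed.

Lemma rectint_inv z e : 0 < e ->
  rectint (fun w => (w - z)^-1) (complex.Re z - e) (complex.Re z + e)
     (complex.Im z - e) (complex.Im z + e) = winding.
Proof.
case: z => x y /= e0.
have pos u : 0 < u ^+ 2 + e ^+ 2 by rewrite ltr_wpDl ?sqr_ge0// exprn_gt0.
have pos' u : u ^+ 2 + e ^+ 2 != 0 by rewrite gt_eqF.
have pos2 u : e ^+ 2 + u ^+ 2 != 0 by rewrite addrC.
rewrite /rectint.
rewrite (eq_cint (a := x - e)
    (G := fun t => (0 +i* (2 * e / ((t - x) ^+ 2 + e ^+ 2)))%C)); last first.
  move=> t _; apply/eqP; rewrite eq_complex/=; apply/andP; split; apply/eqP.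
    rewrite (_ : y - e - y = - e); last by ring.
    by rewrite (_ : y + e - y = e) ?sqrrN; [field|ring].
  rewrite (_ : y - e - y = - e); last by ring.
  by rewrite (_ : y + e - y = e) ?sqrrN; [field|ring].
rewrite (eq_cint (a := y - e)
    (G := fun t => ((2 * e / ((t - y) ^+ 2 + e ^+ 2)) +i* 0)%C)); last first.
  move=> t _; apply/eqP; rewrite eq_complex/=; apply/andP; split; apply/eqP.
    rewrite (_ : x - e - x = - e); last by ring.
    by rewrite (_ : x + e - x = e) ?sqrrN; [field|ring].
  rewrite (_ : x - e - x = - e); last by ring.
  by rewrite (_ : x + e - x = e) ?sqrrN; [field|ring].
rewrite /cint/= !Rintegral_atan// !Rintegral_cst// !mul0r.
apply/eqP; rewrite eq_complex/=; apply/andP; split; apply/eqP; ring.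
Qed.

Lemma has_cderiv_div f z0 z l : z != z0 -> has_cderiv f z l ->
  exists l', has_cderiv (fun w => f w / (w - z0)) z l'.
Proof. by move=> zz0 fl; eexists; exact: has_cderivM fl (has_cderiv_invB zz0). Qed.

(** Excision reduces the integral to a small square around [z]. There [(f w - f z) / (w - z)] is
    bounded by [K], so the defect [D] is at most a constant times the size of the square. *)
Theorem cauchy_formula f z a b c d : inrect a b c d z ->
  (forall w, onrect a b c d w -> exists l, has_cderiv f w l) ->
  rectint (fun w => f w / (w - z)) a b c d = winding * f z.
Proof.
move=> zin df; have [l fl] := df z (inrectW zin).
have [/andP[az zb] /andP[cz zd]] := zin.
have [r r0 hr] := fl 1 ltr01.
pose K := normc l + 1.
have K0 : 0 < K by rewrite ltr_wpDl// normc_ge0.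
apply/eqP; rewrite -subr_eq0; apply/negPn/negP; rewrite -normc_gt0.
set D := normc _ => D0.
(* The diameter estimate [4 e] stays below [r], and [rectint_le] bounds the defect by
   [16 K e <= 16 D / 40 < D]; the last four terms keep the square inside the rectangle. *)
pose e := Num.min (r / 5) (Num.min (D / (40 * K)) (Num.min
  (Num.min (complex.Re z - a) (b - complex.Re z))
  (Num.min (complex.Im z - c) (d - complex.Im z)))).
have e0 : 0 < e by rewrite /e !lt_min !divr_gt0 ?mulr_gt0// !subr_gt0 az zb cz zd.
have : e <= e by []; rewrite {2}/e !le_min => /and3P[er eD /andP[/andP[ea eb] /andP[ec ed]]].
have IE : rectint (fun w => f w / (w - z)) a b c d =
   rectint (fun w => f w / (w - z)) (complex.Re z - e) (complex.Re z + e)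
      (complex.Im z - e) (complex.Im z + e).
  apply: excision; try lra; move=> w wQ wz.
  by have [l' fl'] := df w wQ; exact: has_cderiv_div fl'.
have zin' : inrect (complex.Re z - e) (complex.Re z + e)
      (complex.Im z - e) (complex.Im z + e) z by split; apply/andP; split; lra.
have sub w : onborder (complex.Re z - e) (complex.Re z + e)
      (complex.Im z - e) (complex.Im z + e) w -> onrect a b c d w /\ w != z.
  move=> wb; split; last exact: onborder_neq zin' wb.
  by case: wb => -[/andP[? ?] /andP[? ?]] _; split; apply/andP; split; lra.
have bf : bcont (fun w => f w / (w - z)) (complex.Re z - e) (complex.Re z + e)
      (complex.Im z - e) (complex.Im z + e).
  move=> w /sub[wQ wz]; have [l' fl'] := df w wQ.
  by have [l2] := has_cderiv_div wz fl'; exact: has_cderiv_ccont.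
have bi : bcont (fun w => (w - z)^-1) (complex.Re z - e) (complex.Re z + e)
      (complex.Im z - e) (complex.Im z + e).
  by move=> w /sub[_ wz]; exact: has_cderiv_ccont (has_cderiv_invB wz).
have le1 : complex.Re z - e <= complex.Re z + e by lra.
have le2 : complex.Im z - e <= complex.Im z + e by lra.
have := rectint_lin (- f z) le1 le2 bf bi; rewrite rectint_inv// -IE => E.
have DE : D = normc (rectint (fun w => f w / (w - z) + - f z * (w - z)^-1)
  (complex.Re z - e) (complex.Re z + e) (complex.Im z - e) (complex.Im z + e)).
  by rewrite E /D; congr normc; ring.
have : D <= 4 * K * ((complex.Re z + e - (complex.Re z - e)) +
    (complex.Im z + e - (complex.Im z - e))).
  rewrite DE; apply: rectint_le => // w wb.
    by apply: ccontD; [exact: bf|apply: ccontZ; exact: bi].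
  have [wQ wz] := sub _ wb.
  have wr : normc (w - z) < r.
    have := normc_diag (inrectW zin') (onborderW wb); lra.
  have := hr _ wr; rewrite subrKC => hw.
  have -> : f w / (w - z) + - f z / (w - z) = (f w - f z) / (w - z) by ring.
  have wz0 : 0 < normc (w - z) by rewrite normc_gt0 subr_eq0.
  rewrite normcM normcV ler_pdivrMr// /K mulrDl.
  rewrite -[f w - f z](subrK (l * (w - z))); apply: le_trans (normcD _ _) _.
  by rewrite addrC normcM; apply: lerD.
rewrite ler_pdivlMr ?mulr_gt0// in eD.
by rewrite leNgt => /negP; apply; nra.
Qed.

End Cauchy.

(** * Cauchy integrals for derivatives, and Cauchy's estimates *)

Section CauchyDerivatives.
Variable R : realType.
Notation mu := (@lebesgue_measure R).
Implicit Types (f g : R[i] -> R[i]) (z w h : R[i]).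
Variables (a b c d : R).
Hypotheses (ab : a <= b) (cd : c <= d).

(** This is the [L^1] norm of [f] on the border. Estimates by an integral, instead of a supremum,
    can be raised to the power [p] and then integrated over all translates of the rectangle. *)
Definition border_mass f : R :=
  \int[mu]_(x in `[a, b]) (normc (f (x +i* c)%C) + normc (f (x +i* d)%C)) +
  \int[mu]_(y in `[c, d]) (normc (f (b +i* y)%C) + normc (f (a +i* y)%C)).

Lemma le_of_eq (x y : R) : x = y -> x <= y.
Proof. by move=> ->. Qed.

Lemma border_mass_ge0 f : 0 <= border_mass f.
Proof. by apply: addr_ge0; apply: Rintegral_ge0 => x _; rewrite addr_ge0 ?normc_ge0. Qed.

Lemma rectint_mass f g k : bcont f a b c d -> bcont g a b c d ->
  (forall w, onborder a b c d w -> normc (g w) <= k * normc (f w)) ->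
  normc (rectint g a b c d) <= 2 * k * border_mass f.
Proof.
move=> bf bg gf; have [h v] := bcont_icont ab cd bg.
have If : mu.-integrable `[a, b]
    (EFin \o fun x => normc (f (x +i* c)%C) + normc (f (x +i* d)%C)).
  by apply: integrable_realD => //; apply: integrable_normc;
    [exact: icont_bottom bf|exact: icont_top bf].
have Jf : mu.-integrable `[c, d]
    (EFin \o fun y => normc (f (b +i* y)%C) + normc (f (a +i* y)%C)).
  by apply: integrable_realD => //; apply: integrable_normc;
    [exact: icont_right bf|exact: icont_left bf].
apply: le_trans (normcD _ _) _; rewrite normcM normc_i mul1r.
rewrite /border_mass mulrDr -!mulrA.
rewrite -(RintegralZl _ _ If)// -(RintegralZl _ _ Jf)//; apply: lerD.
  apply: normc_cint_le => //; first exact: integrable_realZ.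
  move=> t tab; apply: le_trans (normcB _ _) _; rewrite mulrDr.
  by apply: lerD; apply: gf; split; rewrite /onrect/= ?lexx ?cd ?tab//;
    [exact: Or43|exact: Or44].
apply: normc_cint_le => //; first exact: integrable_realZ.
move=> t tab; apply: le_trans (normcB _ _) _; rewrite mulrDr.
by apply: lerD; apply: gf; split; rewrite /onrect/= ?lexx ?ab ?tab//;
  [exact: Or42|exact: Or41].
Qed.

Lemma ccontM f g z : ccont f z -> ccont g z -> ccont (fun w => f w * g w) z.
Proof.
move=> hf hg e e0.
have [Kf Kg] := conj (normc_ge0 (f z)) (normc_ge0 (g z)).
pose K := 2 + normc (f z) + normc (g z).
have K0 : 0 < K by rewrite /K; lra.
pose m := Num.min 1 (e / K).
have m0 : 0 < m by rewrite lt_min ltr01 divr_gt0.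
have [r r0 hr] := hf _ m0; have [s s0 hs] := hg _ m0.
exists (Num.min r s); rewrite ?lt_min ?r0// => h; rewrite lt_min => /andP[/hr h1 /hs h2].
have -> : f (z + h) * g (z + h) - f z * g z =
  (f (z + h) - f z) * (g (z + h) - g z) + (f (z + h) - f z) * g z +
  f z * (g (z + h) - g z) by ring.
apply: le_trans (normcD _ _) _.
apply: le_trans (lerD (normcD _ _) (lexx _)) _; rewrite !normcM.
have : m * K <= e by rewrite -ler_pdivlMr// /m ge_min lexx orbT.
have : m <= 1 by rewrite /m ge_min lexx.
have := normc_ge0 (f (z + h) - f z); have := normc_ge0 (g (z + h) - g z).
by rewrite /K; nra.
Qed.

Lemma ccontX f z n : ccont f z -> ccont (fun w => f w ^+ n) z.
Proof.
move=> fz; elim: n => [|n IH].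
  exact: (has_cderiv_ccont (has_cderiv_cst 1 z)).
rewrite (_ : (fun w => f w ^+ n.+1) = fun w => f w * f w ^+ n); first exact: ccontM.
by apply/funext => w; rewrite exprS.
Qed.

(** A remainder of the kernel that is quadratic in [h], uniformly on the border, stays quadratic
    after integration against [f]. *)
Lemma rectint_param f (K K1 : R[i] -> R[i] -> R[i]) z C r :
  0 < r -> 0 <= C -> bcont f a b c d ->
  (forall h, normc h < r -> bcont (K (z + h)) a b c d) ->
  bcont (K1 z) a b c d ->
  (forall h w, normc h < r -> onborder a b c d w ->
    normc (K (z + h) w - K z w - h * K1 z w) <= C * normc h ^+ 2) ->
  has_cderiv (fun z => rectint (fun w => f w * K z w) a b c d) z
    (rectint (fun w => f w * K1 z w) a b c d).
Proof.
move=> r0 C0 bf bK bK1 hK e e0.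
have N0 := border_mass_ge0 f.
have D0 : 0 < 1 + 2 * C * border_mass f by rewrite ltr_pwDl// !mulr_ge0.
exists (Num.min r (e / (1 + 2 * C * border_mass f))).
  by rewrite lt_min r0 divr_gt0.
move=> h; rewrite lt_min ltr_pdivlMr// => /andP[hr he].
have bfK h' : normc h' < r -> bcont (fun w => f w * K (z + h') w) a b c d.
  by move=> h'r w wb; apply: ccontM; [exact: bf|exact: bK].
have bfK1 : bcont (fun w => f w * K1 z w) a b c d.
  by move=> w wb; apply: ccontM; [exact: bf|exact: bK1].
have bfKz : bcont (fun w => f w * K z w) a b c d.
  by rewrite -(addr0 z); apply: bfK; rewrite ComplexField.Normc.normc0.
have bfB : bcont (fun w => f w * K (z + h) w + - 1 * (f w * K z w)) a b c d.
  by move=> w wb; apply: ccontD; [exact: bfK|apply: ccontZ; exact: bfKz].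
have -> : rectint (fun w => f w * K (z + h) w) a b c d
   - rectint (fun w => f w * K z w) a b c d
   - rectint (fun w => f w * K1 z w) a b c d * h =
  rectint (fun w => f w * K (z + h) w + - 1 * (f w * K z w) +
     - h * (f w * K1 z w)) a b c d.
  rewrite (rectint_lin (- h) ab cd bfB bfK1) (rectint_lin (- 1) ab cd (bfK h hr) bfKz).
  by ring.
apply: (@le_trans _ _ (2 * (C * normc h ^+ 2) * border_mass f)).
  apply: rectint_mass => //.
    by move=> w wb; apply: ccontD; [exact: bfB|apply: ccontZ; exact: bfK1].
  move=> w wb; have -> : f w * K (z + h) w + - 1 * (f w * K z w) + - h * (f w * K1 z w)
    = (K (z + h) w - K z w - h * K1 z w) * f w by ring.
  by rewrite normcM; apply: ler_wpM2r; [exact: normc_ge0|exact: hK].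
have := normc_ge0 h; nra.
Qed.

Definition deep (r : R) z :=
  a + r <= complex.Re z <= b - r /\ c + r <= complex.Im z <= d - r.

Lemma deep_dist r z w : deep r z -> onborder a b c d w -> r <= normc (w - z).
Proof.
move=> [/andP[? ?] /andP[? ?]] [_ hw].
have := Re_le_normc (w - z); have := Im_le_normc (w - z); rewrite ReB ImB.
by rewrite !ler_norml => /andP[? ?] /andP[? ?]; case: hw => hw; lra.
Qed.

Lemma deep_in r z : 0 < r -> deep r z -> inrect a b c d z.
Proof.
by move=> r0 [/andP[? ?] /andP[? ?]]; split; apply/andP; split; lra.
Qed.

Lemma in_deep z : inrect a b c d z -> exists2 r, 0 < r & deep r z.
Proof.
move=> [/andP[? ?] /andP[? ?]].
exists (Num.min (Num.min (complex.Re z - a) (b - complex.Re z))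
    (Num.min (complex.Im z - c) (d - complex.Im z))).
  by rewrite !lt_min !subr_gt0; apply/andP; split; apply/andP.
set m := Num.min _ _; have : m <= m by [].
rewrite {2}/m !le_min => /andP[/andP[? ?] /andP[? ?]].
by split; apply/andP; split; lra.
Qed.

Lemma deep_add r r' z h : deep r z -> normc h <= r' -> deep (r - r') (z + h).
Proof.
move=> [/andP[? ?] /andP[? ?]] hr.
have := Re_le_normc h; have := Im_le_normc h; rewrite !ler_norml => /andP[? ?] /andP[? ?].
have -> : z + h = z - - h by rewrite opprK.
rewrite /deep ReB ImB.
have -> : complex.Re (- h) = - complex.Re h by case: (h).
have -> : complex.Im (- h) = - complex.Im h by case: (h).
by split; apply/andP; split; lra.
Qed.

Lemma ccont_kernel z w n : w != z -> ccont (fun w => ((w - z)^-1) ^+ n) w.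
Proof. by move=> wz; apply: ccontX; exact: has_cderiv_ccont (has_cderiv_invB wz). Qed.

Lemma bcont_kernel r z n : 0 < r -> deep r z -> bcont (fun w => ((w - z)^-1) ^+ n) a b c d.
Proof.
move=> r0 zr w wb; apply: ccont_kernel; exact: onborder_neq (deep_in r0 zr) wb.
Qed.

Lemma kernel_norm r z w n : 0 < r -> deep r z -> onborder a b c d w ->
  normc (((w - z)^-1) ^+ n) <= r^-1 ^+ n.
Proof.
move=> r0 zr wb; elim: n => [|n IH]; first by rewrite !expr0 ComplexField.Normc.normc1.
rewrite !exprS normcM normcV; apply: ler_pM => //; rewrite ?invr_ge0 ?normc_ge0//.
by rewrite lef_pV2 ?posrE//; [exact: deep_dist zr wb|
  apply: lt_le_trans r0 _; exact: deep_dist zr wb].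
Qed.

Lemma normc_nat n : normc (n%:R : R[i]) = n%:R.
Proof. by rewrite -(rmorph_nat (real_complex R)) normc_real normr_nat. Qed.

Lemma kernel1_remainder r z w h : 0 < r -> deep r z -> normc h < r / 2 ->
  onborder a b c d w ->
  normc ((w - (z + h))^-1 - (w - z)^-1 - h * (w - z)^-1 ^+ 2) <=
  2 * r^-1 ^+ 3 * normc h ^+ 2.
Proof.
move=> r0 zr hr wb.
have r2 : 0 < r - r / 2 by lra.
have zhr := deep_add zr (ltW hr).
have u0 : w - z != 0 by rewrite subr_eq0; exact: onborder_neq (deep_in r0 zr) wb.
have v0 : w - (z + h) != 0.
  by rewrite subr_eq0; exact: onborder_neq (deep_in r2 zhr) wb.
have -> : (w - (z + h))^-1 - (w - z)^-1 - h * (w - z)^-1 ^+ 2 =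
   h ^+ 2 * ((w - (z + h))^-1 * (w - z)^-1 ^+ 2) by field; rewrite u0 v0.
have k1 := kernel_norm 1 r2 zhr wb; have k2 := kernel_norm 2 r0 zr wb.
rewrite normcM [normc (h ^+ 2)]normcM -expr2 [leRHS]mulrC.
apply: ler_wpM2l; first exact: sqr_ge0.
have -> : 2 * r^-1 ^+ 3 = (r - r / 2)^-1 ^+ 1 * r^-1 ^+ 2.
  by field; rewrite !gt_eqF//; lra.
by rewrite normcM; apply: ler_pM k1 k2; exact: normc_ge0.
Qed.

Lemma kernel2_remainder r z w h : 0 < r -> deep r z -> normc h < r / 2 ->
  onborder a b c d w ->
  normc ((w - (z + h))^-1 ^+ 2 - (w - z)^-1 ^+ 2 - h * (2 * (w - z)^-1 ^+ 3)) <=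
  8 * r^-1 ^+ 4 * normc h ^+ 2.
Proof.
move=> r0 zr hr wb.
have r2 : 0 < r - r / 2 by lra.
have zhr := deep_add zr (ltW hr).
have u0 : w - z != 0 by rewrite subr_eq0; exact: onborder_neq (deep_in r0 zr) wb.
have v0 : w - (z + h) != 0.
  by rewrite subr_eq0; exact: onborder_neq (deep_in r2 zhr) wb.
have -> : (w - (z + h))^-1 ^+ 2 - (w - z)^-1 ^+ 2 - h * (2 * (w - z)^-1 ^+ 3) =
   h ^+ 2 * (3 * ((w - (z + h))^-1 ^+ 1 * (w - z)^-1 ^+ 3) +
     h * ((w - (z + h))^-1 ^+ 2 * (w - z)^-1 ^+ 3)) by field; rewrite u0 v0.
have k1 := kernel_norm 1 r2 zhr wb; have k2 := kernel_norm 2 r2 zhr wb.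
have k3 := kernel_norm 3 r0 zr wb.
rewrite normcM [normc (h ^+ 2)]normcM -expr2 [leRHS]mulrC.
apply: ler_wpM2l; first exact: sqr_ge0.
apply: le_trans (normcD _ _) _.
have -> : 8 * r^-1 ^+ 4 = 3 * ((r - r / 2)^-1 ^+ 1 * r^-1 ^+ 3) +
    r / 2 * ((r - r / 2)^-1 ^+ 2 * r^-1 ^+ 3).
  by field; rewrite !gt_eqF//; lra.
rewrite (normcM 3) normc_nat (normcM h) (normcM (_ ^+ 1)) (normcM (_ ^+ 2)); apply: lerD.
  by apply: ler_wpM2l => //; apply: ler_pM k1 k3; exact: normc_ge0.
apply: ler_pM; rewrite ?(mulr_ge0, normc_ge0)//; first exact: ltW.
by apply: ler_pM k2 k3; exact: normc_ge0.
Qed.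

(** For [n >= 1], this is Cauchy's integral for the derivative of order [n - 1], up to the factor
    [(n - 1)! / winding]. *)
Definition cauchy_moment f n z := rectint (fun w => f w * (w - z)^-1 ^+ n) a b c d.

Lemma cauchy_moment1_deriv f z : bcont f a b c d -> inrect a b c d z ->
  has_cderiv (cauchy_moment f 1) z (cauchy_moment f 2 z).
Proof.
move=> bf /in_deep[r r0 zr]; have r20 : 0 < r / 2 by rewrite divr_gt0.
apply: (@rectint_param f (fun z w => (w - z)^-1 ^+ 1) (fun z w => (w - z)^-1 ^+ 2) z
    (2 * r^-1 ^+ 3) (r / 2)) => //.
- by rewrite mulr_ge0// exprn_ge0// invr_ge0 ltW.
- move=> h hr; apply: (@bcont_kernel (r - r / 2)); first by lra.
  exact: deep_add (ltW hr).
- exact: bcont_kernel zr.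
- by move=> h w hr wb; exact: kernel1_remainder.
Qed.

Lemma cauchy_moment2_deriv f z : bcont f a b c d -> inrect a b c d z ->
  has_cderiv (cauchy_moment f 2) z (2 * cauchy_moment f 3 z).
Proof.
move=> bf /in_deep[r r0 zr]; have r20 : 0 < r / 2 by rewrite divr_gt0.
have bk3 : bcont (fun w => f w * (w - z)^-1 ^+ 3) a b c d.
  by move=> w wb; apply: ccontM; [exact: bf|exact: bcont_kernel zr _ wb].
have b0 : bcont (fun w => 0) a b c d.
  by move=> w _; exact: (has_cderiv_ccont (has_cderiv_cst 0 w)).
have -> : 2 * cauchy_moment f 3 z =
    rectint (fun w => f w * (2 * (w - z)^-1 ^+ 3)) a b c d.
  have := rectint_lin 2 ab cd bk3 bk3; rewrite /cauchy_moment.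
  have := rectint_lin 1 ab cd bk3 bk3.
  rewrite mul1r (_ : _ + _ = 2 * rectint (fun w => f w * (w - z)^-1 ^+ 3) a b c d); last by ring.
  move=> <- _; apply: eq_rectint => // w _; ring.
apply: (@rectint_param f (fun z w => (w - z)^-1 ^+ 2) (fun z w => 2 * (w - z)^-1 ^+ 3) z
    (8 * r^-1 ^+ 4) (r / 2)) => //.
- by rewrite mulr_ge0// exprn_ge0// invr_ge0 ltW.
- move=> h hr; apply: (@bcont_kernel (r - r / 2)); first by lra.
  exact: deep_add (ltW hr).
- by move=> w wb; apply: ccontZ; exact: bcont_kernel zr _ wb.
- by move=> h w hr wb; exact: kernel2_remainder.
Qed.

Lemma cauchy_moment_le f n r z : bcont f a b c d -> 0 < r -> deep r z ->
  normc (cauchy_moment f n z) <= 2 * r^-1 ^+ n * border_mass f.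
Proof.
move=> bf r0 zr; apply: rectint_mass => //.
  by move=> w wb; apply: ccontM; [exact: bf|exact: bcont_kernel zr _ wb].
move=> w wb; rewrite normcM mulrC; apply: ler_wpM2r; first exact: normc_ge0.
exact: kernel_norm.
Qed.

Section Derivatives.
Variables f f1 : R[i] -> R[i].
Hypothesis df : forall w, onrect a b c d w -> has_cderiv f w (f1 w).

Let bf : bcont f a b c d.
Proof. by move=> w /onborderW/df/has_cderiv_ccont. Qed.

Let fE z : inrect a b c d z -> f z = (winding R)^-1 * cauchy_moment f 1 z.
Proof.
move=> zin; rewrite /cauchy_moment (eq_rectint (g := fun w => f w / (w - z)))//.
rewrite cauchy_formula//; last by move=> w /df ?; exists (f1 w).
by rewrite mulKf// winding_neq0.
Qed.

Let near_in z : inrect a b c d z -> exists2 r, 0 < r &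
  forall h, normc h < r -> inrect a b c d (z + h).
Proof.
move=> /in_deep[r r0 zr]; exists (r / 2); first by rewrite divr_gt0.
move=> h hr; apply: (@deep_in (r - r / 2)); first by lra.
exact: deep_add (ltW hr).
Qed.

Let has_cderivZ k g z l : has_cderiv g z l -> has_cderiv (fun w => k * g w) z (k * l).
Proof. by move=> gl; have := has_cderivM (has_cderiv_cst k z) gl; rewrite mul0r add0r. Qed.

(** [f] agrees near [z] with its Cauchy integral, whose derivative is known; uniqueness of the
    derivative identifies [f1]. *)
Let f1E z : inrect a b c d z -> f1 z = (winding R)^-1 * cauchy_moment f 2 z.
Proof.
move=> zin; apply: has_cderiv_uniq (df (inrectW zin)) _.
apply: has_cderiv_near (has_cderivZ _ (cauchy_moment1_deriv bf zin)) _.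
by have [r r0 hr] := near_in zin; exists r => // h /hr/fE.
Qed.

Let f1_deriv z : inrect a b c d z ->
  has_cderiv f1 z ((winding R)^-1 * (2 * cauchy_moment f 3 z)).
Proof.
move=> zin; apply: has_cderiv_near (has_cderivZ _ (cauchy_moment2_deriv bf zin)) _.
by have [r r0 hr] := near_in zin; exists r => // h /hr/f1E.
Qed.

Theorem derivative_holomorphic z : inrect a b c d z -> exists l, has_cderiv f1 z l.
Proof. by move=> zin; eexists; exact: f1_deriv. Qed.

Theorem cauchy_estimates r z l : 0 < r -> deep r z -> has_cderiv f1 z l ->
  [/\ normc (f z) <= 2 / normc (winding R) * r^-1 * border_mass f,
   normc (f1 z) <= 2 / normc (winding R) * r^-1 ^+ 2 * border_mass f &
   normc l <= 4 / normc (winding R) * r^-1 ^+ 3 * border_mass f].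
Proof.
move=> r0 zr fl; have zin := deep_in r0 zr.
rewrite (fE zin) (f1E zin) (has_cderiv_uniq fl (f1_deriv zin)).
rewrite !(normcM (winding R)^-1) (normcM 2) !normcV.
have W0 : 0 < (normc (winding R))^-1 by rewrite invr_gt0 normc_gt0 winding_neq0.
have m n := cauchy_moment_le n bf r0 zr.
have W1 := ltW W0; split.
- by apply: le_trans (ler_wpM2l W1 (m 1)) _; apply: le_of_eq; ring.
- by apply: le_trans (ler_wpM2l W1 (m 2)) _; apply: le_of_eq; ring.
- rewrite normc_nat; apply: le_trans (ler_wpM2l W1 (ler_wpM2l _ (m 3))) _ => //.
  by apply: le_of_eq; ring.
Qed.

End Derivatives.

End CauchyDerivatives.

(** * Integrals over horizontal lines *)

Section LebesgueLine.
Variable R : realType.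
Notation mu := (@lebesgue_measure R).

(** Rounding [t] down to a multiple of [1 / (n + 1)] turns every preimage into a countable union of
    measurable rectangles; continuity in [t] makes these functions converge pointwise to [U]. *)
Lemma measurable_separately (U : R -> R -> R) :
  (forall t, measurable_fun setT (U ^~ t)) -> (forall x, continuous (U x)) ->
  measurable_fun setT (fun z : R * R => U z.1 z.2).
Proof.
move=> mU cU.
pose q n (t : R) : R := (Num.floor (t * n.+1%:R))%:~R / n.+1%:R.
apply: (@measurable_fun_cvg _ _ _ setT (fun n z => U z.1 (q n z.2))).
  move=> n _ Y mY; rewrite setTI.
  have -> : (fun z : R * R => U z.1 (q n z.2)) @^-1` Y =
     \bigcup_(k : int) (((U ^~ (k%:~R / n.+1%:R)) @^-1` Y) `*`
       `[k%:~R / n.+1%:R, (k + 1)%:~R / n.+1%:R[%classic).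
    apply/seteqP; split => -[x t]/=.
      move=> Yxt; exists (Num.floor (t * n.+1%:R)) => //; split => //=.
      by rewrite in_itv/= ler_pdivrMr// ltr_pdivlMr// floor_itv.
    move=> [k _ /= [Yk]]; rewrite in_itv/= ler_pdivrMr// ltr_pdivlMr// => kt.
    by rewrite /q (floor_def kt).
  apply: countable_bigcupT_measurable => //.
  move=> k; apply: measurableX; last exact: measurable_itv.
  by rewrite -[X in measurable X]setTI; exact: mU.
move=> [x t] _ /=; apply: (cvg_comp (q ^~ t) (U x)); last exact: cU.
apply/cvgrPdist_lt => e e0; near=> n.
have := floor_itv (t * n.+1%:R); rewrite intrD => /andP[h1 h2].
have n0 : 0 < n.+1%:R :> R by rewrite ltr0n.
have ne : n.+1%:R^-1 < e by rewrite -[e]/((PosNum e0)%:num); near: n; exact: near_infty_natSinv_lt.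
apply: le_lt_trans ne; rewrite /q.
rewrite (_ : t - _ = (t * n.+1%:R - (Num.floor (t * n.+1%:R))%:~R) * n.+1%:R^-1).
  rewrite normrM (gtr0_norm (x := _^-1)) ?invr_gt0// ger0_norm ?subr_ge0//.
  by rewrite ler_piMl ?invr_ge0 ?(ltW n0)//; lra.
by rewrite mulrBl mulfK ?lt0r_neq0.
Unshelve. all: by end_near. Qed.

(** Tonelli: after exchanging the integrals, the inner one is at most [K] and the outer one runs
    over a segment of finite length. The indicator of the segment lets the theorem be applied on the
    whole plane. *)
Lemma integrable_segment_average (U : R -> R -> R) (al be K : R) :
  al <= be ->
  (forall x t, 0 <= U x t) ->
  (forall t, measurable_fun setT (U ^~ t)) -> (forall x, continuous (U x)) ->
  (forall t, (\int[mu]_x (U x t)%:E <= K%:E)%E) ->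
  mu.-integrable setT (EFin \o (fun x => \int[mu]_(t in `[al, be]) U x t)).
Proof.
move=> ab U0 mU cU UK.
pose D : set R := `[al, be]%classic.
pose g (z : R * R) : \bar R := (U z.1 z.2 * \1_D z.2)%:E.
have mg : measurable_fun setT g.
  apply/measurable_EFinP; apply: measurable_funM; first exact: measurable_separately.
  by apply: measurableT_comp measurable_snd; apply: measurable_indic; exact: measurable_itv.
have g0 z : (0 <= g z)%E by rewrite lee_fin mulr_ge0.
have iU x : mu.-integrable D (EFin \o U x).
  by apply: continuous_segment_integrable => t _; exact: cU.
have gE x : (\int[mu]_t g (x, t) = (\int[mu]_(t in D) U x t)%:E)%E.
  rewrite /Rintegral fineK; last by apply: integrable_fin_num; [exact: measurable_itv|exact: iU].
  rewrite [RHS]integral_mkcond.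
  apply: eq_integral => t _; rewrite patchE /g/= indicE; case: ifPn => tD.
    by rewrite mulr1.
  by rewrite mulr0.
apply/integrableP; split.
  have := measurable_fun_fubini_tonelli_F (m2 := mu) g mg g0.
  by apply: eq_measurable_fun => x _; rewrite /fubini_F gE.
rewrite (_ : (\int[mu]_x _)%E = (\int[mu]_x \int[mu]_t g (x, t))%E); last first.
  by apply: eq_integral => x _; rewrite gE/= ger0_norm// Rintegral_ge0.
rewrite (fubini_tonelli (m1 := mu) (m2 := mu) g mg g0).
have K0 : 0 <= K by rewrite -lee_fin; apply: le_trans (UK 0); apply: integral_ge0 => x _; rewrite lee_fin.
apply: (@le_lt_trans _ _ (\int[mu]_(t in D) K%:E)%E); last first.
  rewrite integral_cst; last exact: measurable_itv.
  have : (mu D < +oo)%E.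
    by rewrite /D lebesgue_measure_itv/=; case: ifP => _; rewrite ?ltry// -EFinB ltry.
  by move=> h; rewrite lte_mul_pinfty// lee_fin.
rewrite [leRHS]integral_mkcond; apply: ge0_le_integral => //.
- by move=> t _; apply: integral_ge0.
- exact: (measurable_fun_fubini_tonelli_G (m1 := mu) g mg g0).
- by apply/measurable_restrict => //; first [exact: measurable_itv|exact: measurable_cst].
- move=> t _; rewrite patchE /g/=; rewrite indicE; case: ifPn => tD.
    by under eq_integral do rewrite mulr1.
  by under eq_integral do rewrite mulr0; rewrite integral0.
Qed.

Lemma integral_translate (G : R -> R) c : continuous G -> (forall x, 0 <= G x) ->
  (\int[mu]_x (G (x + c))%:E = \int[mu]_x (G x)%:E)%E.
Proof.
move=> cG G0.
have dF (x : R) : is_derive x (1 : R) (fun x => x + c) (1 + 0) by exact: dvD (dv_id x) (dv_cst c x).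
have F' : (fun x => x + c)^`() = cst (1 : R).
  by apply/funext => x; rewrite (dv_derive1 (dF x)) addr0.
rewrite [RHS](@increasing_ge0_integration_by_substitutionT _ (fun x => x + c))//.
- by apply: eq_integral => x _; rewrite F'/= /GRing.mul/= mulr1.
- by move=> x y; rewrite ltrD2r.
- by rewrite F' => x; exact: cvg_cst.
- by rewrite F'; exact: is_cvg_cst.
- by rewrite F'; exact: is_cvg_cst.
- exact: cvg_addrr_Ny.
- exact: cvg_addrr.
Qed.

Lemma integral_eq0_continuous (G : R -> R) : continuous G -> (forall x, 0 <= G x) ->
  (\int[mu]_x (G x)%:E = 0)%E -> forall x, G x = 0.
Proof.
move=> cG G0 iG x; apply/eqP; rewrite -[_ == _]negbK; apply/negP => Gx.
have Gx0 : 0 < G x by rewrite lt0r Gx G0.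
have : \forall y \near x, G x / 2 <= G y.
  near=> y; have : `|G x - G y| < G x / 2.
    by near: y; have /cvgrPdist_lt := cG x; apply; rewrite divr_gt0.
  by rewrite ltr_norml => /andP[_]; lra.
move=> /nbhs_ballP[d /= d0 hd].
have dd : x - d / 2 < x + d / 2 by lra.
have : (\int[mu]_(y in `[(x - d / 2)%R, (x + d / 2)%R]) (G x / 2)%:E <= \int[mu]_y (G y)%:E)%E.
  apply: (@le_trans _ _ (\int[mu]_(y in `[(x - d / 2)%R, (x + d / 2)%R]) (G y)%:E)%E).
    apply: ge0_le_integral => //.
    - by move=> y _; rewrite lee_fin divr_ge0.
    - apply/measurable_EFinP; apply: measurable_funTS; exact: continuous_measurable_fun.
    - move=> y; rewrite /= in_itv/= => /andP[? ?]; rewrite lee_fin; apply: hd.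
      by rewrite /ball/= ltr_norml; apply/andP; split; lra.
  apply: ge0_subset_integral => //.
    apply/measurable_EFinP; exact: continuous_measurable_fun.
  by move=> y _; rewrite lee_fin.
rewrite iG integral_cst//= lebesgue_measure_itv/= lte_fin dd -EFinB -EFinM lee_fin leNgt.
by move=> /negP; apply; rewrite mulr_gt0//; lra.
Unshelve. all: by end_near. Qed.

End LebesgueLine.

(** * Real powers of nonnegative functions at their zeros *)

Section PowerDerivative.
Variable R : realType.
Implicit Types (g S : R -> R) (t l e d h r : R).

Lemma is_derive_eps g t l : is_derive t (1 : R) g l ->
  forall e, 0 < e -> exists2 d, 0 < d &
    forall h, `|h| < d -> `|g (t + h) - g t - l * h| <= e * `|h|.
Proof.
move=> [dg gl] e e0; have : h^-1 *: (g (h *: (1 : R) + t) - g t) @[h --> 0^'] --> l.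
  by rewrite -gl; exact: dg.
move=> /cvgrPdist_le /(_ e e0) /nbhs_ballP[d /= d0 hd]; exists d => // h hd'.
have [->|h0] := eqVneq h 0; first by rewrite addr0 subrr mulr0 subr0 normr0 mulr0.
have := hd h; rewrite /ball/= sub0r normrN => /(_ hd' h0).
have -> : l - h^-1 *: (g (h *: (1 : R) + t) - g t) = - (g (t + h) - g t - l * h) / h.
  rewrite /GRing.scale/= mulr1 (addrC h); field; exact: h0.
by rewrite normrM normrN normfV ler_pdivrMr ?normr_gt0.
Qed.

Lemma eps_is_derive g t l :
  (forall e, 0 < e -> exists2 d, 0 < d &
    forall h, `|h| < d -> `|g (t + h) - g t - l * h| <= e * `|h|) ->
  is_derive t (1 : R) g l.
Proof.
move=> H; have cv : h^-1 *: (g (h *: (1 : R) + t) - g t) @[h --> 0^'] --> l.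
  apply/cvgrPdist_le => e /H[d d0 hd]; near=> h.
  have h0 : h != 0 by near: h; exact: nbhs_dnbhs_neq.
  have hd' : `|h| < d by near: h; apply: dnbhs0_lt.
  have -> : l - h^-1 *: (g (h *: (1 : R) + t) - g t) = - (g (t + h) - g t - l * h) / h.
    rewrite /GRing.scale/= mulr1 (addrC h); field; exact: h0.
  by rewrite normrM normrN normfV ler_pdivrMr ?normr_gt0//; exact: hd.
apply: DeriveDef; first by apply/cvg_ex; exists l.
exact/cvg_lim.
Unshelve. all: by end_near. Qed.

Lemma derive_ge0_zero g t l : (forall s, 0 <= g s) -> g t = 0 ->
  is_derive t (1 : R) g l -> l = 0.
Proof.
move=> g0 gt gl; apply/eqP; rewrite -[_ == _]negbK; apply/negP => l0.
(* A zero of a nonnegative function is a minimum: with a nonzero slope, [g] would be negative at one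
   of the points [t + d / 2] and [t - d / 2]. *)
have e0 : 0 < `|l| / 2 by rewrite divr_gt0 ?normr_gt0.
have [d d0 hd] := is_derive_eps gl e0.
have d2 : 0 < d / 2 by rewrite divr_gt0.
have := hd (d / 2); have := hd (- (d / 2)); rewrite normrN gtr0_norm//.
have dd : d / 2 < d by lra.
move=> /(_ dd) + /(_ dd); rewrite gt !ler_norml => /andP[_ h1] /andP[_ h2].
have := g0 (t + d / 2); have := g0 (t - d / 2).
by have [lp|ln] := leP 0 l; [rewrite ger0_norm// in h1 h2; move: lp|rewrite ltr0_norm// in h1 h2];
  rewrite ?le_eqVlt ?(eq_sym 0) ?(negbTE l0)/=; nra.
Qed.

(* Where [S] vanishes so does its derivative: the formula also holds there,
   although [powR] need not be differentiable at [0]. *)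
Lemma is_derive_powR_ge0 S r t l : 1 <= r -> (forall s, 0 <= S s) ->
  is_derive t (1 : R) S l ->
  is_derive t (1 : R) (fun s => S s `^ r) (r * (S t `^ (r - 1) * l)).
Proof.
move=> r1 S0 Sl; have [St|St] := eqVneq (S t) 0; last first.
  have Sp : 0 < S t by rewrite lt0r St S0.
  by apply: dv_eq (dv_comp (is_derive1_powR r Sp) Sl) _; rewrite mulrA.
have l0 := derive_ge0_zero S0 St Sl; rewrite l0 !mulr0.
have r0 : r != 0 by rewrite gt_eqF//; lra.
apply: eps_is_derive => e e0.
have e1 : 0 < Num.min e 1 by rewrite lt_min e0 ltr01.
have [d d0 hd] := is_derive_eps Sl e1; exists (Num.min d 1) => [|h].
  by rewrite lt_min d0 ltr01.
rewrite lt_min => /andP[/hd]; rewrite St l0 !mul0r !subr0 => h1 h2.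
rewrite powR0// subr0 ger0_norm ?powR_ge0//; rewrite ger0_norm// in h1.
(* As [r >= 1], below 1 the power [r] of [S] is at most [S], which is [o(h)]. *)
have S1 : S (t + h) <= 1.
  apply: le_trans h1 _; apply: (@le_trans _ _ (1 * `|h|)); last by rewrite mul1r ltW.
  by apply: ler_wpM2r => //; rewrite ge_min lexx orbT.
apply: (@le_trans _ _ (S (t + h))); last first.
  by apply: le_trans h1 _; apply: ler_wpM2r => //; rewrite ge_min lexx.
have [->|Sh] := eqVneq (S (t + h)) 0; first by rewrite powR0.
by apply: ge1r_powR => //; rewrite lt0r Sh S0.
Qed.

(* If [r < 2], the factor [S t `^ (r - 2)] has the junk value [0] where [S]
   vanishes; it is then multiplied by [S1 t = 0]. *)
Lemma is_derive_powR_ge0' S S1 r t l : 1 <= r -> (forall s, 0 <= S s) ->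
  is_derive t (1 : R) S (S1 t) -> is_derive t (1 : R) S1 l ->
  is_derive t (1 : R) (fun s => r * (S s `^ (r - 1) * S1 s))
    (r * ((r - 1) * S t `^ (r - 2) * S1 t ^+ 2 + S t `^ (r - 1) * l)).
Proof.
move=> r1 S0 dS dS1; apply: dvZ.
have [St|St] := eqVneq (S t) 0; last first.
  have Sp : 0 < S t by rewrite lt0r St S0.
  apply: dv_eq (dvM (dv_comp (is_derive1_powR (r - 1) Sp) dS) dS1) _.
  by rewrite (_ : r - 1 - 1 = r - 2); ring.
have S10 := derive_ge0_zero S0 St dS; rewrite S10 expr0n mulr0 add0r St.
(* For [r = 1] the factor with exponent [r - 1] is the constant 1, including at the zeros of [S], so
   the function is [S1] itself. *)
have [rE|rn] := eqVneq r 1.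
  rewrite rE subrr powRr0 mul1r.
  by under eq_fun do rewrite powRr0 mul1r.
have r0 : 0 < r - 1 by rewrite subr_gt0 lt_neqAle eq_sym rn.
rewrite powR0 ?gt_eqF// mul0r; apply: eps_is_derive => e e0.
have l0 : 0 < `|l| + 1 by rewrite ltr_wpDl.
have [d d0 hd] := is_derive_eps dS1 ltr01.
(* [S <= eta] makes the power at most [e / (|l| + 1)], while [|S1 (t + h)|] is at most
   [(|l| + 1) |h|]. *)
pose eta := (e / (`|l| + 1)) `^ (r - 1)^-1.
have eta0 : 0 < eta by rewrite powR_gt0// divr_gt0.
have eta1 : 0 < Num.min 1 eta by rewrite lt_min ltr01.
have [d' d'0 hd'] := is_derive_eps dS eta1.
exists (Num.min d (Num.min d' 1)) => [|h]; first by rewrite !lt_min d0 d'0 ltr01.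
rewrite !lt_min => /and3P[/hd h1 /hd' h2 h3].
rewrite S10 St subr0 mul0r subr0 in h1 h2.
rewrite S10 mulr0 mul0r !subr0 normrM ger0_norm ?powR_ge0//.
have S1h : `|S1 (t + h)| <= (`|l| + 1) * `|h|.
  have := ler_normD (S1 (t + h) - l * h) (l * h); rewrite subrK normrM; lra.
rewrite subr0 ger0_norm// in h2.
have Sh : S (t + h) <= eta.
  apply: le_trans h2 _; have := normr_ge0 h; have : Num.min 1 eta <= eta by rewrite ge_min lexx orbT.
  by nra.
have pw : S (t + h) `^ (r - 1) <= e / (`|l| + 1).
  apply: (@le_trans _ _ (eta `^ (r - 1))).
    by apply: ge0_ler_powR => //; rewrite ?nnegrE ?S0 ?ltW.
  by rewrite /eta -powRrM mulVf ?gt_eqF// powRr1// divr_ge0// ltW.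
apply: (@le_trans _ _ (e / (`|l| + 1) * ((`|l| + 1) * `|h|))).
  by apply: ler_pM => //; exact: powR_ge0.
by rewrite mulrA divfK ?gt_eqF.
Qed.

End PowerDerivative.

(** * Cauchy's estimates in the half-plane, and Young's inequality *)

Section HalfPlane.
Variable R : realType.
Notation mu := (@lebesgue_measure R).
Implicit Types (f g : R[i] -> R[i]) (z w : R[i]).

Lemma has_cderiv_shift f f1 z w : has_cderiv f (z + w) (f1 (z + w)) ->
  has_cderiv (fun w => f (z + w)) w (f1 (z + w)).
Proof.
by move=> h e /h[d d0 hd]; exists d => // k /hd; rewrite addrA.
Qed.

Lemma half_plane_deriv f f1 :
  (forall z, 0 < complex.Im z -> has_cderiv f z (f1 z)) ->
  exists f2, forall z, 0 < complex.Im z -> has_cderiv f1 z (f2 z).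
Proof.
move=> df; suff : forall z, exists l, 0 < complex.Im z -> has_cderiv f1 z l.
  by move=> h; have [f2 hf2] := choice h; exists f2.
move=> z; have [z0|] := pselect (0 < complex.Im z); last by exists 0.
(* A square of this half-side around [z] stays in the half-plane. *)
pose s := complex.Im z / 2; have s0 : 0 < s by rewrite divr_gt0.
have le1 : complex.Re z - s <= complex.Re z + s by lra.
have le2 : complex.Im z - s <= complex.Im z + s by lra.
have dQ w : onrect (complex.Re z - s) (complex.Re z + s)
    (complex.Im z - s) (complex.Im z + s) w -> has_cderiv f w (f1 w).
  by move=> [_ /andP[h _]]; apply: df; rewrite /s in h *; lra.
have zQ : inrect (complex.Re z - s) (complex.Re z + s)
    (complex.Im z - s) (complex.Im z + s) z by split; apply/andP; split; lra.
by have [l hl] := derivative_holomorphic le1 le2 dQ zQ; exists l.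
Qed.

Lemma Im_realD (x : R) w : complex.Im (x%:C%C + w) = complex.Im w.
Proof. by case: w => ? ? /=; rewrite add0r. Qed.

(** The rectangle is fixed and [f] is translated by [x], hence a constant [C] independent of [x]. A
    single [C] serves [f], [f1] and [f2]. *)
Lemma half_plane_estimates f f1 f2 (y : R) : 0 < y ->
  (forall z, 0 < complex.Im z -> has_cderiv f z (f1 z)) ->
  (forall z, 0 < complex.Im z -> has_cderiv f1 z (f2 z)) ->
  exists2 C : R, 0 < C & forall (x : R) w,
    deep (- (y / 2)) (y / 2) (y - y / 2) (y + y / 2) (y / 4) w ->
    [/\ normc (f (x%:C%C + w)) <= C * border_mass (- (y / 2)) (y / 2) (y - y / 2) (y + y / 2)
          (fun w => f (x%:C%C + w)),
      normc (f1 (x%:C%C + w)) <= C * border_mass (- (y / 2)) (y / 2) (y - y / 2) (y + y / 2)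
          (fun w => f (x%:C%C + w)) &
      normc (f2 (x%:C%C + w)) <= C * border_mass (- (y / 2)) (y / 2) (y - y / 2) (y + y / 2)
          (fun w => f (x%:C%C + w))].
Proof.
move=> y0 df df1; have r0 : 0 < y / 4 by rewrite divr_gt0.
have W0 : 0 < normc (winding R) by rewrite normc_gt0 winding_neq0.
pose k := (y / 4)^-1; have k0 : 0 < k by rewrite invr_gt0.
(* [k] is the inverse of the margin [y / 4]; the sum of its powers dominates the bounds of orders 0,
   1 and 2. *)
pose C := 4 / normc (winding R) * (k + k ^+ 2 + k ^+ 3).
have W1 : 0 < (normc (winding R))^-1 by rewrite invr_gt0.
have C0 : 0 < C by rewrite !mulr_gt0// !addr_gt0// exprn_gt0.
exists C => // x w wd.
have dF v : onrect (- (y / 2)) (y / 2) (y - y / 2) (y + y / 2) v ->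
    has_cderiv (fun w => f (x%:C%C + w)) v (f1 (x%:C%C + v)).
  by move=> [_ /andP[h _]]; apply/has_cderiv_shift/df; rewrite Im_realD; lra.
have dw : has_cderiv (fun w => f1 (x%:C%C + w)) w (f2 (x%:C%C + w)).
  by case: wd => _ /andP[h _]; apply/has_cderiv_shift/df1; rewrite Im_realD; lra.
have le1 : - (y / 2) <= y / 2 by lra.
have le2 : y - y / 2 <= y + y / 2 by lra.
have [e0 e1 e2] := cauchy_estimates le1 le2 dF r0 wd dw.
have N0 := border_mass_ge0 (- (y / 2)) (y / 2) (y - y / 2) (y + y / 2) (fun w => f (x%:C%C + w)).
have k2 : 0 < k ^+ 2 by rewrite exprn_gt0.
have k3 : 0 < k ^+ 3 by rewrite exprn_gt0.
have Wk := mulr_gt0 W1 k0; have Wk2 := mulr_gt0 W1 k2; have Wk3 := mulr_gt0 W1 k3.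
split.
- apply: le_trans e0 _; apply: ler_wpM2r => //; rewrite -/k /C; lra.
- apply: le_trans e1 _; apply: ler_wpM2r => //; rewrite -/k /C; lra.
- apply: le_trans e2 _; apply: ler_wpM2r => //; rewrite -/k /C; lra.
Qed.

Lemma powR_continuous (g : R -> R) (p t : R) : (forall s, 0 <= g s) -> 0 <= p ->
  {for t, continuous g} -> {for t, continuous (fun s => g s `^ p)}.
Proof.
move=> g0; rewrite le_eqVlt => /predU1P[<- _|p0 gc].
  rewrite (_ : (fun s => g s `^ 0) = fun=> 1); first exact: cvg_cst.
  by apply/funext => s; rewrite powRr0.
have [gt|gt] := eqVneq (g t) 0; last first.
  have gtp : 0 < g t by rewrite lt0r gt g0.
  apply: (cvg_comp g (fun x => x `^ p)); first exact: gc.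
  exact: dv_cont (is_derive1_powR p gtp).
apply/cvgrPdist_le => e e0.
have eta0 : 0 < e `^ p^-1 by rewrite powR_gt0.
have gtt : g s @[s --> t] --> g t := gc.
have /cvgrPdist_le/(_ _ eta0) near_t := gtt.
rewrite gt powR0 ?gt_eqF//; near=> s.
rewrite sub0r normrN ger0_norm ?powR_ge0//.
have : `|g t - g s| <= e `^ p^-1 by near: s.
rewrite gt sub0r normrN ger0_norm// => h; apply: (@le_trans _ _ ((e `^ p^-1) `^ p)).
  by apply: ge0_ler_powR => //; rewrite ?nnegrE ?g0 ?ltW.
by rewrite -powRrM mulVf ?gt_eqF// powRr1// ltW.
Unshelve. all: by end_near. Qed.

(** Either [a <= l], or [a^(1 - p) <= l^(1 - p)] and one writes [a = a^(1 - p) a^p]. The threshold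
    [l] stays free so that it can be adapted to the size of the left-hand side in [powR_absorb]. *)
Lemma young_powR (p l a : R) : 1 <= p -> 0 < l -> 0 <= a -> a <= l + l `^ (1 - p) * a `^ p.
Proof.
move=> p1 l0 a0; have [al|la] := leP a l.
  by apply: le_trans al _; rewrite lerDl mulr_ge0 ?powR_ge0.
have ap : 0 < a by lra.
have : a <= l `^ (1 - p) * a `^ p; last by lra.
have p0 : 0 < p by lra.
have -> : l `^ (1 - p) = (l `^ (p - 1))^-1 by rewrite -powRN opprB.
rewrite mulrC ler_pdivlMr ?powR_gt0// -(mulr_powRB1 a0 p0).
by apply: ler_wpM2l => //; apply: ge0_ler_powR; rewrite ?nnegrE; lra.
Qed.

Lemma Rintegral_young (p l a b : R) (g : R -> R) : 1 <= p -> 0 < l -> a <= b ->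
  (forall t, 0 <= g t) -> (forall t, a <= t <= b -> {for t, continuous g}) ->
  \int[mu]_(t in `[a, b]) g t <=
  l * (b - a) + l `^ (1 - p) * \int[mu]_(t in `[a, b]) (g t `^ p).
Proof.
move=> p1 l0 ab g0 gc.
have ig := continuous_segment_integrable gc.
have igp : mu.-integrable `[a, b] (EFin \o (fun t => g t `^ p)).
  apply: continuous_segment_integrable => t /gc; apply: powR_continuous => //; lra.
have iZ : mu.-integrable `[a, b] (EFin \o (fun t => l `^ (1 - p) * g t `^ p)).
  exact: integrable_realZ.
rewrite -Rintegral_segment_cst// -RintegralZl// -RintegralD//; last first.
  exact: integrable_segment_cst.
apply: le_Rintegral => //.
  by apply: integrable_realD => //; exact: integrable_segment_cst.
by move=> t _; exact: young_powR.
Qed.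

(* Absorption: with [l = m / (8 C L)] the linear part of Young's inequality is
   at most [m / 2]. *)
Lemma powR_absorb (p m C L N V : R) : 1 <= p -> 0 <= m -> 0 < C -> 0 < L -> 0 <= V ->
  m <= C * N -> (forall l, 0 < l -> N <= 4 * (l * L) + l `^ (1 - p) * V) ->
  m `^ p <= 2 * C * (8 * C * L) `^ (p - 1) * V.
Proof.
move=> p1; rewrite le_eqVlt => /predU1P[<- C0 L0 V0 _ _|m0 C0 L0 V0 mN hN].
  by rewrite powR0 ?gt_eqF//; [rewrite !mulr_ge0 ?powR_ge0// ltW|lra].
have K0 : 0 < 8 * C * L by rewrite !mulr_gt0.
pose l := m / (8 * C * L); have l0 : 0 < l by rewrite divr_gt0.
have := hN l l0 => h.
have e1 : C * (4 * (l * L)) = m / 2 by rewrite /l; field; rewrite !gt_eqF.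
have h2 : m / 2 <= C * (l `^ (1 - p) * V).
  have := ler_wpM2l (ltW C0) h; rewrite mulrDr e1; lra.
have lp : 0 < l `^ (p - 1) by rewrite powR_gt0.
have lE : l `^ (1 - p) = (l `^ (p - 1))^-1 by rewrite -powRN opprB.
have h3 : m * l `^ (p - 1) <= 2 * C * V.
  have := ler_wpM2r (ltW lp) h2; rewrite lE -!mulrA (mulrC V) mulKf ?gt_eqF//; lra.
have p0 : 0 < p by lra.
rewrite -(mulr_powRB1 (ltW m0) p0).
have -> : m `^ (p - 1) = l `^ (p - 1) * (8 * C * L) `^ (p - 1).
  by rewrite -powRM ?(ltW l0) ?(ltW K0)// /l divfK ?gt_eqF.
rewrite mulrA [leRHS]mulrAC; apply: ler_wpM2r => //; exact: powR_ge0.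
Qed.

End HalfPlane.

(** * A dominating function with integrable [p]-th power *)

Section Domination.
Variable R : realType.
Notation mu := (@lebesgue_measure R).
Implicit Types (f g : R[i] -> R[i]) (z w : R[i]).

(** Vertical sides are extended to all parameters by clipping the height at [c], since
    [integrable_path_average] asks for paths that remain in the half-plane for every [t]. *)
Lemma pcont_clip (G : R -> R[i]) (c t : R) :
  pcont G (Num.max t c) -> pcont (fun s => G (Num.max s c)) t.
Proof.
move=> hG e /hG[d d0 hd]; exists d => // s sd.
rewrite -(subrKC (Num.max t c) (Num.max (t + s) c)); apply: hd.
apply: le_lt_trans sd; rewrite ler_norml.
have := ler_norm s; have := ler_norm (- s); rewrite normrN => ? ?.
by have [?|?] := leP t c; have [?|?] := leP (t + s) c; apply/andP; split; lra.
Qed.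

Lemma sum4_le (a1 a2 a3 a4 b1 b2 b3 b4 s k : R) :
  a1 <= s + k * b1 -> a2 <= s + k * b2 -> a3 <= s + k * b3 -> a4 <= s + k * b4 ->
  a1 + a2 + (a3 + a4) <= 4 * s + k * (b1 + b2 + (b3 + b4)).
Proof. lra. Qed.

Variables (f f1 f2 : R[i] -> R[i]).
Hypothesis df : forall z, 0 < complex.Im z -> has_cderiv f z (f1 z).

Lemma half_plane_ccont z : 0 < complex.Im z -> ccont f z.
Proof. by move=> /df; exact: has_cderiv_ccont. Qed.

Lemma pcont_real_line w : 0 < complex.Im w -> forall x, pcont (fun x => f (x%:C%C + w)) x.
Proof.
move=> w0 x; apply: (@pcont_line _ f 1 (fun x => x%:C%C + w)).
- exact: ComplexField.Normc.normc1.
- by move=> s; rewrite rmorphD/= mulr1 addrAC.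
- by apply: half_plane_ccont; rewrite Im_realD.
Qed.

Lemma normc_powR_continuous (G : R -> R[i]) (p : R) : 0 <= p ->
  (forall t, pcont G t) -> continuous (fun t => normc (G t) `^ p).
Proof.
move=> p0 hG t; apply: powR_continuous => //; first by move=> s; exact: normc_ge0.
exact: pcont_normc.
Qed.

Variables (p K : R).
Hypothesis p1 : 1 <= p.
Hypothesis fK : forall y, 0 < y -> (line_integral_pow p f y <= K%:E)%E.

Lemma line_integral_shift w : 0 < complex.Im w ->
  (\int[mu]_x (normc (f (x%:C%C + w)) `^ p)%:E = line_integral_pow p f (complex.Im w))%E.
Proof.
case: w => u v /= v0; rewrite /line_integral_pow.
rewrite -(@integral_translate _ (fun x => normc (f (x +i* v)%C) `^ p) u).
- by apply: eq_integral => x _; congr ((normc (f _) `^ p)%:E); rewrite [LHS]/GRing.add/= add0r.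
- rewrite (_ : (fun x => _) = fun x => normc (f (x%:C%C + (0 +i* v)%C)) `^ p).
    have p0 : 0 <= p := le_trans ler01 p1.
    exact: normc_powR_continuous p0 (@pcont_real_line (0 +i* v)%C v0).
  apply/funext => x; congr (normc (f _) `^ p).
  by rewrite [RHS]/GRing.add/= addr0 add0r.
- by move=> x; exact: powR_ge0.
Qed.

Lemma integrable_path_average (ga : R -> R[i]) (al be : R) : al <= be ->
  (forall t, 0 < complex.Im (ga t)) ->
  (forall x t, pcont (fun t => f (x%:C%C + ga t)) t) ->
  mu.-integrable setT
    (EFin \o (fun x => \int[mu]_(t in `[al, be]) (normc (f (x%:C%C + ga t)) `^ p))).
Proof.
move=> ab ga0 cga; have p0 : 0 <= p := le_trans ler01 p1.
apply: (@integrable_segment_average _ (fun x t => normc (f (x%:C%C + ga t)) `^ p) _ _ K) => //.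
- by move=> x t; exact: powR_ge0.
- move=> t; apply: continuous_measurable_fun.
  by apply: normc_powR_continuous => // x; exact: pcont_real_line.
- by move=> x; exact: normc_powR_continuous.
- by move=> t; rewrite line_integral_shift//; exact: fK.
Qed.

Variable y : R.
Hypothesis y0 : 0 < y.
Hypothesis df1 : forall z, 0 < complex.Im z -> has_cderiv f1 z (f2 z).

(** [m] is a multiple of the [L^1] mass of [f] on the border of the rectangle translated by [x], and
    [G] a multiple of the integral of [|f|^p] over the same border. The margin [y / 4] leaves the
    points [w] with [|Re w| <= y / 4] and [|Im w - y| <= y / 4]. *)
Lemma half_plane_dominated : exists m G : R -> R,
  [/\ forall x, 0 <= m x, forall x, m x `^ p <= G x, mu.-integrable setT (EFin \o G) &
  forall x w, deep (- (y / 2)) (y / 2) (y - y / 2) (y + y / 2) (y / 4) w ->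
    [/\ normc (f (x%:C%C + w)) <= m x, normc (f1 (x%:C%C + w)) <= m x &
        normc (f2 (x%:C%C + w)) <= m x]].
Proof.
have yp := y0; have [C C0 hC] := half_plane_estimates y0 df df1.
set a := - (y / 2) in hC *; set b := y / 2 in hC *.
set c := y - y / 2 in hC *; set d := y + y / 2 in hC *.
have ab : a <= b by rewrite /a /b; lra.
have cd : c <= d by rewrite /c /d; lra.
have c0 : 0 < c by rewrite /c; lra.
have d0 : 0 < d by rewrite /d; lra.
have p0 : 0 <= p := le_trans ler01 p1.
pose ver u t : R[i] := (u +i* Num.max t c)%C.
pose hor v t : R[i] := (t +i* v)%C.
have verc u x t : pcont (fun t => f (x%:C%C + ver u t)) t.
  apply: (@pcont_clip (fun t => f (x%:C%C + (u +i* t)%C))).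
  have h : 0 < complex.Im (x%:C%C + (u +i* Num.max t c)%C).
    by rewrite Im_realD/= lt_max c0 orbT.
  exact: (@pcont_v _ (fun w => f (x%:C%C + w)) _ _
    (has_cderiv_ccont (has_cderiv_shift (df h)))).
have horc v x t : 0 < v -> pcont (fun t => f (x%:C%C + hor v t)) t.
  move=> v0; have h : 0 < complex.Im (x%:C%C + (t +i* v)%C) by rewrite Im_realD.
  exact: (@pcont_h _ (fun w => f (x%:C%C + w)) _ _
    (has_cderiv_ccont (has_cderiv_shift (df h)))).
pose I al be (ga : R -> R[i]) x := \int[mu]_(t in `[al, be]) (normc (f (x%:C%C + ga t)) `^ p).
pose V x := I a b (hor c) x + I a b (hor d) x + (I c d (ver b) x + I c d (ver a) x).
have V0 x : 0 <= V x.
  by rewrite /V !addr_ge0// Rintegral_ge0// => t _; exact: powR_ge0.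
have iV : mu.-integrable setT (EFin \o V).
  have ivert u : mu.-integrable setT (EFin \o I c d (ver u)).
    by apply: integrable_path_average => // t; rewrite /= lt_max c0 orbT.
  have ihor v : 0 < v -> mu.-integrable setT (EFin \o I a b (hor v)).
    by move=> v0; apply: integrable_path_average => // x t; exact: horc.
  by do ![apply: integrable_realD => //]; by [exact: ihor|exact: ivert].
pose N x := border_mass a b c d (fun w => f (x%:C%C + w)).
pose J al be (ga : R -> R[i]) x := \int[mu]_(t in `[al, be]) (normc (f (x%:C%C + ga t))).
have NE x : N x = J a b (hor c) x + J a b (hor d) x + (J c d (ver b) x + J c d (ver a) x).
  rewrite /N /border_mass /J; congr (_ + _).
    by apply: RintegralD => //; apply: integrable_normc => t _; exact: horc.
  rewrite -RintegralD//; try by apply: integrable_normc => t _; exact: verc.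
  apply: eq_Rintegral => t; rewrite inE/= in_itv/= => /andP[ct _].
  by rewrite /ver max_l.
have NV x l : 0 < l -> N x <= 4 * (l * y) + l `^ (1 - p) * V x.
  move=> l0.
  have yg al be ga : al <= be -> be - al = y -> (forall t, pcont (fun t => f (x%:C%C + ga t)) t) ->
      J al be ga x <= l * y + l `^ (1 - p) * I al be ga x.
    move=> albe <- hga; apply: Rintegral_young => //; first by move=> t; exact: normc_ge0.
    by move=> t _; exact: pcont_normc.
  have e1 : b - a = y by rewrite /a /b; lra.
  have e2 : d - c = y by rewrite /c /d; lra.
  rewrite NE; exact: sum4_le (yg _ _ _ ab e1 (fun t => horc c x t c0))
    (yg _ _ _ ab e1 (fun t => horc d x t d0)) (yg _ _ _ cd e2 (verc b x))
    (yg _ _ _ cd e2 (verc a x)).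
(* All four sides have length [y], so [powR_absorb] applies with [L = y]. *)
exists (fun x => C * N x), (fun x => 2 * C * (8 * C * y) `^ (p - 1) * V x); split.
- by move=> x; rewrite mulr_ge0 ?border_mass_ge0// ltW.
- move=> x; apply: (@powR_absorb _ _ _ _ _ (N x)) => //; last by move=> l; exact: NV.
  by rewrite mulr_ge0 ?border_mass_ge0// ltW.
- exact: integrable_realZ.
- by move=> x w /(hC x).
Qed.

End Domination.

(** * Directional derivatives of |f| ^ p *)

Section LineDerivatives.
Variable R : realType.
Notation mu := (@lebesgue_measure R).
Implicit Types (g : R[i] -> R[i]) (z w e : R[i]).

Definition dot z w : R := complex.Re z * complex.Re w + complex.Im z * complex.Im w.

Lemma dot_le z w : `|dot z w| <= normc z * normc w.
Proof.
have zw0 : 0 <= normc z * normc w by rewrite mulr_ge0 ?normc_ge0.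
rewrite -(ger0_norm zw0) -ler_sqr ?nnegrE ?normr_ge0// !real_normK ?num_real//.
rewrite exprMn !normc_sqr /dot.
(* Lagrange's identity: this square is the difference of the two sides. *)
have := sqr_ge0 (complex.Re z * complex.Im w - complex.Im z * complex.Re w); lra.
Qed.

Lemma dotzz z : dot z z = normc z ^+ 2.
Proof. by rewrite normc_sqr /dot -!expr2. Qed.

(** [q] stands for the real or the imaginary part: a real-linear form that does not increase the
    modulus. *)
Lemma path_derive (q : R[i] -> R) g z e l (t : R) :
  (forall w, `|q w| <= normc w) -> (forall v w, q (v - w) = q v - q w) ->
  (forall (k : R) w, q (k%:C%C * w) = k * q w) ->
  normc e = 1 -> has_cderiv g (z + t%:C%C * e) l ->
  is_derive t (1 : R) (fun s => q (g (z + s%:C%C * e))) (q (e * l)).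
Proof.
move=> qle qB qZ e1 gl; apply: eps_is_derive => eps /gl[d d0 hd]; exists d => // h hd'.
have nh : normc (h%:C%C * e) = `|h| by rewrite normcM normc_real e1 mulr1.
have -> : q (g (z + (t + h)%:C%C * e)) - q (g (z + t%:C%C * e)) - q (e * l) * h =
  q (g (z + t%:C%C * e + h%:C%C * e) - g (z + t%:C%C * e) - l * (h%:C%C * e)).
  rewrite !qB; congr (q (g _) - _ - _); first by rewrite rmorphD/= mulrDl addrA.
  by rewrite mulrC -qZ; congr q; ring.
by apply: le_trans (qle _) _; rewrite -nh; apply: hd; rewrite nh.
Qed.

Lemma path_derive_Re g z e l (t : R) : normc e = 1 -> has_cderiv g (z + t%:C%C * e) l ->
  is_derive t (1 : R) (fun s => complex.Re (g (z + s%:C%C * e))) (complex.Re (e * l)).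
Proof.
apply: path_derive; [exact: Re_le_normc|exact: ReB|exact: ReZ].
Qed.

Lemma path_derive_Im g z e l (t : R) : normc e = 1 -> has_cderiv g (z + t%:C%C * e) l ->
  is_derive t (1 : R) (fun s => complex.Im (g (z + s%:C%C * e))) (complex.Im (e * l)).
Proof.
apply: path_derive; [exact: Im_le_normc|exact: ImB|].
by move=> k w; case: w => a b /=; ring.
Qed.

Lemma dv_dot (g h : R[i] -> R[i]) z e lg lh (t : R) : normc e = 1 ->
  has_cderiv g (z + t%:C%C * e) lg -> has_cderiv h (z + t%:C%C * e) lh ->
  is_derive t (1 : R) (fun s => dot (g (z + s%:C%C * e)) (h (z + s%:C%C * e)))
    (dot (e * lg) (h (z + t%:C%C * e)) + dot (g (z + t%:C%C * e)) (e * lh)).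
Proof.
move=> e1 dg dh.
have := dvD (dvM (path_derive_Re e1 dg) (path_derive_Re e1 dh))
  (dvM (path_derive_Im e1 dg) (path_derive_Im e1 dh)).
by move=> H; apply: dv_eq H _; rewrite /dot; ring.
Qed.

Variables (f f1 f2 f3 : R[i] -> R[i]).
Hypothesis df : forall z, 0 < complex.Im z -> has_cderiv f z (f1 z).
Hypothesis df1 : forall z, 0 < complex.Im z -> has_cderiv f1 z (f2 z).
Hypothesis df2 : forall z, 0 < complex.Im z -> has_cderiv f2 z (f3 z).
Variables (p K : R).
Hypothesis p2 : 2 <= p.
Hypothesis fK : forall y, 0 < y -> (line_integral_pow p f y <= K%:E)%E.

Let r := p / 2.
Let r1 : 1 <= r. Proof. by rewrite /r; have := p2; lra. Qed.

(* [|f| ^ p] is written [(|f| ^ 2) ^ (p / 2)] since [|f| ^ 2] is smooth; the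
   suffixes 1 and 2 stand for the derivatives in the direction [e]. *)
Definition modsq z := normc (f z) ^+ 2.
Definition modsq1 e z := 2 * dot (f z) (e * f1 z).
Definition modsq2 e z := 2 * (dot (e * f1 z) (e * f1 z) + dot (f z) (e * (e * f2 z))).
Definition modpow z := modsq z `^ r.
Definition modpow1 e z := r * (modsq z `^ (r - 1) * modsq1 e z).
Definition modpow2 e z := r * ((r - 1) * modsq z `^ (r - 2) * modsq1 e z ^+ 2 +
  modsq z `^ (r - 1) * modsq2 e z).

Lemma modsq_ge0 z : 0 <= modsq z.
Proof. exact: sqr_ge0. Qed.

Lemma modpowE z : modpow z = normc (f z) `^ p.
Proof.
rewrite /modpow /modsq -powR_mulrn ?normc_ge0// -powRrM /r.
by congr powR; field.
Qed.

Section Path.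
Variables (z e : R[i]) (t : R).
Hypotheses (e1 : normc e = 1) (zt : 0 < complex.Im (z + t%:C%C * e)).

Let dmodsq : is_derive t (1 : R) (fun s => modsq (z + s%:C%C * e)) (modsq1 e (z + t%:C%C * e)).
Proof.
rewrite (_ : (fun s => _) = fun s : R => dot (f (z + s%:C%C * e)) (f (z + s%:C%C * e))).
  by apply: dv_eq (dv_dot e1 (df zt) (df zt)) _; rewrite /modsq1 /dot; ring.
by apply/funext => s; rewrite dotzz.
Qed.

Let dmodsq1 : is_derive t (1 : R) (fun s => modsq1 e (z + s%:C%C * e)) (modsq2 e (z + t%:C%C * e)).
Proof.
have de : has_cderiv (fun w => e * f1 w) (z + t%:C%C * e) (e * f2 (z + t%:C%C * e)).
  by have := has_cderivM (has_cderiv_cst e _) (df1 zt); rewrite mul0r add0r.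
exact: dvZ (dv_dot e1 (df zt) de).
Qed.

Lemma dv_modpow :
  is_derive t (1 : R) (fun s => modpow (z + s%:C%C * e)) (modpow1 e (z + t%:C%C * e)).
Proof.
exact: (is_derive_powR_ge0 r1 (fun s => modsq_ge0 (z + s%:C%C * e)) dmodsq).
Qed.

Lemma dv_modpow1 :
  is_derive t (1 : R) (fun s => modpow1 e (z + s%:C%C * e)) (modpow2 e (z + t%:C%C * e)).
Proof.
exact: (is_derive_powR_ge0' (S1 := fun s => modsq1 e (z + s%:C%C * e)) r1
  (fun s => modsq_ge0 (z + s%:C%C * e)) dmodsq dmodsq1).
Qed.

End Path.

Section Bounds.
Variables (z e : R[i]) (m : R).
Hypotheses (e1 : normc e = 1) (m0 : normc (f z) <= m) (m1 : normc (f1 z) <= m)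
  (m2 : normc (f2 z) <= m).

Let mge0 : 0 <= m. Proof. exact: le_trans (normc_ge0 _) m0. Qed.

Let msq : modsq z <= m ^+ 2.
Proof. by rewrite /modsq ler_sqr ?nnegrE ?normc_ge0. Qed.

Let mp : (m ^+ 2) `^ (r - 1) * m ^+ 2 = m `^ p.
Proof.
have r0 : 0 < r by have := r1; lra.
rewrite mulrC (mulr_powRB1 (sqr_ge0 m) r0) -(powR_mulrn 2 mge0) -powRrM.
by congr powR; rewrite /r; field.
Qed.

Let mr1 : modsq z `^ (r - 1) <= (m ^+ 2) `^ (r - 1).
Proof.
by apply: ge0_ler_powR; rewrite ?nnegrE ?sqr_ge0//; have := r1; lra.
Qed.

Let mmsq1 : `|modsq1 e z| <= 2 * m ^+ 2.
Proof.
rewrite normrM (gtr0_norm (ltr0n _ 2)) ler_pM2l//; apply: le_trans (dot_le _ _) _.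
by rewrite normcM e1 mul1r expr2; apply: ler_pM; rewrite ?normc_ge0.
Qed.

(** The constant [4 r^2] is common to the orders 0, 1 and 2, so that one dominating function serves
    all three: the computations give 1, [2 r] and [4 r^2], and [r >= 1]. *)
Lemma modpow_bound : `|modpow z| <= 4 * r ^+ 2 * m `^ p.
Proof.
rewrite modpowE ger0_norm ?powR_ge0//.
apply: (@le_trans _ _ (m `^ p)); last first.
  by rewrite ler_peMl ?powR_ge0//; have := r1; nra.
by apply: ge0_ler_powR; rewrite ?nnegrE ?normc_ge0//; have := p2; lra.
Qed.

Lemma modpow1_bound : `|modpow1 e z| <= 4 * r ^+ 2 * m `^ p.
Proof.
rewrite /modpow1 normrM (ger0_norm (_ : 0 <= r)); last by have := r1; lra.
rewrite normrM (ger0_norm (powR_ge0 _ _)).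
apply: (@le_trans _ _ (r * ((m ^+ 2) `^ (r - 1) * (2 * m ^+ 2)))).
  apply: ler_wpM2l; first by have := r1; lra.
  by apply: ler_pM => //; exact: powR_ge0.
have -> : r * ((m ^+ 2) `^ (r - 1) * (2 * m ^+ 2)) = 2 * r * ((m ^+ 2) `^ (r - 1) * m ^+ 2).
  by ring.
by rewrite mp ler_wpM2r ?powR_ge0//; have := r1; nra.
Qed.

(** The factor [r - 1] makes this true at the zeros of [f] too: for [r = 1] it is 0, and for [r > 1]
    both sides vanish. *)
Lemma modsq_pow_pred : (r - 1) * modsq z `^ (r - 2) * modsq z = (r - 1) * modsq z `^ (r - 1).
Proof.
have [S0|S0] := eqVneq (modsq z) 0.
  rewrite S0 mulr0; have [->|rn] := eqVneq (r - 1) 0; first by rewrite mul0r.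
  by rewrite powR0// mulr0.
rewrite -mulrA; congr (_ * _); have -> : r - 1 = r - 2 + 1 by ring.
by rewrite [RHS]powRD ?S0 ?implybT// powRr1 ?modsq_ge0.
Qed.

Lemma modpow2_bound : `|modpow2 e z| <= 4 * r ^+ 2 * m `^ p.
Proof.
have rr := r1; have r0 : 0 <= r by lra.
have rm : 0 <= r - 1 by rewrite subr_ge0.
have P0 := powR_ge0 (modsq z) (r - 1); have Q0 := powR_ge0 (modsq z) (r - 2).
have s2 : `|modsq2 e z| <= 4 * m ^+ 2.
  rewrite normrM (gtr0_norm (ltr0n _ 2)).
  apply: (@le_trans _ _ (2 * (m ^+ 2 + m ^+ 2))); last by lra.
  rewrite ler_pM2l//; apply: le_trans (ler_normD _ _) _; apply: lerD.
    apply: le_trans (dot_le _ _) _.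
    by rewrite normcM e1 mul1r expr2; apply: ler_pM; rewrite ?normc_ge0.
  apply: le_trans (dot_le _ _) _.
  by rewrite !normcM e1 !mul1r expr2; apply: ler_pM; rewrite ?normc_ge0.
(* One factor [modsq z] is kept in the bound: it raises the possibly negative exponent [r - 2] to
   [r - 1]. *)
have s1 : modsq1 e z ^+ 2 <= 4 * (modsq z * m ^+ 2).
  rewrite -real_normK ?num_real//.
  apply: (@le_trans _ _ ((2 * (normc (f z) * m)) ^+ 2)); last by rewrite /modsq; lra.
  rewrite ler_sqr ?nnegrE ?normr_ge0// ?mulr_ge0 ?normc_ge0//.
  rewrite normrM (gtr0_norm (ltr0n _ 2)) ler_pM2l//; apply: le_trans (dot_le _ _) _.
  by rewrite normcM e1 mul1r ler_wpM2l ?normc_ge0.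
rewrite normrM (ger0_norm r0).
apply: (@le_trans _ _ (r * ((r - 1) * modsq z `^ (r - 2) * (4 * (modsq z * m ^+ 2))
   + modsq z `^ (r - 1) * (4 * m ^+ 2)))).
  apply: ler_wpM2l => //; apply: le_trans (ler_normD _ _) _; apply: lerD.
    rewrite ger0_norm; last by apply: mulr_ge0 (sqr_ge0 _); exact: mulr_ge0.
    by apply: ler_wpM2l => //; rewrite mulr_ge0.
  by rewrite normrM (ger0_norm P0); apply: ler_wpM2l.
have -> : r * ((r - 1) * modsq z `^ (r - 2) * (4 * (modsq z * m ^+ 2))
   + modsq z `^ (r - 1) * (4 * m ^+ 2)) =
   r * (4 * ((r - 1) * modsq z `^ (r - 2) * modsq z) * m ^+ 2
   + modsq z `^ (r - 1) * (4 * m ^+ 2)) by ring.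
rewrite modsq_pow_pred.
have -> : r * (4 * ((r - 1) * modsq z `^ (r - 1)) * m ^+ 2
   + modsq z `^ (r - 1) * (4 * m ^+ 2)) = 4 * r ^+ 2 * (modsq z `^ (r - 1) * m ^+ 2) by ring.
rewrite -mp; apply: ler_wpM2l; first by rewrite mulr_ge0 ?sqr_ge0.
by apply: ler_wpM2r; rewrite ?sqr_ge0.
Qed.

End Bounds.

Lemma dot_line_continuous (g h : R[i] -> R[i]) w :
  (forall x, pcont (fun x => g (x%:C%C + w)) x) ->
  (forall x, pcont (fun x => h (x%:C%C + w)) x) ->
  continuous (fun x : R => dot (g (x%:C%C + w)) (h (x%:C%C + w))).
Proof.
move=> cg ch x; rewrite /dot; apply: cvgD; apply: cvgM.
- exact: (pcont_Re (cg x)).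
- exact: (pcont_Re (ch x)).
- exact: (pcont_Im (cg x)).
- exact: (pcont_Im (ch x)).
Qed.

Section LineContinuity.
Variables (w e : R[i]).
Hypothesis w0 : 0 < complex.Im w.

Let cf := pcont_real_line df w0.
Let cf1 := pcont_real_line df1 w0.
Let cf2 := pcont_real_line df2 w0.
Let ce g (h : forall x, pcont (fun x => g (x%:C%C + w)) x) x :
  pcont (fun x => (e * g (x%:C%C + w))) x := pcontZ e (h x).

Lemma modsq_continuous : continuous (fun x : R => modsq (x%:C%C + w)).
Proof.
rewrite (_ : (fun x : R => _) = fun x : R => dot (f (x%:C%C + w)) (f (x%:C%C + w))).
  exact: dot_line_continuous.
by apply/funext => x; rewrite dotzz.
Qed.

Lemma modsq_powR_continuous s : 0 <= s ->
  continuous (fun x : R => modsq (x%:C%C + w) `^ s).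
Proof.
move=> s0 x; apply: (@powR_continuous _ (fun x : R => modsq (x%:C%C + w))) => //.
  by move=> ?; exact: modsq_ge0.
exact: modsq_continuous.
Qed.

Lemma modsq1_continuous : continuous (fun x : R => modsq1 e (x%:C%C + w)).
Proof.
move=> x; apply: cvgM; first exact: cvg_cst.
exact: (dot_line_continuous cf (h := fun z => e * f1 z) (ce cf1)).
Qed.

Lemma modsq2_continuous : continuous (fun x : R => modsq2 e (x%:C%C + w)).
Proof.
move=> x; apply: cvgM; first exact: cvg_cst.
apply: cvgD.
  exact: (dot_line_continuous (g := fun z => e * f1 z) (h := fun z => e * f1 z) (ce cf1) (ce cf1)).
exact: (dot_line_continuous cf (h := fun z => e * (e * f2 z))
  (fun x => pcontZ e (pcontZ e (cf2 x)))).
Qed.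

Let ms s : measurable_fun setT (fun x : R => modsq (x%:C%C + w) `^ s).
Proof.
exact: (measurableT_comp (@measurable_powR _ s)
  (continuous_measurable_fun modsq_continuous)).
Qed.

Lemma measurable_modpow : measurable_fun setT (fun x : R => modpow (x%:C%C + w)).
Proof. exact: ms. Qed.

Lemma measurable_modpow1 : measurable_fun setT (fun x : R => modpow1 e (x%:C%C + w)).
Proof.
exact: (measurable_funM (@measurable_cst _ _ _ _ _ r)
  (measurable_funM (ms _) (continuous_measurable_fun modsq1_continuous))).
Qed.

(** Measurability replaces continuity here, because the exponent [r - 2] is negative when
    [p < 4]. *)
Lemma measurable_modpow2 : measurable_fun setT (fun x : R => modpow2 e (x%:C%C + w)).
Proof.
have m1 := continuous_measurable_fun modsq1_continuous.
have m2 := continuous_measurable_fun modsq2_continuous.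
exact: (measurable_funM (@measurable_cst _ _ _ _ _ r) (measurable_funD
  (measurable_funM (measurable_funM (@measurable_cst _ _ _ _ _ (r - 1)) (ms _))
    (measurable_funX 2 m1)) (measurable_funM (ms _) m2))).
Qed.

End LineContinuity.

End LineDerivatives.

(** * Means over horizontal lines *)

Section IntegralDerivative.
Variable R : realType.
Notation mu := (@lebesgue_measure R).

Lemma dv_integral (U V : R -> R -> R) (G : R -> R) (d : R) :
  (forall t, `|t| < d -> mu.-integrable setT (EFin \o U t)) ->
  (forall t x, `|t| < d -> is_derive t (1 : R) (U ^~ x) (V t x)) ->
  (forall x, 0 <= G x) -> mu.-integrable setT (EFin \o G) ->
  (forall t x, `|t| < d -> `|V t x| <= G x) ->
  forall t, `|t| < d ->
  is_derive t (1 : R) (fun s => \int[mu]_x U s x) (\int[mu]_x V t x).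
Proof.
move=> iU dU G0 iG VG t td.
have ballE (s : R) : `](- d), d[%classic s = (`|s| < d) :> Prop.
  by rewrite ltr_norml /= in_itv.
have td' : `](- d), d[%classic t by rewrite ballE.
have inI (s : R) : `](- d), d[%classic s -> `|s| < d by rewrite ballE.
have d1 s x : `|s| < d -> partial1of2 U s x = V s x.
  by move=> sd; rewrite /partial1of2; exact: dv_derive1 (dU s x sd).
have iU' s : `](- d), d[%classic s -> mu.-integrable setT (EFin \o U s) by move=> /inI/iU.
have dU' s x : `](- d), d[%classic s -> setT x -> derivable (U ^~ x) s 1.
  by move=> /inI sd _; case: (dU s x sd).
have VG' s x : `](- d), d[%classic s -> setT x -> `|partial1of2 U s x| <= G x.
  by move=> /inI sd _; rewrite d1//; exact: VG.
have h1 := derivable_under_integral measurableT td' iU' dU' G0 iG VG'.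
have h2 := differentiation_under_integral measurableT td' iU' dU' G0 iG VG'.
apply: DeriveDef; first exact: h1.
by rewrite -derive1E h2; apply: eq_Rintegral => x _; exact: d1.
Qed.

End IntegralDerivative.

Section LineMeans.
Variable R : realType.
Notation mu := (@lebesgue_measure R).
Variables (f f1 f2 f3 : R[i] -> R[i]).
Hypothesis df : forall z, 0 < complex.Im z -> has_cderiv f z (f1 z).
Hypothesis df1 : forall z, 0 < complex.Im z -> has_cderiv f1 z (f2 z).
Hypothesis df2 : forall z, 0 < complex.Im z -> has_cderiv f2 z (f3 z).
Variables (p K : R).
Hypothesis p2 : 2 <= p.
Hypothesis fK : forall y, 0 < y -> (line_integral_pow p f y <= K%:E)%E.

Local Notation line y x := (x%:C%C + (0 +i* y)%C).
Local Notation u := (modpow f p).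
Local Notation u1 := (modpow1 f f1 p).
Local Notation u2 := (modpow2 f f1 f2 p).

(** The direction ['i] gives the derivatives of the mean in [y]; the direction [1] gives integrals
    that translation invariance determines. For [|t| < y / 4] the shifted line stays where
    [half_plane_dominated] applies. *)
Lemma line_means_near (y : R) (e : R[i]) : 0 < y -> normc e = 1 ->
  [/\ [/\ mu.-integrable setT (EFin \o fun x : R => u (line y x)),
     mu.-integrable setT (EFin \o fun x : R => u1 e (line y x)) &
     mu.-integrable setT (EFin \o fun x : R => u2 e (line y x))],
   forall t : R, `|t| < y / 4 ->
     is_derive t (1 : R) (fun s : R => \int[mu]_x u (line y x + s%:C%C * e))
       (\int[mu]_x u1 e (line y x + t%:C%C * e)) &
   forall t : R, `|t| < y / 4 ->
     is_derive t (1 : R) (fun s : R => \int[mu]_x u1 e (line y x + s%:C%C * e))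
       (\int[mu]_x u2 e (line y x + t%:C%C * e))].
Proof.
move=> y0 e1.
have p1 : 1 <= p := le_trans (ler1n _ 2) p2.
have [m [G [m0 mG iG hm]]] := half_plane_dominated df p1 fK y0 df1.
have Im_le (t : R) : `|t| < y / 4 ->
    `|complex.Re (t%:C%C * e)| <= y / 4 /\ `|complex.Im (t%:C%C * e)| <= y / 4.
  move=> td; have nt : normc (t%:C%C * e) <= y / 4 by rewrite normcM normc_real e1 mulr1 ltW.
  by split; apply: le_trans nt; [exact: Re_le_normc|exact: Im_le_normc].
pose w (t : R) := (0 +i* y)%C + t%:C%C * e.
have lineE (t x : R) : line y x + t%:C%C * e = x%:C%C + w t by rewrite /w addrA.
have deepw (t : R) : `|t| < y / 4 -> deep (- (y / 2)) (y / 2) (y - y / 2) (y + y / 2) (y / 4) (w t).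
  move=> /Im_le[]; rewrite !ler_norml => /andP[h1 h2] /andP[h3 h4].
  have -> : w t = (0 +i* y)%C - - (t%:C%C * e) by rewrite opprK.
  rewrite /deep ReB ImB.
  have -> : complex.Re (- (t%:C%C * e)) = - complex.Re (t%:C%C * e) by case: (t%:C%C * e).
  have -> : complex.Im (- (t%:C%C * e)) = - complex.Im (t%:C%C * e) by case: (t%:C%C * e).
  rewrite [complex.Re (0 +i* y)%C]/= [complex.Im (0 +i* y)%C]/=.
  by split; apply/andP; split; lra.
have Imw (t : R) : `|t| < y / 4 -> 0 < complex.Im (w t).
  by move=> /deepw[_ /andP[h _]]; lra.
pose H x := 4 * (p / 2) ^+ 2 * G x.
have c0 : 0 <= 4 * (p / 2) ^+ 2 by rewrite mulr_ge0// sqr_ge0.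
have iH : mu.-integrable setT (EFin \o H) by exact: integrable_realZ.
have H0 x : 0 <= H x by rewrite mulr_ge0// (le_trans _ (mG x))// powR_ge0.
have mH x : 4 * (p / 2) ^+ 2 * m x `^ p <= H x by exact: ler_wpM2l.
have dom (h : R -> R) : measurable_fun setT h -> (forall x, `|h x| <= H x) ->
    mu.-integrable setT (EFin \o h).
  move=> mh hH; apply: le_integrable iH => //; first exact/measurable_EFinP.
  by move=> x _; rewrite /= lee_fin (ger0_norm (H0 x)).
have b0 (t x : R) : `|t| < y / 4 -> `|u (x%:C%C + w t)| <= H x.
  by move=> /deepw/(hm x)[h0 h1 h2]; apply: le_trans (mH x); exact: modpow_bound.
have b1 (t x : R) : `|t| < y / 4 -> `|u1 e (x%:C%C + w t)| <= H x.
  by move=> /deepw/(hm x)[h0 h1 h2]; apply: le_trans (mH x); exact: modpow1_bound.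
have b2 (t x : R) : `|t| < y / 4 -> `|u2 e (x%:C%C + w t)| <= H x.
  by move=> /deepw/(hm x)[h0 h1 h2]; apply: le_trans (mH x); exact: modpow2_bound.
have i0 (t : R) : `|t| < y / 4 -> mu.-integrable setT (EFin \o fun x : R => u (x%:C%C + w t)).
  move=> td; apply: dom => [|x]; last exact: b0.
  exact: measurable_modpow df _ _ (Imw t td).
have i1 (t : R) : `|t| < y / 4 -> mu.-integrable setT (EFin \o fun x : R => u1 e (x%:C%C + w t)).
  move=> td; apply: dom => [|x]; last exact: b1.
  exact: measurable_modpow1 df df1 _ _ _ (Imw t td).
have i2 (t : R) : `|t| < y / 4 -> mu.-integrable setT (EFin \o fun x : R => u2 e (x%:C%C + w t)).
  move=> td; apply: dom => [|x]; last exact: b2.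
  exact: measurable_modpow2 df df1 df2 _ _ _ (Imw t td).
have t0 : `|0 : R| < y / 4 by rewrite normr0 divr_gt0.
have Imline (t x : R) : `|t| < y / 4 -> 0 < complex.Im (line y x + t%:C%C * e).
  by move=> /Imw; rewrite lineE Im_realD.
split.
- have w0 : w 0 = (0 +i* y)%C by rewrite /w mul0r addr0.
  by have := i0 0 t0; have := i1 0 t0; have := i2 0 t0; rewrite w0.
- apply: (@dv_integral _ (fun t x => u (line y x + t%:C%C * e))
    (fun t x => u1 e (line y x + t%:C%C * e)) H).
  + by move=> t td; under eq_fun do rewrite lineE; exact: i0.
  + by move=> t x td; apply: dv_modpow => //; exact: Imline.
  + exact: H0.
  + exact: iH.
  + by move=> t x td; rewrite lineE; exact: b1.
- apply: (@dv_integral _ (fun t x => u1 e (line y x + t%:C%C * e))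
    (fun t x => u2 e (line y x + t%:C%C * e)) H).
  + by move=> t td; under eq_fun do rewrite lineE; exact: i1.
  + by move=> t x td; apply: dv_modpow1 => //; exact: Imline.
  + exact: H0.
  + exact: iH.
  + by move=> t x td; rewrite lineE; exact: b2.
Qed.

Definition line_mean (y : R) : R := \int[mu]_x u (line y x).
Definition line_mean1 (y : R) : R := \int[mu]_x u1 'i%C (line y x).
Definition energy z : R := p ^+ 2 * (modsq f z `^ (p / 2 - 1) * normc (f1 z) ^+ 2).
Definition line_energy (y : R) : R := \int[mu]_x energy (line y x).

Lemma normc1 : normc (1 : R[i]) = 1.
Proof. exact: ComplexField.Normc.normc1. Qed.

(* [u2] is a second directional derivative: adding the directions [1] and ['i]
   gives the Laplacian of [|f| ^ p], which is [p^2 |f|^(p-2) |f'|^2]. *)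
Lemma modpow2_laplacian z : u2 1 z + u2 'i%C z = energy z.
Proof.
have sq (a b : R[i]) : dot a b ^+ 2 + dot a ('i%C * b) ^+ 2 = normc a ^+ 2 * normc b ^+ 2.
  by case: a b => [a a'] [b b']; rewrite !normc_sqr /dot/=; ring.
have s1 : modsq1 f f1 1 z ^+ 2 + modsq1 f f1 'i%C z ^+ 2 = 4 * (modsq f z * normc (f1 z) ^+ 2).
  by rewrite /modsq1 !exprMn mul1r -mulrDr sq /modsq; ring.
have s2 : modsq2 f f1 f2 1 z + modsq2 f f1 f2 'i%C z = 4 * normc (f1 z) ^+ 2.
  rewrite /modsq2 !mul1r !dotzz normcM normc_i mul1r.
  have -> : dot (f z) ('i%C * ('i%C * f2 z)) = - dot (f z) (f2 z).
    by case: (f z) (f2 z) => [a a'] [b b']; rewrite /dot/=; ring.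
  by ring.
have -> : u2 1 z + u2 'i%C z = p / 2 * ((p / 2 - 1) * modsq f z `^ (p / 2 - 2) *
   (modsq1 f f1 1 z ^+ 2 + modsq1 f f1 'i%C z ^+ 2) +
   modsq f z `^ (p / 2 - 1) * (modsq2 f f1 f2 1 z + modsq2 f f1 f2 'i%C z)).
  by rewrite /modpow2; ring.
rewrite /energy s1 s2.
have -> : (p / 2 - 1) * modsq f z `^ (p / 2 - 2) * (4 * (modsq f z * normc (f1 z) ^+ 2)) =
  (p / 2 - 1) * modsq f z `^ (p / 2 - 2) * modsq f z * (4 * normc (f1 z) ^+ 2) by ring.
by rewrite modsq_pow_pred; field.
Qed.

(** The trinomial is [|f|^(p - 2) |l f + i p f'|^2], where [i f'] is the vertical derivative of
    [f]. *)
Lemma discriminant_pointwise z l :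
  0 <= l ^+ 2 * u z + 2 * l * u1 'i%C z + energy z.
Proof.
have r0 : 0 < p / 2 by rewrite divr_gt0// (lt_le_trans _ p2).
have -> : l ^+ 2 * u z + 2 * l * u1 'i%C z + energy z =
  modsq f z `^ (p / 2 - 1) *
   ((l * complex.Re (f z) - p * complex.Im (f1 z)) ^+ 2 +
    (l * complex.Im (f z) + p * complex.Re (f1 z)) ^+ 2).
  rewrite /modpow -(mulr_powRB1 (modsq_ge0 f z) r0) /modpow1 /energy /modsq1.
  move: (modsq f z `^ (p / 2 - 1)) => P; rewrite /modsq !normc_sqr.
  by case: (f z) (f1 z) => [a b] [c d]; rewrite /dot/=; field.
by rewrite mulr_ge0 ?powR_ge0// addr_ge0// sqr_ge0.
Qed.

Lemma energy_ge0 z : 0 <= energy z.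
Proof. by rewrite mulr_ge0 ?sqr_ge0// mulr_ge0 ?powR_ge0// sqr_ge0. Qed.

Lemma line_meanE (y : R) : 0 < y -> (line_mean y)%:E = line_integral_pow p f y.
Proof.
move=> y0; rewrite -(line_integral_shift df (le_trans (ler1n _ 2) p2) (w := (0 +i* y)%C) y0).
have [[i0 _ _] _ _] := line_means_near y0 normc1.
rewrite /line_mean /Rintegral fineK; last exact: integrable_fin_num.
by apply: eq_integral => x _; rewrite modpowE.
Qed.

Lemma line_vertical (y t x : R) : line y x + t%:C%C * 'i%C = line (y + t) x.
Proof. by apply/eqP; rewrite eq_complex/=; apply/andP; split; apply/eqP; ring. Qed.

Lemma line_horizontal (y t x : R) : line y x + t%:C%C * 1 = line y (x + t).
Proof. by apply/eqP; rewrite eq_complex/=; apply/andP; split; apply/eqP; ring. Qed.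

Lemma dv_shift (g h : R -> R) (y : R) l :
  is_derive (0 : R) (1 : R) g l -> (forall t, g t = h (y + t)) -> is_derive y (1 : R) h l.
Proof.
move=> gl gh.
have gl' : is_derive (y - y) (1 : R) g l by rewrite subrr.
have := @dv_comp _ g (fun s => s - y) y _ _ gl' (dvB (dv_id y) (dv_cst y y)).
rewrite subr0 mulr1.
by congr is_derive; apply/funext => s; rewrite gh addrC subrK.
Qed.

Lemma dv_line_mean (y : R) : 0 < y -> is_derive y (1 : R) line_mean (line_mean1 y).
Proof.
move=> y0; have [_ h _] := line_means_near y0 (normc_i R).
have t0 : `|0 : R| < y / 4 by rewrite normr0 divr_gt0.
have := h 0 t0; rewrite (_ : \int[mu]_x _ = line_mean1 y); last first.
  by apply: eq_Rintegral => x _; rewrite mul0r addr0.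
move=> /dv_shift; apply => t.
by apply: eq_Rintegral => x _; rewrite line_vertical.
Qed.

Lemma dv_line_mean1 (y : R) : 0 < y -> is_derive y (1 : R) line_mean1 (line_energy y).
Proof.
move=> y0; have [[_ _ i2] _ h] := line_means_near y0 (normc_i R).
have [[_ _ i2'] h0 h0'] := line_means_near y0 normc1.
have t0 : `|0 : R| < y / 4 by rewrite normr0 divr_gt0.
have e0 (g : R[i] -> R) (e : R[i]) : \int[mu]_x g (line y x + 0%:C%C * e) = \int[mu]_x g (line y x).
  by apply: eq_Rintegral => x _; rewrite mul0r addr0.
have cst_mean (t : R) : \int[mu]_x u (line y x + t%:C%C * 1) = line_mean y.
  rewrite /line_mean /Rintegral; apply: (congr1 (@fine R)).
  rewrite -(@integral_translate _ (fun x : R => u (line y x)) t).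
  - by apply: eq_integral => x _; rewrite line_horizontal.
  - by apply: (modsq_powR_continuous df) => //; rewrite divr_ge0// (le_trans _ p2).
  - by move=> x; exact: powR_ge0.
have mean1 (t : R) : `|t| < y / 4 -> \int[mu]_x u1 1 (line y x + t%:C%C * 1) = 0.
  move=> td; have [_ <-] := h0 t td.
  rewrite (_ : (fun s : R => _) = cst (line_mean y)); last exact/funext/cst_mean.
  by rewrite derive_cst.
have mean2 : \int[mu]_x u2 1 (line y x) = 0.
  rewrite -(e0 _ 1); have [_ <-] := h0' 0 t0.
  (* [mean1] is known for [|t| < y / 4] only, which is enough for a derivative at 0. *)
  rewrite (@near_eq_derive _ _ _ _ (cst 0)) ?derive_cst//.
  apply/nbhs_ballP; exists (y / 4); first exact: divr_gt0.
  by move=> t; rewrite /ball/= sub0r normrN => /mean1.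
have E : line_energy y = \int[mu]_x u2 'i%C (line y x).
  transitivity (\int[mu]_x u2 1 (line y x) + \int[mu]_x u2 'i%C (line y x)).
    rewrite -RintegralD//.
    by apply: eq_Rintegral => x _; rewrite -modpow2_laplacian.
  by rewrite mean2 add0r.
have := h 0 t0; rewrite e0 -E.
move=> /dv_shift; apply => t.
by apply: eq_Rintegral => x _; rewrite line_vertical.
Qed.

Lemma integrable_energy (y : R) : 0 < y -> mu.-integrable setT (EFin \o fun x : R => energy (line y x)).
Proof.
move=> y0; have [[_ _ i2] _ _] := line_means_near y0 (normc_i R).
have [[_ _ i2'] _ _] := line_means_near y0 normc1.
have := integrable_realD measurableT i2' i2.
by apply: eq_integrable => // x _; rewrite /= modpow2_laplacian.
Qed.

Lemma line_mean_ge0 y : 0 <= line_mean y.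
Proof. by apply: Rintegral_ge0 => x _; exact: powR_ge0. Qed.

Lemma line_energy_ge0 y : 0 <= line_energy y.
Proof. by apply: Rintegral_ge0 => x _; exact: energy_ge0. Qed.

Lemma line_mean_log_convex (y : R) : 0 < y ->
  line_mean1 y ^+ 2 <= line_mean y * line_energy y.
Proof.
move=> y0; have [[i0 i1 _] _ _] := line_means_near y0 (normc_i R).
have ie := integrable_energy y0.
have quad l : 0 <= l ^+ 2 * line_mean y + 2 * l * line_mean1 y + line_energy y.
  have j0 : mu.-integrable setT (EFin \o fun x : R => l ^+ 2 * u (line y x)).
    exact: integrable_realZ.
  have j1 : mu.-integrable setT (EFin \o fun x : R => 2 * l * u1 'i%C (line y x)).
    exact: integrable_realZ.
  rewrite /line_mean /line_mean1 /line_energy -!RintegralZl// -RintegralD//.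
  rewrite -RintegralD//; last exact: integrable_realD.
  by apply: Rintegral_ge0 => x _; exact: discriminant_pointwise.
have M0 := line_mean_ge0 y; have E0 := line_energy_ge0 y.
move: (line_mean y) (line_mean1 y) (line_energy y) => a b c in quad M0 E0 *.
move: M0; rewrite le_eqVlt => /predU1P[a0|a0].
  rewrite -a0 mul0r; have [->|b0] := eqVneq b 0; first by rewrite expr0n.
  (* When [a = 0] the trinomial is affine in [l]; at this [l] it equals [- c - 2 < 0]. *)
  have := quad (- ((c + 1) / b)); rewrite -a0 mulr0 add0r.
  have -> : 2 * - ((c + 1) / b) * b = - 2 * (c + 1) by field.
  by lra.
have := quad (- (b / a)) => h.
have : 0 <= a * ((- (b / a)) ^+ 2 * a + 2 * - (b / a) * b + c) by rewrite mulr_ge0// ltW.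
have -> : a * ((- (b / a)) ^+ 2 * a + 2 * - (b / a) * b + c) = a * c - b ^+ 2.
  by field; rewrite gt_eqF.
by rewrite subr_ge0.
Qed.

Lemma line_mean_eq0 (y : R) : 0 < y -> line_mean y = 0 -> forall x, f (x +i* y)%C = 0.
Proof.
move=> y0 My x.
have r0 : 0 <= p / 2 by rewrite divr_ge0// (le_trans _ p2).
have cu : continuous (fun x : R => u (line y x)) by exact: (modsq_powR_continuous df).
have u0 := @integral_eq0_continuous _ _ cu (fun x => powR_ge0 _ _).
have [[i0 _ _] _ _] := line_means_near y0 normc1.
have : (\int[mu]_x (u (line y x))%:E = 0)%E.
  by rewrite -(fineK (integrable_fin_num _ i0))//; congr EFin.
move=> /u0/(_ x)/eqP; rewrite modpowE powR_eq0 => /andP[/eqP/ComplexField.Normc.eq0_normc h _].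
rewrite -h; congr f; apply/eqP; rewrite eq_complex/=; apply/andP; split; apply/eqP; ring.
Qed.

(** Vanishing energy forces [f = 0] or [f' = 0] at each point of the line when [p > 2], and [f' = 0]
    when [p = 2]. In all cases the horizontal derivative of [|f|^p] is 0; and a constant that is
    integrable over the real line is 0. *)
Lemma line_energy_eq0 (y : R) : 0 < y -> line_energy y = 0 -> line_mean y = 0.
Proof.
move=> y0 Ey.
have rm : 0 <= p / 2 - 1 by rewrite subr_ge0 ler_pdivlMr// mul1r.
have p0 : p != 0 by rewrite gt_eqF// (lt_le_trans _ p2).
have ce : continuous (fun x : R => energy (line y x)).
  move=> x; apply: cvgM; first exact: cvg_cst.
  apply: cvgM; first exact: (modsq_powR_continuous df).
  apply: cvgM; exact: (pcont_normc (pcont_real_line df1 (w := (0 +i* y)%C) y0 x)).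
have e0 := @integral_eq0_continuous _ _ ce (fun x => energy_ge0 _).
have ie := integrable_energy y0.
have /e0 {}e0 : (\int[mu]_x (energy (line y x))%:E = 0)%E.
  by rewrite -(fineK (integrable_fin_num _ ie))//; congr EFin.
have u1_0 x : u1 1 (line y x) = 0.
  have /eqP := e0 x; rewrite /energy mulf_eq0 expf_eq0/= (negbTE p0)/= mulf_eq0 /modpow1.
  move=> /orP[/eqP->|]; first by rewrite mul0r mulr0.
  rewrite expf_eq0/= => /eqP/ComplexField.Normc.eq0_normc h.
  by rewrite /modsq1 h mulr0 /dot/= !mulr0 addr0 !mulr0.
have du (x : R) : is_derive x (1 : R) (fun x : R => u (line y x)) 0.
  have := @dv_modpow _ f f1 df p p2 (0 +i* y)%C 1 x normc1.
  rewrite mulr1 addrC Im_realD => /(_ y0); rewrite u1_0.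
  by congr is_derive; apply/funext => s; rewrite mulr1 addrC.
have uc (x : R) : u (line y x) = u (line y 0).
  by have := @is_derive_0_is_cst _ (fun x : R => u (line y x)) x 0 du.
have [[i0 _ _] _ _] := line_means_near y0 normc1.
have := integrable_lty measurableT i0.
have -> : (\int[mu]_x (EFin \o (fun x : R => u (line y x))) x)%E =
    (\int[mu]_x (u (line y 0))%:E)%E.
  by apply: eq_integral => x _ /=; rewrite uc.
have [u0 _|un] := eqVneq (u (line y 0)) 0.
  by rewrite /line_mean; under eq_Rintegral do rewrite uc u0; rewrite Rintegral_cst// mul0r.
rewrite integral_cst//= -set_itvNyy lebesgue_measure_itv/= gt0_muley ?ltxx//.
by rewrite lte_fin lt0r un powR_ge0.
Qed.

End LineMeans.

(** * Bounded log-convex functions *)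

Section Asymptotics.
Variable R : realType.
Implicit Types (g h : R -> R) (a b k l : R) (m n : nat).

Lemma mvt g g' a b : a < b ->
  (forall x, a <= x <= b -> is_derive x (1 : R) g (g' x)) ->
  exists2 c, a < c < b & g b - g a = g' c * (b - a).
Proof.
move=> ab dg.
have dg' x : x \in `]a, b[%R -> is_derive x (1 : R) g (g' x).
  by rewrite in_itv/= => /andP[? ?]; apply: dg; rewrite !ltW.
have cg : {within `[a, b], continuous g}.
  by apply: continuous_in_subspaceT => x; rewrite inE/= in_itv/= => /dg; exact: dv_cont.
by have [c] := MVT ab dg' cg; rewrite in_itv/=; exists c.
Qed.

Lemma ge0_derive_le g g' a b : a <= b ->
  (forall x, a <= x <= b -> is_derive x (1 : R) g (g' x)) ->
  (forall x, a < x < b -> 0 <= g' x) -> g a <= g b.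
Proof.
rewrite le_eqVlt => /predU1P[->//|ab] dg g0.
have [c cab E] := mvt ab dg; rewrite -subr_ge0 E mulr_ge0 ?g0//.
by rewrite subr_ge0 ltW.
Qed.

Lemma gt0_derive_lt g g' a b : a < b ->
  (forall x, a <= x <= b -> is_derive x (1 : R) g (g' x)) ->
  (forall x, a < x < b -> 0 < g' x) -> g a < g b.
Proof.
move=> ab dg g0; have [c cab E] := mvt ab dg.
by rewrite -subr_gt0 E mulr_gt0 ?g0// subr_gt0.
Qed.

(** This is the expansion [g (a + t) = k t^m + o(t^m)], where [k = 0] is allowed and nothing is said
    about [g a]. *)
Definition asymp a g k m := g (a + t) / t ^+ m @[t --> 0^'] --> k.

Lemma asympP a g k m : asymp a g k m <-> forall e, 0 < e -> exists2 d, 0 < d &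
  forall t, t != 0 -> `|t| < d -> `|g (a + t) - k * t ^+ m| <= e * `|t| ^+ m.
Proof.
have E t : t != 0 -> k - g (a + t) / t ^+ m = - (g (a + t) - k * t ^+ m) / t ^+ m.
  by move=> t0; rewrite opprB mulrBl mulfK ?expf_neq0.
split=> [H e e0|H].
  move/cvgrPdist_le : H => /(_ e e0)/nbhs_ballP[d /= d0 hd]; exists d => // t t0 td.
  have := hd t; rewrite /ball/= sub0r normrN => /(_ td t0).
  by rewrite E// normrM normrN normfV ler_pdivrMr normrX// exprn_gt0// normr_gt0.
apply/cvgrPdist_le => e /H[d d0 hd]; apply/nbhs_ballP; exists d => // t.
rewrite /ball/= sub0r normrN => td t0.
by rewrite E// normrM normrN normfV ler_pdivrMr normrX ?exprn_gt0 ?normr_gt0//; exact: hd.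
Qed.

Lemma asympM a g h k l m n : asymp a g k m -> asymp a h l n ->
  asymp a (fun x => g x * h x) (k * l) (m + n)%N.
Proof.
move=> gk hl; apply: cvg_trans (cvgM gk hl); apply: near_eq_cvg; near=> t.
by rewrite /= exprD invfM mulrACA.
Unshelve. all: by end_near. Qed.

Lemma asymp_div a g h k l m n : l != 0 -> asymp a g k (m + n)%N -> asymp a h l n ->
  asymp a (fun x => g x / h x) (k / l) m.
Proof.
move=> l0 gk hl; apply: cvg_trans (cvgM gk (cvgV l0 hl)); apply: near_eq_cvg; near=> t.
have t0 : t != 0 by near: t; exact: nbhs_dnbhs_neq.
rewrite /= exprD !invfM invrK; move: (h (a + t))^-1 => v.
by field; rewrite !expf_neq0.
Unshelve. all: by end_near. Qed.

Lemma asympD a g h k l m : asymp a g k m -> asymp a h l m ->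
  asymp a (fun x => g x + h x) (k + l) m.
Proof.
move=> gk hl; apply: cvg_trans (cvgD gk hl); apply: near_eq_cvg; near=> t.
by rewrite /= mulrDl.
Unshelve. all: by end_near. Qed.

Lemma asymp_cst a k : asymp a (fun=> k) k 0.
Proof.
apply/asympP => e e0; exists 1 => // t _ _.
by rewrite expr0 mulr1 subrr normr0 mulr1 ltW.
Qed.

Lemma asympZ a c g k m : asymp a g k m -> asymp a (fun x => c * g x) (c * k) m.
Proof. exact: asympM (@asymp_cst a c). Qed.

Lemma asymp_eq a g h k l m : asymp a g k m -> (forall x, g x = h x) -> k = l -> asymp a h l m.
Proof. by move=> gk /funext <- <-. Qed.

Lemma asymp_derive a g l : is_derive a (1 : R) g l -> asymp a (fun x => g x - g a) l 1.
Proof.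
move=> gl; apply/asympP => e e0; have [d d0 hd] := is_derive_eps gl e0.
by exists d => // t _ td; rewrite !expr1; exact: hd.
Qed.

Lemma derive_asymp a g l : asymp a (fun x => g x - g a) l 1 -> is_derive a (1 : R) g l.
Proof.
move=> /asympP H; apply: eps_is_derive => e /H[d d0 hd]; exists d => // t td.
have [->|t0] := eqVneq t 0; first by rewrite addr0 subrr mulr0 subr0 normr0 mulr0.
by have := hd t t0 td; rewrite !expr1.
Qed.

Lemma asymp_continuous a g l : is_derive a (1 : R) g l -> asymp a g (g a) 0.
Proof.
move=> gl; apply/asympP => e e0; have [d d0 hd] := is_derive_eps gl ltr01.
have l0 : 0 < `|l| + 1 by rewrite ltr_wpDl.
exists (Num.min d (e / (`|l| + 1))) => [|t _]; first by rewrite lt_min d0 divr_gt0.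
rewrite lt_min ltr_pdivlMr// => /andP[/hd h1 h2]; rewrite !expr0 !mulr1.
have := ler_normD (g (a + t) - g a - l * t) (l * t); rewrite subrK normrM; lra.
Qed.

Lemma asymp_cvg a g k : asymp a g k 0 -> g x @[x --> a^'] --> k.
Proof.
move=> /asympP H; apply/cvgrPdist_le => e /H[d d0 hd].
apply/nbhs_ballP; exists d => // x; rewrite /ball/= distrC => xd xa.
have := hd (x - a); rewrite subr_eq0 => /(_ xa xd).
by rewrite subrKC !expr0 !mulr1 distrC.
Qed.

Lemma asymp_gt0 a g k : 0 < k -> asymp a g k 2 ->
  exists2 d, 0 < d & forall t, t != 0 -> `|t| < d -> 0 < g (a + t).
Proof.
move=> k0 /asympP /(_ (k / 2)) []; first by rewrite divr_gt0.
move=> d d0 hd; exists d => // t t0 /(hd t t0).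
have t2 : 0 < t ^+ 2 by rewrite exprn_even_gt0.
by rewrite real_normK ?num_real// ler_norml => /andP[h _]; nra.
Qed.

(** Expansions are integrated through the mean value theorem, applied to [g] minus its expected main
    term. *)
Lemma asymp_primitive a g g' k m (d : R) : 0 < d -> g a = 0 ->
  (forall t, `|t| < d -> is_derive (a + t) (1 : R) g (g' (a + t))) ->
  asymp a g' k m -> g' a = k * 0 ^+ m -> asymp a g (k / m.+1%:R) m.+1.
Proof.
move=> d0 ga dg /asympP H g'a; apply/asympP => e e0; have [d' d'0 hd] := H e e0.
exists (Num.min d d') => [|t t0]; first by rewrite lt_min d0 d'0.
rewrite lt_min => /andP[td td'].
pose P x := g x - k / m.+1%:R * (x - a) ^+ m.+1.
have m0 : m.+1%:R != 0 :> R by rewrite pnatr_eq0.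
have dP s : `|s| < d -> is_derive (a + s) (1 : R) P (g' (a + s) - k * s ^+ m).
  move=> sd.
  have hX := dvX m (dvB (dv_id (a + s)) (dv_cst a (a + s))).
  have := dvB (dg s sd) (dvZ (k / m.+1%:R) hX).
  move=> h; apply: dv_eq h _; congr (_ - _).
  rewrite (_ : a + s - a = s); last by ring.
  by field.
have [c cs E] : exists2 c, `|c| <= `|t| & P (a + t) - P a = (g' (a + c) - k * c ^+ m) * t.
  pose P' x := g' x - k * (x - a) ^+ m.
  have dP' x : `|x - a| < d -> is_derive x (1 : R) P (P' x).
    by move=> /dP; rewrite subrKC.
  have [tp|tn] := ltP 0 t.
    have at1 : a < a + t by rewrite ltrDl.
    have [x /andP[h1 h2]|c /andP[c1 c2] E] := mvt (g' := P') (g := P) at1.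
      by apply: dP'; apply: le_lt_trans td; rewrite !ger0_norm; lra.
    exists (c - a); first by rewrite !ger0_norm; lra.
    by rewrite E /P' subrKC; ring.
  have at1 : a + t < a by rewrite gtrDl lt_neqAle t0.
  have [x /andP[h1 h2]|c /andP[c1 c2] E] := mvt (g' := P') (g := P) at1.
    by apply: dP'; apply: le_lt_trans td; rewrite !ler0_norm; lra.
  exists (c - a); first by rewrite !ler0_norm; lra.
  by rewrite -opprB E /P' subrKC; ring.
have Pa : P a = 0 by rewrite /P ga subrr expr0n mulr0 subrr.
have Pt : P (a + t) = g (a + t) - k / m.+1%:R * t ^+ m.+1.
  by rewrite /P (_ : a + t - a = t)//; ring.
rewrite -Pt -[P (a + t)]subr0 -[in X in _ - X]Pa E normrM exprSr mulrA.
apply: ler_wpM2r => //.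
have [c0|c0] := eqVneq c 0.
  by rewrite c0 addr0 g'a subrr normr0; apply: mulr_ge0; [exact: ltW|exact: exprn_ge0].
apply: le_trans (hd c c0 (le_lt_trans cs td')) _.
by apply: ler_wpM2l; [exact: ltW|exact: lerXn2r].
Qed.

End Asymptotics.

(** * Positivity and strict decrease of a bounded log-convex function *)

Section LogConvex.
Variable R : realType.
Variables (M M1 M2 : R -> R) (K : R).
Hypothesis dM : forall y : R, 0 < y -> is_derive y (1 : R) M (M1 y).
Hypothesis dM1 : forall y : R, 0 < y -> is_derive y (1 : R) M1 (M2 y).
Hypothesis M_ge0 : forall y, 0 < y -> 0 <= M y.
Hypothesis M2_ge0 : forall y, 0 < y -> 0 <= M2 y.
Hypothesis M_le : forall y, 0 < y -> M y <= K.
Hypothesis M_log : forall y, 0 < y -> M1 y ^+ 2 <= M y * M2 y.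

Lemma convex_derive_le a b : 0 < a -> a <= b -> M1 a <= M1 b.
Proof.
move=> a0 ab; apply: (ge0_derive_le (g' := M2)) => // x /andP[ax _].
  by apply: dM1; exact: lt_le_trans ax.
by apply: M2_ge0; exact: lt_trans ax.
Qed.

Lemma bounded_convex_derive_le0 a : 0 < a -> M1 a <= 0.
Proof.
move=> a0; rewrite leNgt; apply/negP => M1a.
have K0 : 0 <= K by exact: le_trans (M_ge0 a0) (M_le a0).
(* Between [a] and [b] the tangent at [a] rises by [K + 1], more than a convex function with values
   in [[0, K]] can afford. *)
pose b := a + (K + 1) / M1 a.
have ab : a < b by rewrite ltrDl divr_gt0// ltr_wpDl.
have [x /andP[ax _]|c /andP[ac cb] E] := mvt (g := M) (g' := M1) ab.
  by apply: dM; exact: lt_le_trans ax.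
have := convex_derive_le a0 (ltW ac) => M1c.
have b0 := lt_trans a0 ab.
have h1 := M_le b0; have h2 := M_ge0 a0.
have : M1 a * (b - a) <= M b - M a by rewrite E ler_wpM2r// subr_ge0 ltW.
have -> : M1 a * (b - a) = K + 1 by rewrite /b; field; rewrite gt_eqF.
lra.
Qed.

Lemma convex_nonincreasing a b : 0 < a -> a <= b -> M b <= M a.
Proof.
move=> a0 ab; rewrite -lerN2.
apply: (ge0_derive_le (g := fun x => - M x) (g' := fun x => - M1 x)) => // x /andP[ax _].
  have x0 := lt_le_trans a0 ax.
  by apply: is_deriveN; exact: dM.
by rewrite oppr_ge0; apply: bounded_convex_derive_le0; exact: lt_trans ax.
Qed.

(* [(M + e)'/(M + e)] is nondecreasing, so [M + e] decays at most exponentially;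
   then let [e] tend to [0]. *)
Lemma log_convex_gt0 a y : 0 < a -> 0 < M a -> 0 < y -> 0 < M y.
Proof.
move=> a0 Ma y0; have [ya|ay] := leP y a.
  exact: lt_le_trans Ma (convex_nonincreasing y0 ya).
rewrite lt_neqAle M_ge0// andbT; apply/eqP => My.
pose k := - M1 a / M a.
have k0 : 0 <= k by rewrite divr_ge0 ?oppr_ge0 ?bounded_convex_derive_le0// ltW.
pose X := expR (k * (y - a)); have X0 : 0 < X by exact: expR_gt0.
(* With this [e], [M y = 0] would give [M a + e <= e X = M a / 2]. *)
pose e := M a / (2 * X); have e0 : 0 < e by rewrite divr_gt0// mulr_gt0.
have Me x : 0 < x -> 0 < M x + e by move=> /M_ge0; lra.
have dMe (x : R) : 0 < x -> is_derive x (1 : R) (fun x => M x + e) (M1 x).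
  by move=> /dM h; apply: dv_eq (dvD h (dv_cst e x)) _; rewrite addr0.
have ratio x : a <= x -> - k * (M x + e) <= M1 x.
  move=> ax; have x0 := lt_le_trans a0 ax.
  have h : M1 a / (M a + e) <= M1 x / (M x + e).
    apply: (ge0_derive_le (g := fun x => M1 x / (M x + e))
      (g' := fun x => (M2 x * (M x + e) - M1 x * M1 x) / (M x + e) ^+ 2)) => // s /andP[a_s _].
      have s0 := lt_le_trans a0 a_s.
      exact: (@dvdiv _ M1 (fun x => M x + e) _ _ _ (lt0r_neq0 (Me _ s0)) (dM1 s0) (dMe _ s0)).
    have s0 := lt_trans a0 a_s; rewrite divr_ge0 ?sqr_ge0//.
    have := M_log s0; have := M2_ge0 s0; have := e0; nra.
  have h' : - k <= M1 a / (M a + e).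
    rewrite /k mulNr opprK ler_pdivrMr// mulrAC ler_pdivlMr ?Me//.
    by have := bounded_convex_derive_le0 a0; have := e0; nra.
  by rewrite -ler_pdivlMr ?Me//; exact: le_trans h.
have dX (x : R) : is_derive x (1 : R) (fun x => expR (k * (x - a))) (expR (k * (x - a)) * k).
  apply: dv_eq (dv_comp (is_derive_expR _) (dvZ k (dvB (dv_id x) (dv_cst a x)))) _.
  by rewrite subr0 mulr1.
have : (M a + e) * expR (k * (a - a)) <= (M y + e) * expR (k * (y - a)).
  apply: (ge0_derive_le (g := fun x => (M x + e) * expR (k * (x - a)))
    (g' := fun x => M1 x * expR (k * (x - a)) + (M x + e) * (expR (k * (x - a)) * k))).
  - exact: ltW.
  - by move=> x /andP[ax _]; exact: dvM (dMe _ (lt_le_trans a0 ax)) (dX x).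
  - move=> x /andP[ax _]; have := ratio x (ltW ax).
    have E0 : 0 < expR (k * (x - a)) by exact: expR_gt0.
    by move: (expR _) E0 (M x) (M1 x) => E E0 m m1; nra.
rewrite subrr mulr0 expR0 mulr1 -My add0r -/X.
have -> : e * X = M a / 2 by rewrite /e; field; rewrite gt_eqF.
by lra.
Qed.

Hypothesis M2_eq0 : forall y, 0 < y -> M2 y = 0 -> M y = 0.

(** If the nondecreasing, nonpositive [M1] vanishes at [y], it vanishes from [y] on. Then [M2], and
    with it [M], is 0 at [y + 1], against positivity. *)
Lemma log_convex_derive_lt0 a y : 0 < a -> 0 < M a -> 0 < y -> M1 y < 0.
Proof.
move=> a0 Ma y0; rewrite lt_neqAle bounded_convex_derive_le0// andbT; apply/eqP => M1y.
have M10 x : y <= x -> M1 x = 0.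
  move=> yx; have x0 := lt_le_trans y0 yx.
  apply/eqP; rewrite eq_le bounded_convex_derive_le0//= -M1y; exact: convex_derive_le.
(* The point [y + 1] is interior to the half-line where [M1 = 0], as a two-sided derivative
   requires. *)
have y10 : 0 < y + 1 by exact: addr_gt0.
have := log_convex_gt0 a0 Ma y10; rewrite M2_eq0 ?ltxx//.
rewrite -(dv_derive1 (dM1 y10)).
apply: (dv_derive1 (dv_near (dv_cst 0 (y + 1)) _)).
apply/nbhs_ballP; exists 1 => [|x]; first exact: ltr01.
rewrite /ball/= ltr_norml => /andP[_ h].
by rewrite M10//; lra.
Qed.

End LogConvex.

(** * The weighted mean h / phi *)

Section WeightedMean.
Variable R : realType.
Variables (phi phi1 phi2 phi3 h M M1 M2 : R -> R).
Hypothesis dphi : forall y : R, 0 < y -> is_derive y (1 : R) phi (phi1 y).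
Hypothesis dphi1 : forall y : R, 0 < y -> is_derive y (1 : R) phi1 (phi2 y).
Hypothesis dphi2 : forall y : R, 0 < y -> is_derive y (1 : R) phi2 (phi3 y).
Hypothesis dh : forall y : R, 0 < y -> is_derive y (1 : R) h (phi1 y * M y).
Hypothesis dM : forall y : R, 0 < y -> is_derive y (1 : R) M (M1 y).
Hypothesis dM1 : forall y : R, 0 < y -> is_derive y (1 : R) M1 (M2 y).
Hypothesis phi_at1 : phi 1 = 0.
Hypothesis h_at1 : h 1 = 0.
Hypothesis phi1_gt0 : forall y, 0 < y -> 0 < phi1 y.
Hypothesis M_gt0 : forall y, 0 < y -> 0 < M y.
Hypothesis M1_lt0 : forall y, 0 < y -> M1 y < 0.
Hypothesis M_log : forall y, 0 < y -> M1 y ^+ 2 <= M y * M2 y.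
Hypothesis phi_cond : forall y, 0 < y ->
  phi1 y ^+ 2 * phi2 y + phi y * phi1 y * phi3 y - 2 * phi y * phi2 y ^+ 2 <= 0.

Let T y := M y * phi y - h y.

Let dT (y : R) : 0 < y -> is_derive y (1 : R) T (M1 y * phi y).
Proof.
by move=> y0; apply: dv_eq (dvB (dvM (dM y0) (dphi y0)) (dh y0)) _; ring.
Qed.

Lemma weight_gt0 y : 1 < y -> 0 < phi y.
Proof.
move=> y1; rewrite -phi_at1; apply: (gt0_derive_lt (g' := phi1)) => // x /andP[x1 _].
  by apply: dphi; exact: lt_le_trans x1.
by apply: phi1_gt0; exact: lt_trans x1.
Qed.

Lemma weight_lt0 y : 0 < y -> y < 1 -> phi y < 0.
Proof.
move=> y0 y1; rewrite -phi_at1; apply: (gt0_derive_lt (g' := phi1)) => // x /andP[yx _].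
  by apply: dphi; exact: lt_le_trans yx.
by apply: phi1_gt0; exact: lt_trans yx.
Qed.

Lemma weighted_gt0 y : 1 < y -> 0 < h y.
Proof.
move=> y1; rewrite -h_at1; apply: (gt0_derive_lt (g' := fun y => phi1 y * M y)) => // x /andP[x1 _].
  by apply: dh; exact: lt_le_trans x1.
have x0 : 0 < x by exact: lt_trans x1.
by rewrite mulr_gt0 ?phi1_gt0 ?M_gt0.
Qed.

Lemma weighted_lt0 y : 0 < y -> y < 1 -> h y < 0.
Proof.
move=> y0 y1; rewrite -h_at1; apply: (gt0_derive_lt (g' := fun y => phi1 y * M y)) => // x /andP[yx _].
  by apply: dh; exact: lt_le_trans yx.
have x0 : 0 < x by exact: lt_trans yx.
by rewrite mulr_gt0 ?phi1_gt0 ?M_gt0.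
Qed.

Lemma weight_neq0 y : 0 < y -> y != 1 -> phi y != 0.
Proof.
move=> y0; rewrite neq_lt => /orP[y1|y1]; first by rewrite lt_eqF ?weight_lt0.
by rewrite gt_eqF ?weight_gt0.
Qed.

Lemma weighted_neq0 y : 0 < y -> y != 1 -> h y != 0.
Proof.
move=> y0; rewrite neq_lt => /orP[y1|y1]; first by rewrite lt_eqF ?weighted_lt0.
by rewrite gt_eqF ?weighted_gt0.
Qed.

(** [T] has a strict maximum at 1, of value 0: its derivative [M' phi] is positive before 1 and
    negative after. *)
Let T_lt0 y : 0 < y -> y != 1 -> T y < 0.
Proof.
have T1 : T 1 = 0 by rewrite /T phi_at1 h_at1 mulr0 subr0.
move=> y0; rewrite neq_lt => /orP[y1|y1].
  rewrite -T1; apply: (gt0_derive_lt (g' := fun y => M1 y * phi y)) => // x /andP[yx x1].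
    by apply: dT; exact: lt_le_trans yx.
  have x0 := lt_trans y0 yx.
  by rewrite nmulr_rgt0 ?M1_lt0// weight_lt0.
rewrite -oppr_gt0 -[0]oppr0 -[in ltLHS]T1.
apply: (gt0_derive_lt (g := fun y => - T y) (g' := fun y => - (M1 y * phi y))) => // x /andP[x1 xy].
  have x0 : 0 < x by exact: lt_le_trans x1.
  by apply: is_deriveN; exact: dT.
have x0 : 0 < x by exact: lt_trans x1.
by rewrite oppr_gt0 nmulr_rlt0 ?M1_lt0// weight_gt0.
Qed.

Let p01 : phi1 1 != 0. Proof. by rewrite gt_eqF ?phi1_gt0. Qed.

Let near1 (t : R) : `|t| < 1 -> 0 < 1 + t.
Proof. by rewrite ltr_norml => /andP[? _]; lra. Qed.

Let asymp_phi : asymp 1 phi (phi1 1) 1.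
Proof. by apply: asymp_eq (asymp_derive (dphi ltr01)) _ _ => // x; rewrite phi_at1 subr0. Qed.

Let asymp_h : asymp 1 h (phi1 1 * M 1) 1.
Proof. by apply: asymp_eq (asymp_derive (dh ltr01)) _ _ => // x; rewrite h_at1 subr0. Qed.

Let asymp_T : asymp 1 T (M1 1 * phi1 1 / 2) 2.
Proof.
apply: (@asymp_primitive _ 1 T (fun y => M1 y * phi y) _ 1 1) => //.
- by rewrite /T phi_at1 h_at1 mulr0 subr0.
- by move=> t /near1; exact: dT.
- exact: asympM (asymp_continuous (dM1 ltr01)) asymp_phi.
- by rewrite phi_at1 expr1 !mulr0.
Qed.

Let asymp_phi_sqr : asymp 1 (fun y => phi y ^+ 2) (phi1 1 ^+ 2) 2.
Proof. by apply: asymp_eq (asympM asymp_phi asymp_phi) _ _ => // x; rewrite expr2. Qed.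

Lemma weighted_mean_cvg : h y / phi y @[y --> (1 : R)^'] --> M 1.
Proof.
have H := @asymp_div _ 1 h phi _ _ 0 1 p01 asymp_h asymp_phi.
by have := asymp_cvg H; rewrite mulrC mulKf.
Qed.

(** [q' = phi' W]. The value at 1 is the quotient of the leading coefficients of [T] and [phi^2],
    both of order 2. *)
Let W y := if y == 1 then M1 1 / (2 * phi1 1) else T y / phi y ^+ 2.
(** This is the derivative of [W] at 1, read off the third order expansion of [T - w phi^2] with
    [w = W 1]. *)
Let kappa := (M2 1 - 2 * (M1 1 / (2 * phi1 1)) * phi2 1) / (3 * phi1 1).
Let W1 y := if y == 1 then kappa else
  (M1 y * phi y * phi y ^+ 2 - T y * (2 * phi y * phi1 y)) / (phi y ^+ 2) ^+ 2.

Local Notation q := (extend_at 1 (M 1) (fun y => h y / phi y)).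
Let q1 y := phi1 y * W y.
Let q2 y := phi2 y * W y + phi1 y * W1 y.

Let near_neq1 (y : R) (P : R -> Prop) : y != 1 -> (forall s, s != 1 -> P s) ->
  \forall s \near y, P s.
Proof.
move=> y1 HP; apply/nbhs_ballP; exists `|y - 1|.
  by rewrite /= normr_gt0 subr_eq0.
move=> s; rewrite /ball/= => ys; apply: HP; apply/eqP => s1.
by rewrite s1 ltxx in ys.
Qed.

Let dq (y : R) : 0 < y -> is_derive y (1 : R) q (q1 y).
Proof.
move=> y0; have [->|y1] := eqVneq y 1; last first.
  have P := weight_neq0 y0 y1.
  apply: (dv_near (dv_eq (dvdiv P (dh y0) (dphi y0)) _)).
    by rewrite /q1 /W (negbTE y1) /T; field.
  by apply: near_neq1 => // s s1; rewrite /extend_at (negbTE s1).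
apply: derive_asymp.
(* The increment of [q] from 1 is [N / phi], and [N' = phi' (M - M 1)] has a first order zero at
   1. *)
pose N y := h y - M 1 * phi y.
have aN : asymp 1 N (phi1 1 * M1 1 / 2) 2.
  apply: (@asymp_primitive _ 1 N (fun y => phi1 y * (M y - M 1)) _ 1 1) => //.
  - by rewrite /N phi_at1 h_at1 mulr0 subr0.
  - move=> t /near1 t0; apply: dv_eq (dvB (dh t0) (dvZ (M 1) (dphi t0))) _; ring.
  - exact: asympM (asymp_continuous (dphi1 ltr01)) (asymp_derive (dM ltr01)).
  - by rewrite subrr expr1 !mulr0.
have H := @asymp_div _ 1 N phi _ _ 1 1 p01 aN asymp_phi.
have -> : q1 1 = phi1 1 * M1 1 / 2 / phi1 1 by rewrite /q1 /W eqxx; field.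
apply/asympP => e e0; have /asympP/(_ e e0)[d d0 hd] := H.
exists (Num.min d 1) => [|t t0]; first by rewrite lt_min d0 ltr01.
rewrite lt_min => /andP[/(hd t t0) + /near1 t1].
have t11 : 1 + t != 1 by rewrite -subr_eq0 addrAC subrr add0r.
have P := weight_neq0 t1 t11.
rewrite /extend_at (negbTE t11) eqxx /N mulrBl mulfK//.
Qed.

Let dW (y : R) : 0 < y -> is_derive y (1 : R) W (W1 y).
Proof.
move=> y0; have [->|y1] := eqVneq y 1; last first.
  have P := weight_neq0 y0 y1.
  have P2 : phi y ^+ 2 != 0 by rewrite expf_neq0.
  apply: (dv_near (dv_eq (@dvdiv _ T (fun y => phi y ^+ 2) _ _ _ P2 (dT y0) (dv_sqr (dphi y0))) _)).
    by rewrite /W1 (negbTE y1).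
  by apply: near_neq1 => // s s1; rewrite /W (negbTE s1).
apply: derive_asymp.
pose w := M1 1 / (2 * phi1 1).
(* [N' = phi (M' - 2 w phi')], and both factors vanish at 1 by the choice of [w]. Thus first order
   expansions of [phi], [phi'] and [M'] yield the third order expansion of [N]. *)
pose N y := T y - w * phi y ^+ 2.
have aD : asymp 1 (fun y => M1 y - 2 * w * phi1 y) (M2 1 - 2 * w * phi2 1) 1.
  have := asympD (asymp_derive (dM1 ltr01)) (asympZ (c := - (2 * w)) (asymp_derive (dphi1 ltr01))).
  by move=> H; apply: asymp_eq H _ _ => [x|]; rewrite /w; [field|ring].
have aN : asymp 1 N (phi1 1 * (M2 1 - 2 * w * phi2 1) / 3) 3.
  apply: (@asymp_primitive _ 1 N (fun y => phi y * (M1 y - 2 * w * phi1 y)) _ 2 1) => //.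
  - by rewrite /N /T phi_at1 h_at1 expr0n !mulr0 !subr0.
  - by move=> t /near1 t0; apply: dv_eq (dvB (dT t0) (dvZ w (dv_sqr (dphi t0)))) _; ring.
  - exact: asympM asymp_phi aD.
  - by rewrite phi_at1 expr0n mul0r mulr0.
have P12 : phi1 1 ^+ 2 != 0 by rewrite expf_neq0.
have H := @asymp_div _ 1 N (fun y => phi y ^+ 2) _ _ 1 2 P12 aN asymp_phi_sqr.
have -> : W1 1 = phi1 1 * (M2 1 - 2 * w * phi2 1) / 3 / phi1 1 ^+ 2.
  by rewrite /W1 eqxx /kappa -/w; field.
apply/asympP => e e0; have /asympP/(_ e e0)[d d0 hd] := H.
exists (Num.min d 1) => [|t t0]; first by rewrite lt_min d0 ltr01.
rewrite lt_min => /andP[/(hd t t0) + /near1 t1].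
have t11 : 1 + t != 1 by rewrite -subr_eq0 addrAC subrr add0r.
have P := weight_neq0 t1 t11.
by rewrite /W (negbTE t11) eqxx -/w /N mulrBl mulfK// expf_neq0.
Qed.

Let dq1 (y : R) : 0 < y -> is_derive y (1 : R) q1 (q2 y).
Proof. by move=> y0; exact: dvM (dphi1 y0) (dW y0). Qed.

Let q1_lt0 y : 0 < y -> q1 y < 0.
Proof.
move=> y0; rewrite /q1 pmulr_rlt0 ?phi1_gt0// /W; case: eqVneq => y1.
  by rewrite pmulr_llt0 ?M1_lt0// invr_gt0 mulr_gt0 ?phi1_gt0.
by rewrite pmulr_llt0 ?T_lt0// invr_gt0 exprn_even_gt0// weight_neq0.
Qed.

Let q_gt0 y : 0 < y -> 0 < q y.
Proof.
move=> y0; rewrite /extend_at; case: eqVneq => [_|]; first exact: M_gt0.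
rewrite neq_lt => /orP[y1|y1].
  by rewrite nmulr_rgt0 ?weighted_lt0// invr_lt0 weight_lt0.
by rewrite divr_gt0 ?weighted_gt0 ?weight_gt0.
Qed.

(* Off [1], [q q'' - q'^2] equals [phi'^2 h D / phi^4]. The derivative of [D] is
   the left-hand side of [phi_cond] times the nonpositive [T / phi'^3], plus a
   quadratic form [Q] in [T / h] and [phi], which is nonnegative by
   log-convexity of [M]. *)
Let A y := phi y * phi2 y / phi1 y ^+ 2.
Let D y := A y * T y + h y - M y ^+ 2 * phi y ^+ 2 / h y + M1 y * phi y ^+ 2 / phi1 y.
Let Q y := phi1 y * M y * (T y / h y) ^+ 2 - 2 * M1 y * phi y * (T y / h y)
  + M2 y * phi y ^+ 2 / phi1 y.
Let D1 y := (phi1 y ^+ 2 * phi2 y + phi y * phi1 y * phi3 y - 2 * phi y * phi2 y ^+ 2)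
  / phi1 y ^+ 3 * T y + Q y.

Let dD (y : R) : 0 < y -> y != 1 -> is_derive y (1 : R) D (D1 y).
Proof.
move=> y0 y1; have H := weighted_neq0 y0 y1.
have P : phi1 y != 0 by rewrite gt_eqF ?phi1_gt0.
have P2 : phi1 y ^+ 2 != 0 by rewrite expf_neq0.
have dA := @dvdiv _ (fun y => phi y * phi2 y) (fun y => phi1 y ^+ 2) _ _ _ P2
  (dvM (dphi y0) (dphi2 y0)) (dv_sqr (dphi1 y0)).
have d3 := @dvdiv _ (fun y => M y ^+ 2 * phi y ^+ 2) h _ _ _ H
  (dvM (dv_sqr (dM y0)) (dv_sqr (dphi y0))) (dh y0).
have d4 := @dvdiv _ (fun y => M1 y * phi y ^+ 2) phi1 _ _ _ P
  (dvM (dM1 y0) (dv_sqr (dphi y0))) (dphi1 y0).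
apply: dv_eq (dvD (dvB (dvD (dvM dA (dT y0)) (dh y0)) d3) d4) _.
by rewrite /D1 /Q /A /T; field; rewrite H P.
Qed.

Let Q_ge0 y : 0 < y -> 0 <= Q y.
Proof.
move=> y0; have P := phi1_gt0 y0; have M0 := M_gt0 y0.
have -> : Q y = (M y * phi1 y)^-1 *
    ((M y * phi1 y * (T y / h y) - M1 y * phi y) ^+ 2 + (M y * M2 y - M1 y ^+ 2) * phi y ^+ 2).
  by rewrite /Q; move: (T y / h y) => X; field; rewrite !gt_eqF.
rewrite mulr_ge0 ?invr_ge0 ?mulr_ge0 ?(ltW M0) ?(ltW P)//.
by rewrite addr_ge0 ?sqr_ge0// mulr_ge0 ?sqr_ge0// subr_ge0 M_log.
Qed.

Let D1_geQ y : 0 < y -> y != 1 -> Q y <= D1 y.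
Proof.
move=> y0 y1; rewrite /D1 lerDr mulr_le0 ?(ltW (T_lt0 y0 y1))//.
by rewrite mulr_le0_ge0 ?phi_cond// invr_ge0 exprn_ge0// ltW ?phi1_gt0.
Qed.

(** [S] comes from completing the square in [Q], and [Q0] is [Q] with [M''] replaced by its lower
    bound [M'^2 / M]. Unlike [M''], all ingredients of [Q0] have known expansions at 1. *)
Let S y := M y * phi1 y * (T y / h y) - M1 y * phi y.
Let Q0 y := S y * S y / (M y * phi1 y).

Let Q0_leQ y : 0 < y -> Q0 y <= Q y.
Proof.
move=> y0; have P := phi1_gt0 y0; have M0 := M_gt0 y0.
have -> : Q y = Q0 y + (M y * M2 y - M1 y ^+ 2) * phi y ^+ 2 / (M y * phi1 y).
  by rewrite /Q /Q0 /S; move: (T y / h y) => X; field; rewrite !gt_eqF.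
rewrite lerDl divr_ge0 ?(ltW (mulr_gt0 M0 P))// mulr_ge0 ?sqr_ge0//.
by rewrite subr_ge0 M_log.
Qed.

(** The leading term of [Q0] at 1 is [M'(1)^2 phi'(1) / (4 M(1)) t^2], with a positive coefficient
    because [M'(1) < 0]. This is the source of strictness for [D]. *)
Let Q0_near : exists2 d, 0 < d & forall t, t != 0 -> `|t| < d -> 0 < Q0 (1 + t).
Proof.
have m0 : M 1 != 0 by rewrite gt_eqF ?M_gt0.
have hn : phi1 1 * M 1 != 0 by rewrite mulf_neq0.
have aX : asymp 1 (fun y => T y / h y) (M1 1 * phi1 1 / 2 / (phi1 1 * M 1)) 1.
  exact: @asymp_div _ 1 T h _ _ 1 1 hn asymp_T asymp_h.
have aM := asymp_continuous (dM ltr01); have aP := asymp_continuous (dphi1 ltr01).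
have aS : asymp 1 S (- (M1 1 * phi1 1 / 2)) 1.
  have H := asympD (asympM (asympM aM aP) aX)
    (asympZ (c := - 1) (asympM (asymp_continuous (dM1 ltr01)) asymp_phi)).
  apply: asymp_eq H _ _ => [x|]; first by rewrite /S; ring.
  by field; rewrite m0 p01.
have mp : M 1 * phi1 1 != 0 by rewrite mulf_neq0.
have aQ := @asymp_div _ 1 (fun y => S y * S y) (fun y => M y * phi1 y) _ _ 2 0 mp
  (asympM aS aS) (asympM aM aP).
apply: asymp_gt0 aQ.
rewrite divr_gt0 ?(mulr_gt0 (M_gt0 ltr01))// ?phi1_gt0//.
rewrite mulrNN -expr2 exprn_even_gt0//= mulf_neq0 ?invr_eq0 ?pnatr_eq0//.
by rewrite mulf_neq0// lt_eqF// M1_lt0.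
Qed.

Let D_cvg : asymp 1 D 0 0.
Proof.
have P2 : phi1 1 ^+ 2 != 0 by rewrite expf_neq0.
have m0 : M 1 != 0 by rewrite gt_eqF ?M_gt0.
have hn : phi1 1 * M 1 != 0 by rewrite mulf_neq0.
have aM := asymp_continuous (dM ltr01); have aM1 := asymp_continuous (dM1 ltr01).
have aP := asymp_continuous (dphi ltr01); have aP1 := asymp_continuous (dphi1 ltr01).
have aP2 := asymp_continuous (dphi2 ltr01); have ah := asymp_continuous (dh ltr01).
have aT := asymp_continuous (dT ltr01).
have e1 := @asymp_div _ 1 (fun y => phi y * phi2 y) (fun y => phi1 y * phi1 y) _ _ 0 0
  (mulf_neq0 p01 p01) (asympM aP aP2) (asympM aP1 aP1).
(* [phi^2 / h] is a quotient of two functions vanishing at 1: one factor [phi] is set against [h],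
   giving a finite limit, and the other makes the product tend to 0. *)
have e3 := @asymp_div _ 1 (fun y => M y * M y * phi y) h _ _ 0 1 hn
  (asympM (asympM aM aM) asymp_phi) asymp_h.
have e4 := @asymp_div _ 1 (fun y => M1 y * (phi y * phi y)) phi1 _ _ 0 0 p01
  (asympM aM1 (asympM aP aP)) aP1.
have H := asympD (asympD (asympD (asympM e1 aT) ah) (asympZ (c := - 1) (asympM e3 aP))) e4.
apply: asymp_eq H _ _ => [x|]; first by rewrite /D /A; ring.
by rewrite phi_at1 h_at1; ring.
Qed.

Let D_le a b : 0 < a -> a <= b -> 1 < a \/ b < 1 -> D a <= D b.
Proof.
move=> a0 ab h1; have ne x : a <= x <= b -> 0 < x /\ x != 1.
  by move=> /andP[ax xb]; split; [|case: h1 => ?]; lra.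
apply: (ge0_derive_le (g' := D1)) => // x.
  by move=> /ne[x0 x1]; exact: dD.
move=> /andP[ax xb]; have [|x0 x1] := ne x; first by rewrite !ltW.
by apply: le_trans (D1_geQ x0 x1); exact: Q_ge0.
Qed.

Let D_lt : exists2 d, 0 < d & forall a b, 0 < a -> a < b -> 1 < a \/ b < 1 ->
  `|a - 1| < d -> `|b - 1| < d -> D a < D b.
Proof.
have [d d0 hd] := Q0_near; exists d => // a b a0 ab h1 ad bd.
have ne x : a <= x <= b -> 0 < x /\ x != 1.
  by move=> /andP[ax xb]; split; [|case: h1 => ?]; lra.
apply: (gt0_derive_lt (g' := D1)) => // x.
  by move=> /ne[x0 x1]; exact: dD.
move=> /andP[ax xb]; have [|x0 x1] := ne x; first by rewrite !ltW.
apply: lt_le_trans (D1_geQ x0 x1); apply: lt_le_trans (Q0_leQ x0).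
rewrite -(subrKC 1 x); apply: hd; first by rewrite subr_eq0.
by move: ad bd; rewrite !ltr_norml => /andP[? ?] /andP[? ?]; apply/andP; split; lra.
Qed.

(** For points [1 < b < c <= y] with [c] close to 1: [D b >= 0] since [D] is nondecreasing with
    limit 0 at 1, then [D b < D c] by strictness near 1, and [D c <= D y]. *)
Let D_gt0 y : 1 < y -> 0 < D y.
Proof.
move=> y1; have [d d0 hd] := D_lt.
pose c := 1 + Num.min ((y - 1) / 2) (d / 2).
have c1 : 1 < c by rewrite ltrDl lt_min !divr_gt0// subr_gt0.
have cy : c <= y.
  have : Num.min ((y - 1) / 2) (d / 2) <= (y - 1) / 2 by rewrite ge_min lexx.
  by rewrite /c; lra.
have cd : c - 1 < d.
  have : Num.min ((y - 1) / 2) (d / 2) <= d / 2 by rewrite ge_min lexx orbT.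
  by rewrite /c; lra.
move: c c1 cy cd => c c1 cy cd.
pose b := (1 + c) / 2; have b1 : 1 < b by rewrite /b; lra.
have bc : b < c by rewrite /b; lra.
apply: lt_le_trans (D_le _ cy (or_introl c1)); last by lra.
apply: (@le_lt_trans _ _ (D b)); last first.
  by apply: hd; [lra|lra|left|rewrite gtr0_norm; lra|rewrite gtr0_norm; lra].
rewrite leNgt; apply/negP => Db.
have Db2 : 0 < - D b / 2 by rewrite divr_gt0// oppr_gt0.
have [r r0 hr] := (asympP _ _ _ _).1 D_cvg _ Db2.
pose s := Num.min (b - 1) (r / 2).
have s0 : 0 < s by rewrite lt_min subr_gt0 b1 divr_gt0.
have sr : s < r by rewrite gt_min ltr_pdivrMr// ltr_pMr// ltr1n orbT.
have := hr s; rewrite gt_eqF// gtr0_norm// => /(_ isT sr).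
rewrite !expr0 !mulr1 subr0 ler_norml => /andP[h1 _].
have : D (1 + s) <= D b.
  by apply: D_le; [lra| |left; lra]; rewrite -lerBrDl ge_min lexx.
by lra.
Qed.

Let D_lt0 y : 0 < y -> y < 1 -> D y < 0.
Proof.
move=> y0 y1; have [d d0 hd] := D_lt.
pose c := 1 - Num.min ((1 - y) / 2) (d / 2).
have c1 : c < 1 by rewrite ltrBlDr ltrDl lt_min !divr_gt0// subr_gt0.
have cy : y <= c.
  have : Num.min ((1 - y) / 2) (d / 2) <= (1 - y) / 2 by rewrite ge_min lexx.
  by rewrite /c; lra.
have cd : 1 - c < d.
  have : Num.min ((1 - y) / 2) (d / 2) <= d / 2 by rewrite ge_min lexx orbT.
  by rewrite /c; lra.
move: c c1 cy cd => c c1 cy cd.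
pose b := (1 + c) / 2; have b1 : b < 1 by rewrite /b; lra.
have bc : c < b by rewrite /b; lra.
apply: le_lt_trans (D_le y0 cy (or_intror c1)) _.
apply: (@lt_le_trans _ _ (D b)).
  by apply: hd; [lra|lra|right|rewrite ltr0_norm; lra|rewrite ltr0_norm; lra].
rewrite leNgt; apply/negP => Db.
have Db2 : 0 < D b / 2 by rewrite divr_gt0.
have [r r0 hr] := (asympP _ _ _ _).1 D_cvg _ Db2.
pose s := Num.min (1 - b) (r / 2).
have s0 : 0 < s by rewrite lt_min subr_gt0 b1 divr_gt0.
have sr : s < r by rewrite gt_min ltr_pdivrMr// ltr_pMr// ltr1n orbT.
have := hr (- s); rewrite oppr_eq0 normrN gt_eqF// gtr0_norm// => /(_ isT sr).
rewrite !expr0 !mulr1 subr0 ler_norml => /andP[_ h1].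
have sb : s <= 1 - b by rewrite ge_min lexx.
have : D b <= D (1 + - s) by apply: D_le; [lra|lra|right; lra].
by lra.
Qed.

Let q_log_convex y : 0 < y -> q1 y ^+ 2 < q y * q2 y.
Proof.
move=> y0; have [->|y1] := eqVneq y 1.
  have P := phi1_gt0 ltr01; have m0 := M_gt0 ltr01; have m1 := M1_lt0 ltr01.
  have ml := M_log ltr01; have := phi_cond ltr01.
  (* At 1, where [phi] vanishes, condition (ii) reduces to [phi''(1) <= 0]. *)
  rewrite phi_at1 !(mul0r, mulr0) subr0 addr0 pmulr_rle0 ?exprn_gt0// => p2.
  rewrite /q1 /q2 /extend_at /W /W1 /kappa eqxx -subr_gt0.
  (* The first term is nonnegative by log-convexity of [M], the last because [M'(1)] and [phi''(1)]
     are both nonpositive; the middle one is positive and ensures strictness. *)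
  have -> : M 1 * (phi2 1 * (M1 1 / (2 * phi1 1)) + phi1 1 *
    ((M2 1 - 2 * (M1 1 / (2 * phi1 1)) * phi2 1) / (3 * phi1 1))) -
    (phi1 1 * (M1 1 / (2 * phi1 1))) ^+ 2 =
    (M 1 * M2 1 - M1 1 ^+ 2) / 3 + M1 1 ^+ 2 / 12 + M 1 * (M1 1 * phi2 1) / (6 * phi1 1).
    by field.
  have s1 : 0 < M1 1 ^+ 2 by rewrite exprn_even_gt0//= lt_eqF.
  have s2 : 0 <= M 1 * (M1 1 * phi2 1) / (6 * phi1 1).
    have s3 : 0 <= M1 1 * phi2 1 by rewrite mulr_le0// ltW.
    by apply: divr_ge0; apply: mulr_ge0 => //; exact: ltW.
  by lra.
have P := weight_neq0 y0 y1; have H := weighted_neq0 y0 y1.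
have P1 := phi1_gt0 y0.
rewrite -subr_gt0 /q1 /q2 /extend_at /W /W1 (negbTE y1).
have -> : h y / phi y * (phi2 y * (T y / phi y ^+ 2) + phi1 y *
   ((M1 y * phi y * phi y ^+ 2 - T y * (2 * phi y * phi1 y)) / (phi y ^+ 2) ^+ 2)) -
   (phi1 y * (T y / phi y ^+ 2)) ^+ 2 = phi1 y ^+ 2 / (phi y ^+ 2) ^+ 2 * (h y * D y).
  by rewrite /D /A /T; field; rewrite P H gt_eqF.
have sq0 : 0 < phi y ^+ 2 by rewrite exprn_even_gt0.
apply: mulr_gt0; first by apply: divr_gt0; exact: exprn_gt0.
move: y1; rewrite neq_lt => /orP[y1|y1].
  by rewrite -mulrNN mulr_gt0 ?oppr_gt0 ?weighted_lt0 ?D_lt0.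
by rewrite mulr_gt0 ?weighted_gt0 ?D_gt0.
Qed.

Theorem weighted_mean_strictly_log_convex : exists r1 r2 : R -> R, forall y : R, 0 < y ->
  [/\ is_derive y (1 : R) q (r1 y), is_derive y (1 : R) r1 (r2 y), 0 < q y, r1 y < 0 &
      r1 y ^+ 2 < q y * r2 y].
Proof.
exists q1, q2 => y y0; split.
- exact: dq.
- exact: dq1.
- exact: q_gt0.
- exact: q1_lt0.
- exact: q_log_convex.
Qed.

End WeightedMean.

(** * Oriented integrals and differentiability classes *)

Section OrientedIntegral.
Variable R : realType.
Notation mu := (@lebesgue_measure R).

Lemma oriented_integral_id (a : R) (g : R -> R) : oriented_integral a a g = 0.
Proof. by rewrite /oriented_integral lexx set_itv1 Rintegral_set1. Qed.

Lemma dv_oriented_integral (a : R) (g : R -> R) : 0 < a ->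
  (forall y : R, 0 < y -> {for y, continuous g}) ->
  forall y : R, 0 < y -> is_derive y (1 : R) (fun y => oriented_integral a y g) (g y).
Proof.
move=> a0 gc y y0; pose b := Num.min a y / 2.
have m0 : 0 < Num.min a y by rewrite lt_min a0.
have b0 : 0 < b by rewrite divr_gt0.
have bm : b < Num.min a y by rewrite ltr_pdivrMr// ltr_pMr// ltr1n.
have [ba b_y] : b < a /\ b < y by move: bm; rewrite lt_min => /andP.
have ig s t : b <= s -> mu.-integrable `[s, t] (EFin \o g).
  move=> bs; apply: continuous_segment_integrable => x /andP[sx _]; apply: gc.
  exact: lt_le_trans b0 (le_trans bs sx).
have gy : {for y, continuous g} by exact: gc.
have yy : y < y + 1 by rewrite ltrDl.
have [dI DI] := continuous_FTC1_closed yy (ig b (y + 1) (lexx b)) b_y gy.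
have dF : is_derive y (1 : R) (fun x => \int[mu]_(t in `[b, x]) g t) (g y).
  by apply: DeriveDef; [exact: dI|rewrite -derive1E].
have := dvB dF (dv_cst (\int[mu]_(t in `[b, a]) g t) y); rewrite subr0.
move=> /dv_near; apply; apply/nbhs_ballP; exists (y - b).
  by rewrite /= subr_gt0.
move=> x; rewrite /ball/= ltr_norml => /andP[_ h].
have bx : b <= x by lra.
rewrite /oriented_integral; case: leP => ax.
  rewrite (@Rintegral_chasles _ g b a x) ?(ltW ba)//; last exact: ig.
  by rewrite addrC addKr.
rewrite (@Rintegral_chasles _ g b x a) ?bx ?(ltW ax)//; last exact: ig.
by rewrite opprD addrA subrr add0r.
Qed.

End OrientedIntegral.

Lemma Dclass_is_derive (R : realType) (n k : nat) (g : R -> R) (y : R) :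
  Dclass n `]0, +oo[ g -> (k < n)%N -> 0 < y ->
  is_derive y (1 : R) (derive1n k g) (derive1n k.+1 g y).
Proof.
move=> gD kn y0; apply: DeriveDef; last by rewrite [RHS]/= derive1E.
by apply: gD => //; rewrite /= in_itv/= y0.
Qed.

Lemma near_gt0 (R : realType) (y : R) (P : R -> Prop) : 0 < y ->
  (forall s, 0 < s -> P s) -> \forall s \near y, P s.
Proof.
move=> y0 HP; apply/nbhs_ballP; exists y => // s.
by rewrite /ball/= ltr_norml => /andP[_ h]; apply: HP; lra.
Qed.

Lemma Dclass2 (R : realType) (g g1 g2 : R -> R) :
  (forall y : R, 0 < y -> is_derive y (1 : R) g (g1 y)) ->
  (forall y : R, 0 < y -> is_derive y (1 : R) g1 (g2 y)) ->
  Dclass 2 `]0, +oo[ g /\ forall y, 0 < y -> derive1 g y = g1 y /\ derive1n 2 g y = g2 y.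
Proof.
move=> dg dg1.
have gE y : 0 < y -> derive1 g y = g1 y by move=> /dg/dv_derive1.
have dg' (y : R) : 0 < y -> is_derive y (1 : R) (derive1 g) (g2 y).
  move=> y0; apply: dv_near (dg1 y y0) _.
  by apply: near_gt0 => // s /gE.
split=> [[|[|//]] _ y|y y0].
- by rewrite /= in_itv/= andbT => /dg[].
- by rewrite /= in_itv/= andbT => /dg'[].
- by split; [exact: gE|rewrite -(dv_derive1 (dg' y y0))].
Qed.

Lemma dv_ln_comp (R : realType) (g : R -> R) (y l : R) : 0 < g y ->
  is_derive y (1 : R) g l -> is_derive y (1 : R) (fun y => ln (g y)) (l / g y).
Proof.
move=> g0 gl; apply: dv_eq (dv_comp (is_derive1_ln g0) gl) _.
by rewrite mulrC.
Qed.

Lemma hardy_mean_facts (R : realType) (p : R) (f : R[i] -> R[i]) (M : R -> R) :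
  2 <= p -> hardy p f -> (exists2 z : R[i], upper_half_plane z & f z != 0) ->
  (forall y : R, 0 < y -> (M y)%:E = line_integral_pow p f y) ->
  exists M1 M2 : R -> R, forall y : R, 0 < y ->
   [/\ is_derive y (1 : R) M (M1 y), is_derive y (1 : R) M1 (M2 y),
     0 < M y, M1 y < 0 & M1 y ^+ 2 <= M y * M2 y].
Proof.
move=> p2 [holf supf] [z0 z0H fz0] hM.
have [f1 df] : exists f1, forall z, 0 < complex.Im z -> has_cderiv f z (f1 z).
  suff h z : exists l, 0 < complex.Im z -> has_cderiv f z l by have [f1] := choice h; exists f1.
  have [z0'|] := pselect (0 < complex.Im z); last by exists 0.
  by have [l] := derivable_has_cderiv (holf z z0'); exists l.
have [f2 df1] := half_plane_deriv df; have [f3 df2] := half_plane_deriv df1.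
have [K fK] : exists K, forall y, 0 < y -> (line_integral_pow p f y <= K%:E)%E.
  have ub y : 0 < y -> (line_integral_pow p f y <=
      ereal_sup [set line_integral_pow p f y | y in [set y : R | (0 < y)%R]])%E.
    by move=> y0; apply: ereal_sup_ubound; exists y.
  (* A real supremum serves as [K]; if it were [-oo], each line integral would be [-oo], hence below
     0. *)
  move: supf ub; case: (ereal_sup _) => [K _ ub|//|_ ub]; first by exists K.
  exists 0 => y /ub; rewrite leeNy_eq => /eqP ->; exact: leNye.
pose m := line_mean f p.
have mE y : 0 < y -> M y = m y.
  by move=> y0; apply/EFin_inj; rewrite hM// (line_meanE df df1 df2 p2 fK).
pose m1 := line_mean1 f f1 p; pose m2 := line_energy f f1 p.
have dm (y : R) : 0 < y -> is_derive y (1 : R) m (m1 y) by exact: (dv_line_mean df df1 df2 p2 fK).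
have dm1 (y : R) : 0 < y -> is_derive y (1 : R) m1 (m2 y) by exact: (dv_line_mean1 df df1 df2 p2 fK).
have m_ge0 y : 0 < y -> 0 <= m y by move=> _; exact: line_mean_ge0.
have m2_ge0 y : 0 < y -> 0 <= m2 y by move=> _; exact: line_energy_ge0.
have m_le y : 0 < y -> m y <= K.
  by move=> y0; rewrite -lee_fin (line_meanE df df1 df2 p2 fK)//; exact: fK.
have m_log y : 0 < y -> m1 y ^+ 2 <= m y * m2 y.
  by exact: (line_mean_log_convex df df1 df2 p2 fK).
have m2_eq0 y : 0 < y -> m2 y = 0 -> m y = 0.
  by exact: (line_energy_eq0 df df1 df2 p2 fK).
(* If the mean vanished at this height, [f] would be 0 on the whole line through [z0]. From this one
   height, [log_convex_gt0] reaches all the others. *)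
have mz0 : 0 < m (complex.Im z0).
  rewrite lt_neqAle m_ge0// andbT eq_sym; apply/eqP => /(line_mean_eq0 df df1 df2 p2 fK z0H).
  by move=> /(_ (complex.Re z0)); case: z0 fz0 {z0H} => a b /eqP.
exists m1, m2 => y y0; split.
- by apply: dv_near (dm y y0) _; apply: near_gt0 => // s /mE.
- exact: dm1.
- by rewrite (mE y y0); exact: (log_convex_gt0 dm dm1 m_ge0 m2_ge0 m_le m_log z0H mz0).
- exact: (log_convex_derive_lt0 dm dm1 m_ge0 m2_ge0 m_le m_log m2_eq0 z0H mz0).
- by rewrite (mE y y0); exact: m_log.
Qed.

Theorem theorem12 (R : realType) (p : R) (f : R[i] -> R[i]) (M phi h : R -> R)
  (hp : 2 <= p)
  (hf : hardy p f)
  (hf0 : exists2 z : R[i], upper_half_plane z & f z != 0)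
  (hM : forall y : R, 0 < y -> (M y)%:E = line_integral_pow p f y)
  (phiD3 : Dclass 3 `]0, +oo[ phi)
  (phi_int : forall y : R, 0 < y -> phi y = oriented_integral 1 y (derive1 phi))
  (phi'_gt0 : forall y : R, 0 < y -> 0 < derive1 phi y)
  (phi_ineq : forall y : R, 0 < y ->
     derive1 phi y ^+ 2 * derive1n 2 phi y + phi y * derive1 phi y * derive1n 3 phi y
       - 2 * phi y * derive1n 2 phi y ^+ 2 <= 0)
  (h_int : forall y : R, 0 < y ->
     h y = oriented_integral 1 y (fun t : R => derive1 phi t * M t)) :
  let q := extend_at 1 (M 1) (fun y : R => h y / phi y) in
  let logq := fun y : R => ln (q y) in
  [/\ h y / phi y @[y --> (1 : R)^'] --> M 1,
      forall y : R, 0 < y -> 0 < q y,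
      Dclass 2 `]0, +oo[ q /\ Dclass 2 `]0, +oo[ logq,
      forall y : R, 0 < y -> derive1 q y < 0 &
      forall y : R, 0 < y -> 0 < derive1n 2 logq y].
Proof.
have [M1 [M2 hM12]] := hardy_mean_facts hp hf hf0 hM.
have dM (y : R) : 0 < y -> is_derive y (1 : R) M (M1 y) by move=> /hM12[].
have dM1 (y : R) : 0 < y -> is_derive y (1 : R) M1 (M2 y) by move=> /hM12[].
have M_gt0 (y : R) : 0 < y -> 0 < M y by move=> /hM12[].
have M1_lt0 (y : R) : 0 < y -> M1 y < 0 by move=> /hM12[].
have M_log (y : R) : 0 < y -> M1 y ^+ 2 <= M y * M2 y by move=> /hM12[].
have dphi (y : R) : 0 < y -> is_derive y (1 : R) phi (derive1 phi y).
  exact: (Dclass_is_derive (k := 0) phiD3).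
have dphi1 (y : R) : 0 < y -> is_derive y (1 : R) (derive1 phi) (derive1n 2 phi y).
  exact: (Dclass_is_derive (k := 1) phiD3).
have dphi2 (y : R) : 0 < y -> is_derive y (1 : R) (derive1n 2 phi) (derive1n 3 phi y).
  exact: (Dclass_is_derive (k := 2) phiD3).
have dh (y : R) : 0 < y -> is_derive y (1 : R) h (derive1 phi y * M y).
  have gc (t : R) : 0 < t -> {for t, continuous (fun t : R => derive1 phi t * M t)}.
    by move=> t0; exact: dv_cont (dvM (dphi1 t t0) (dM t t0)).
  move=> y0; apply: dv_near (dv_oriented_integral ltr01 gc y0) _.
  by apply: near_gt0 => // s /h_int ->.
have phi1 : phi 1 = 0 by rewrite phi_int// oriented_integral_id.
have h1 : h 1 = 0 by rewrite h_int// oriented_integral_id.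
move=> q logq.
have [q1 [q2 hq]] := weighted_mean_strictly_log_convex dphi dphi1 dphi2 dh dM dM1
  phi1 h1 phi'_gt0 M_gt0 M1_lt0 M_log phi_ineq.
have q_gt0 y : 0 < y -> 0 < q y by move=> /hq[].
have dq (y : R) : 0 < y -> is_derive y (1 : R) q (q1 y) by move=> /hq[].
have dq1 (y : R) : 0 < y -> is_derive y (1 : R) q1 (q2 y) by move=> /hq[].
have [qD qE] := Dclass2 dq dq1.
have dl (y : R) : 0 < y -> is_derive y (1 : R) logq (q1 y / q y).
  by move=> y0; apply: dv_ln_comp; [exact: q_gt0|exact: dq].
have dl1 (y : R) : 0 < y -> is_derive y (1 : R) (fun y => q1 y / q y)
    ((q2 y * q y - q1 y * q1 y) / q y ^+ 2).
  by move=> y0; apply: (dvdiv (lt0r_neq0 (q_gt0 y y0)) (dq1 y y0) (dq y y0)).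
have [lD lE] := Dclass2 dl dl1.
split.
- exact: (weighted_mean_cvg dphi dh phi1 h1 phi'_gt0).
- exact: q_gt0.
- by split.
- by move=> y y0; have [-> _] := qE y y0; case: (hq y y0).
- move=> y y0; have [_ ->] := lE y y0.
  have [_ _ qy _ lc] := hq y y0.
  by rewrite divr_gt0 ?exprn_gt0// subr_gt0 -expr2 mulrC.
Qed.
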